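(* The transformation $f\mapsto g$ given by $$g(z)=z^{-1}f'(0)^{-1/2}\,(f(z)-f(0)-f'(0)z)\,(f(z)-f(0))^{-1}f'(0)^{1/2}$$ $$\phantom{g(z)}=z^{-1}f'(0)^{1/2}\,(f(z)-f(0))^{-1}(f(z)-f(0)-f'(0)z)\,f'(0)^{-1/2},$$ where $f'(0)^{1/2}$ is the non-negative definite square root of $f'(0)$, satisfies the following properties: (i) If $f\in\mathfrak{N}_1(0)$ is non-degenerate, then $g$ is a Nevanlinna function. (ii) If $r\ge2$ and $f\in\mathfrak{N}_r(0)$ is non-degenerate, then $g\in\mathfrak{N}_{r-2}(0)$. As a consequence, the Schur algorithm $$f_0=f,\qquad f_{n+1}(z)=z^{-1}a_n^{-1}(f_n(z)-b_n-a_n^2z)(f_n(z)-b_n)^{-1}a_n=z^{-1}a_n(f_n(z)-b_n)^{-1}(f_n(z)-b_n-a_n^2z)a_n^{-1},$$ with $b_n=f_n(0)$, $a_n=f_n'(0)^{1/2}$, $n\ge0$ (which in the scalar case reads $f_{n+1}(z)=\frac1z\frac{f_n(z)-b_n-a_n^2z}{f_n(z)-b_n}$), is valid for every $f\in\mathfrak{N}_\infty(0)$, and in this case it generates finitely or infinitely many Nevanlinna iterates $f_n$ depending on whether a degenerate iterate arises or not (the algorithm stops at a degenerate iterate).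
   Context: A matrix valued Nevanlinna function is an analytic function $f$ on $\mathbb{C}\setminus\mathbb{R}$ with values in complex square matrices of a fixed size such that $f(z)^\dagger=f(\overline z)$ and $\operatorname{Im}f(z)/\operatorname{Im}z\ge0$ for all $z\in\mathbb{C}\setminus\mathbb{R}$, where $\operatorname{Im}A=(A-A^\dagger)/(2i)$. For such $f$ the subspace $\ker\operatorname{Im}f(z)$ does not depend on $z\in\mathbb{C}\setminus\mathbb{R}$; $f$ is called non-degenerate if this kernel is trivial, and degenerate otherwise. For $x\in\mathbb{R}$ and an integer $r\ge0$, $\mathfrak{N}_r(x)$ is the set of matrix valued Nevanlinna functions $f$ with $r$-th normal derivative at $x$, i.e. such that the following limits (with $y$ real) exist: $f^{(0)}(x)=f(x):=\lim_{y\to0}f(x+iy)$ and $f^{(k)}(x):=\lim_{y\to0}\frac{f^{(k-1)}(x+iy)-f^{(k-1)}(x)}{iy}$ for $k=1,\dots,r$, where $f^{(k-1)}(x+iy)$ for $y\ne0$ is the usual derivative. $\mathfrak{N}_\infty(x)$ is the set of those $f$ for which all these normal derivatives ($k\ge0$) exist. The values $f(0)$, $f'(0)$ denote the normal limit and normal derivative at $0$. *)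

(* Defs.v *)
From HB Require Import structures.
From mathcomp Require Import all_boot all_order all_algebra.
From mathcomp Require Import sesquilinear spectral complex.
From mathcomp Require Import all_classical all_reals all_analysis.

Set Implicit Arguments.
Unset Strict Implicit.
Unset Printing Implicit Defensive.

Import Order.TTheory GRing.Theory Num.Theory.
Import numFieldNormedType.Exports.

Local Open Scope classical_set_scope.
Local Open Scope ring_scope.
Local Open Scope sesquilinear_scope.

(* [R[i]] as a [numClosedFieldType]; it is through this structure that it gets
   the norm topology of numFieldNormedType. *)
Definition Cplx (R : realType) : numClosedFieldType := complex R.

Section Defs.
Variables (R : realType) (d : nat).
Local Notation C := (Cplx R).
Implicit Types (f : C -> 'M[C]_d) (A B S : 'M[C]_d) (x y : R) (z : C).

(* The point x + iy. *)
Definition cpt x y : C := Complex x y.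

Definition Im_mx A : 'M[C]_d := (2 * 'i)^-1 *: (A - A ^t*).

Definition psdmx A : Prop :=
  A \is hermsymmx /\ forall v : 'cV[C]_d, 0 <= (v ^t* *m A *m v) 0 0.

(* Functions on C \ R are total functions on C; their values on the real line
   are irrelevant: nothing below depends on them. *)
Definition nevanlinna f : Prop :=
  [/\ forall z, z \isn't Num.real -> derivable f z 1,
      forall z, z \isn't Num.real -> (f z) ^t* = f z^*
    & forall z, z \isn't Num.real -> psdmx (('Im z)^-1 *: Im_mx (f z))].

(* The kernel of Im f(z) does not depend on z for f Nevanlinna, so that it is
   trivial for all non-real z or for none. *)
Definition nondegen f : Prop :=
  forall z, z \isn't Num.real ->
    forall v : 'cV[C]_d, Im_mx (f z) *m v = 0 -> v = 0.

Definition degen f : Prop := ~ nondegen f.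

(* The function of y whose limit as y -> 0, y <> 0, is f^(k)(x). *)
Fixpoint nquot f x (k : nat) : R -> 'M[C]_d :=
  match k with
  | 0 => fun y => f (cpt x y)
  | k'.+1 => fun y =>
      (cpt 0 y)^-1 *: (derive1n k' f (cpt x y) - lim (nquot f x k' @ (0 : R)^'))
  end.

(* The normal derivative f^(k)(x); it is meaningful when the limit exists. *)
Definition nderiv f x (k : nat) : 'M[C]_d := lim (nquot f x k @ (0 : R)^').

Definition Nclass (r : nat) x : set (C -> 'M[C]_d) :=
  [set f | nevanlinna f /\ forall k, (k <= r)%N -> cvg (nquot f x k @ (0 : R)^')].

Definition Nclass_oo x : set (C -> 'M[C]_d) :=
  [set f | nevanlinna f /\ forall k, cvg (nquot f x k @ (0 : R)^')].

(* The non-negative definite square root (0 if there is none). *)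
Definition psd_sqrt A : 'M[C]_d := xget 0 [set S | psdmx S /\ S *m S = A].

Definition schur_expr1 (b c a : 'M[C]_d) f z : 'M[C]_d :=
  z^-1 *: (invmx a *m (f z - b - z *: c) *m invmx (f z - b) *m a).

Definition schur_expr2 (b c a : 'M[C]_d) f z : 'M[C]_d :=
  z^-1 *: (a *m invmx (f z - b) *m (f z - b - z *: c) *m invmx a).

(* All the inverses in the two expressions exist, and the expressions agree
   off the real line; [invmx] returns a singular matrix unchanged. *)
Definition schur_expr_valid (b c a : 'M[C]_d) f : Prop :=
  [/\ a \in unitmx,
      forall z, z \isn't Num.real -> f z - b \in unitmx
    & forall z, z \isn't Num.real ->
        schur_expr1 b c a f z = schur_expr2 b c a f z].

Definition schur_transform f : C -> 'M[C]_d :=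
  schur_expr1 (nderiv f 0 0) (nderiv f 0 1) (psd_sqrt (nderiv f 0 1)) f.

Definition schur_b f : 'M[C]_d := nderiv f 0 0.
Definition schur_a f : 'M[C]_d := psd_sqrt (nderiv f 0 1).

Definition schur_step f : C -> 'M[C]_d :=
  schur_expr1 (schur_b f) (schur_a f *m schur_a f) (schur_a f) f.

(* The n-th iterate; [None] if the algorithm has stopped before reaching it. *)
Fixpoint schur_iter f (n : nat) : option (C -> 'M[C]_d) :=
  match n with
  | 0 => Some f
  | n'.+1 =>
      if schur_iter f n' is Some h then
        if `[< nondegen h >] then Some (schur_step h) else None
      else None
  end.

End Defs.

(* Main.v *)
Require Import Defs.
From mathcomp Require Import all_boot all_order all_algebra.
From mathcomp Require Import sesquilinear spectral complex.
From mathcomp Require Import all_classical all_reals all_analysis.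
From mathcomp Require Import ring lra.
Set Implicit Arguments.
Unset Strict Implicit.
Unset Printing Implicit Defensive.
Import Order.TTheory GRing.Theory Num.Theory.
Import numFieldNormedType.Exports.
Local Open Scope classical_set_scope.
Local Open Scope ring_scope.
Import ComplexField.Normc.

(** Let [b] and [c = a^2] be the normal value and the normal derivative of [f]
    at [0].  Expanding the product shows that both expressions of the transform
    are [g z = 1/z - a (f z - b)^-1 a] ([schur_transformE]).

    That [g] is a Nevanlinna function is an inequality of Pick type.  For
    [h = f z - b], [N = Im f(z) / Im z] and [u = h^-1 a v], the form of
    [Im g(z) / Im z] at [v] is that of [N] at [u] minus [|v|^2 / |z|^2]
    ([schur_dot]), so what is needed is
    [|x^* h u|^2 <= (x^* c x) (u^* N u) |z|^2] for [x = a^-1 v]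
    ([boundary_pick]).  This is the limit, as [w = iy] tends to [0], of the
    inequality [pick_inequality] between two points [z] and [w] of a half-plane.
    The latter holds because [(f z - f w) (f z - (f w)^* )^-1] is a contraction
    for the norm given by the inverse of [Im f(w) / Im w] and vanishes at [w]:
    the lemma of Schwarz improves the bound by [|z - w| / |z - conj w|].  The
    same inequality shows that [c] is invertible, and hence [a].

    The function theory rests on the maximum principle alone.  If [F] is
    holomorphic near [p] except perhaps at [p], where it is continuous, then
    [Im F] has no strict local maximum at [p]: in the coordinates
    [p + e^(s+it)] the theorem of Goursat on rectangles makes the mean of
    [Im F] over circles about [p] independent of the radius ([no_strict_max]).  From
    this follow the maximum modulus principle with exceptional points
    ([max_modulus]), hence the lemma of Schwarz ([schwarz_half_plane]), and,
    by bounding divided differences, the holomorphy of the derivative of a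
    holomorphic function ([derivable_derive1]).

    For the normal derivatives, [taylor J m u] says that [u] has an expansion
    of order [m] along the imaginary axis whose remainder may be hit [J] times
    by [theta = z d/dz].  These functions form an algebra closed under the
    inversion of functions with nonzero limit ([taylor_inv]).  If [f] has [r]
    normal derivatives at [0], then the entries of [q = (f - b) / z] belong to
    the class with [J = m = r - 1] ([taylor_of_normal_data]): an expansion of
    the derivative can be integrated because [u = c0 + c1 z + z^2 s] makes
    [s] a solution of the Euler equation [z s' + 2 s = (u' - c1) / z], whose
    right-hand side is known by induction ([euler_taylor]).  Since
    [g = z^-1 (1 - a q^-1 a)], where the parenthesis tends to
    [1 - a c^-1 a = 0], one more order is lost and [g] has [r - 2] normal
    derivatives ([nquot_of_taylor]).

    The algorithm then runs as long as its iterates are non-degenerate, each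
    of them having all its normal derivatives at [0]. *)

(** * Limits and derivatives of matrices, entry by entry *)

Lemma cvg_dnbhs_eq (K : numFieldType) (U : topologicalType) (f g : K -> U) a (l : U) :
  (forall x, x != a -> f x = g x) ->
  f x @[x --> a^'] --> l -> g x @[x --> a^'] --> l.
Proof.
move=> fg fl P Pl; have : \forall x \near a, x != a -> P (f x) := fl P Pl.
change ((\forall x \near a, x != a -> P (f x)) -> \forall x \near a, x != a -> P (g x)).
by apply: filterS => x H xa; rewrite -fg//; exact: H.
Qed.

Section ScalarLimits.
Variables (K : numFieldType) (T : Type) (F : set_system T).
Context {FF : Filter F}.
Implicit Types (f g : T -> K) (a b : K).

Lemma cvg_const a : (fun=> a) x @[x --> F] --> a.
Proof. exact: cvg_cst. Qed.

Lemma cvg_add f g a b : f x @[x --> F] --> a -> g x @[x --> F] --> b ->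
  f x + g x @[x --> F] --> a + b.
Proof. exact: cvgD. Qed.

Lemma cvg_sub f g a b : f x @[x --> F] --> a -> g x @[x --> F] --> b ->
  f x - g x @[x --> F] --> a - b.
Proof. exact: cvgB. Qed.

Lemma cvg_mul f g a b : f x @[x --> F] --> a -> g x @[x --> F] --> b ->
  f x * g x @[x --> F] --> a * b.
Proof. exact: cvgM. Qed.

Lemma cvg_sqr_norm f a : f x @[x --> F] --> a -> `|f x| ^+ 2 @[x --> F] --> `|a| ^+ 2.
Proof. by move=> fa; apply: cvgM; exact: cvg_norm fa. Qed.

End ScalarLimits.

Section MatrixLimits.
Variables (K : numFieldType) (m n : nat).

Lemma cvg_entries T (F : set_system T) {FF : Filter F} (A : T -> 'M[K]_(m, n))
    (A0 : 'M[K]_(m, n)) :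
  A x @[x --> F] --> A0 <-> forall i j, A x i j @[x --> F] --> A0 i j.
Proof.
split=> [cA i j|cA].
  by apply: (@cvg_comp _ _ _ A (fun M : 'M[K]_(m, n) => M i j) F _ _ cA); exact: coord_continuous.
apply/cvg_ballP => e e0.
have near_ij (k : 'I_m * 'I_n) : \forall x \near F, ball (A0 k.1 k.2) e (A x k.1 k.2).
  by have /cvg_ballP := cA k.1 k.2; exact.
have near_all := filter_forall _ near_ij.
near=> x.
have xP : forall k : 'I_m * 'I_n, ball (A0 k.1 k.2) e (A x k.1 k.2).
  by near: x; exact: near_all.
by split=> // i j; exact: (xP (i, j)).
Unshelve. all: by end_near. Qed.

Lemma derivable_entries (A : K -> 'M[K]_(m, n)) (z : K) :
  derivable A z 1 <-> forall i j, derivable (fun x => A x i j) z 1.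
Proof.
split=> [/cvg_ex[/= L /cvg_entries cL] i j|dA]; apply/cvg_ex.
  exists (L i j); have := cL i j.
  by rewrite (_ : (fun _ => _ i j) = fun h => h^-1 *: (A (h *: 1 + z) i j - A z i j)) //; apply/funext => h; rewrite !mxE.
exists (\matrix_(i, j) 'D_1 (fun x => A x i j) z); apply/cvg_entries => i j.
have cD : (fun h => h^-1 *: (A (h *: 1 + z) i j - A z i j)) @ 0^' --> 'D_1 (fun x => A x i j) z := dA i j.
rewrite mxE; apply: cvg_trans cD; apply: near_eq_cvg.
by near=> h; rewrite /= !mxE.
Unshelve. all: by end_near. Qed.

Lemma derive1_entries (A : K -> 'M[K]_(m, n)) (z : K) i j : derivable A z 1 ->
  (derive1 A z) i j = derive1 (fun x => A x i j) z.
Proof.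
move=> dA; rewrite !derive1E; apply/esym/cvg_lim; first exact: norm_hausdorff.
have cD : (fun h => h^-1 *: (A (h *: 1 + z) - A z)) @ 0^' --> 'D_1 A z := dA.
have /cvg_entries/(_ i j) := cD.
by rewrite (_ : (fun _ => _ i j) = fun h => h^-1 *: (A (h *: 1 + z) i j - A z i j)) //;
  apply/funext => h; rewrite !mxE.
Qed.

End MatrixLimits.

(** * The theorem of Goursat on rectangles *)

Section Goursat.
Variable R : realType.
Implicit Types a b c d s t x y l h e : R.

Lemma mvt_is_derive (f df : R -> R) a b : a <= b ->
  (forall x, a <= x <= b -> is_derive x 1 f (df x)) ->
  exists2 x, a <= x <= b & f b - f a = df x * (b - a).
Proof.
move=> ab fD; have [||x xab ->] := @MVT_segment R f df a b ab.
- by move=> x; rewrite in_itv/= => /andP[ax xb]; apply: fD; rewrite !ltW.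
- apply: derivable_within_continuous => x; rewrite in_itv/= => xab.
  by have [] := fD x xab.
- by exists x => //; rewrite in_itv/= in xab.
Qed.

Lemma nested_intervals (x : R^nat) (l : R) :
  (forall n, x n <= x n.+1 /\ x n.+1 + l / 2 ^+ n.+1 <= x n + l / 2 ^+ n) ->
  0 <= l -> exists z, forall n, x n <= z <= x n + l / 2 ^+ n.
Proof.
move=> xS l0.
have ndx m n : (m <= n)%N ->
    x m <= x n /\ x n + l / 2 ^+ n <= x m + l / 2 ^+ m.
  elim: n => [|n IH]; first by rewrite leqn0 => /eqP->.
  rewrite leq_eqVlt => /predU1P[->//|]; rewrite ltnS => /IH[mn nm].
  have [le1 le2] := xS n.
  by split; [exact: le_trans le1|exact: le_trans le2 nm].
have lt0 n : 0 <= l / 2 ^+ n by rewrite divr_ge0// exprn_ge0.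
have cross m n : x m <= x n + l / 2 ^+ n.
  have [/ndx[mn _]|/ltnW/ndx[_ nm]] := leqP m n.
    by apply: le_trans mn _; rewrite lerDl.
  by apply: le_trans nm; rewrite lerDl.
have hx : has_sup (range x).
  split; first by exists (x 0%N); exists 0%N.
  by exists (x 0%N + l / 2 ^+ 0) => _ [m _ <-].
exists (sup (range x)) => n; apply/andP; split.
  by apply: sup_upper_bound => //; exists n.
by apply: ge_sup => [|_ [m _ <-]//]; case: hx.
Qed.

Lemma halves_small (l e : R) : 0 < e -> exists n, l / 2 ^+ n < e.
Proof.
move=> e0; have [l0|l0] := lerP 0 l; last first.
  by exists 0%N; rewrite expr0 divr1; apply: lt_trans e0.
have := archi_boundP (divr_ge0 l0 (ltW e0)); set n := Num.bound _ => ln.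
exists n; rewrite ltr_pdivrMr ?exprn_gt0// -ltr_pdivrMl// mulrC.
by apply: lt_le_trans ln _; rewrite -natrX ler_nat ltnW// ltn_expl.
Qed.

Lemma dist_in_itv (x l s s' : R) : x <= s <= x + l -> x <= s' <= x + l ->
  `|s' - s| <= l.
Proof. by move=> /andP[? ?] /andP[? ?]; rewrite ler_norml; apply/andP; split; lra. Qed.

Lemma dist_sub (o p q a b d e : R) :
  `|p - o - a| <= e -> `|q - o - b| <= e -> a - b = d ->
  `|p - q - d| <= e + e.
Proof.
move=> pa qb <-; have -> : p - q - (a - b) = (p - o - a) - (q - o - b) by ring.
by apply: le_trans (ler_normB _ _) _; apply: lerD.
Qed.

Variables U V PU PV : R -> R -> R.
Variables a0 b0 c0 d0 : R.
Hypothesis a0b0 : a0 <= b0.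
Hypothesis c0d0 : c0 <= d0.
Hypothesis dPU : forall s t, a0 <= s <= b0 -> is_derive s 1 (PU t) (U s t).
Hypothesis dPV : forall s t, c0 <= t <= d0 -> is_derive t 1 (PV s) (V s t).
(** [U + iV] is differentiable in the complex sense, with derivative
    [al + i be]. *)
Hypothesis cauchy_riemann : forall s t, a0 <= s <= b0 -> c0 <= t <= d0 ->
  exists al be, forall e, 0 < e -> exists2 dl : R, 0 < dl &
    forall s' t', `|s' - s| < dl -> `|t' - t| < dl ->
      `|U s' t' - U s t - (al * (s' - s) - be * (t' - t))|
         <= e * (`|s' - s| + `|t' - t|) /\
      `|V s' t' - V s t - (be * (s' - s) + al * (t' - t))|
         <= e * (`|s' - s| + `|t' - t|).

(** The integral of [U ds - V dt], the real part of [(U + iV) (ds + i dt)],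
    along the boundary of [[a, b] x [c, d]].  It is expressed by primitives, so
    that the mean value theorem replaces estimates of integrals. *)
Definition rect_int a b c d :=
  (PU c b - PU c a) - (PU d b - PU d a) - (PV b d - PV b c) + (PV a d - PV a c).

(** The affine part of [U + iV] contributes nothing to the integral, by the
    Cauchy-Riemann equations, so that on a small rectangle about [(s, t)] only
    the remainder counts. *)
Lemma rect_int_small s t e : a0 <= s <= b0 -> c0 <= t <= d0 -> 0 < e ->
  exists2 dl : R, 0 < dl & forall x y l h, 0 <= l < dl -> 0 <= h < dl ->
    x <= s <= x + l -> y <= t <= y + h -> a0 <= x -> x + l <= b0 ->
    c0 <= y -> y + h <= d0 ->
    `|rect_int x (x + l) y (y + h)| <= e * (l + h) ^+ 2.
Proof.
move=> sab tcd e0; have [al [be CR]] := cauchy_riemann sab tcd.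
have e20 : 0 < e / 2 by rewrite divr_gt0.
have [dl dl0 {}CR] := CR _ e20.
exists dl => // x y l h /andP[l0 ldl] /andP[h0 hdl] sx ty.
move=> ax xb cy yd.
have [xi /andP[xi1 xi2] Exi] : exists2 xi, x <= xi <= x + l &
    (PU y (x + l) - PU y x) - (PU (y + h) (x + l) - PU (y + h) x) =
    (U xi y - U xi (y + h)) * l.
  have [||xi xiP] := @mvt_is_derive (PU y - PU (y + h))
    (fun s' => U s' y - U s' (y + h)) x (x + l).
  - by rewrite lerDl.
  - move=> s' /andP[s1 s2]; have s'ab : a0 <= s' <= b0 by apply/andP; split; lra.
    by have := dPU y s'ab; have := dPU (y + h) s'ab; move=> ? ?; apply: is_deriveB.
  have -> : x + l - x = l by ring.
  move=> E; exists xi => //; rewrite -E.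
  by rewrite !fctE; ring.
have [eta /andP[eta1 eta2] Eeta] : exists2 eta, y <= eta <= y + h &
    (PV (x + l) (y + h) - PV (x + l) y) - (PV x (y + h) - PV x y) =
    (V (x + l) eta - V x eta) * h.
  have [||eta etaP] := @mvt_is_derive (PV (x + l) - PV x)
    (fun t' => V (x + l) t' - V x t') y (y + h).
  - by rewrite lerDl.
  - move=> t' /andP[t1 t2]; have t'cd : c0 <= t' <= d0 by apply/andP; split; lra.
    by have := dPV x t'cd; have := dPV (x + l) t'cd; move=> ? ?; apply: is_deriveB.
  have -> : y + h - y = h by ring.
  move=> E; exists eta => //; rewrite -E.
  by rewrite !fctE; ring.
have near_s s' : x <= s' <= x + l -> `|s' - s| < dl /\ `|s' - s| <= l.
  by move=> s'P; have le_l := dist_in_itv sx s'P; split=> //; apply: le_lt_trans ldl.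
have near_t t' : y <= t' <= y + h -> `|t' - t| < dl /\ `|t' - t| <= h.
  by move=> t'P; have le_h := dist_in_itv ty t'P; split=> //; apply: le_lt_trans hdl.
have err s' t' : x <= s' <= x + l -> y <= t' <= y + h ->
    `|U s' t' - U s t - (al * (s' - s) - be * (t' - t))| <= e / 2 * (l + h) /\
    `|V s' t' - V s t - (be * (s' - s) + al * (t' - t))| <= e / 2 * (l + h).
  move=> /near_s[s1 s2] /near_t[t1 t2]; have [E1 E2] := CR _ _ s1 t1.
  by split; [apply: le_trans E1 _|apply: le_trans E2 _]; rewrite ler_pM2l ?divr_gt0// lerD.
have xi_in : x <= xi <= x + l by rewrite xi1.
have eta_in : y <= eta <= y + h by rewrite eta1.
have y_in : y <= y <= y + h by rewrite lexx lerDl.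
have yh_in : y <= y + h <= y + h by rewrite lexx lerDl h0.
have x_in : x <= x <= x + l by rewrite lexx lerDl.
have xl_in : x <= x + l <= x + l by rewrite lexx lerDl l0.
have [u1 _] := err _ _ xi_in y_in; have [u2 _] := err _ _ xi_in yh_in.
have [_ v1] := err _ _ x_in eta_in; have [_ v2] := err _ _ xl_in eta_in.
have -> : rect_int x (x + l) y (y + h) =
    (U xi y - U xi (y + h) - be * h) * l - (V (x + l) eta - V x eta - be * l) * h.
  transitivity ((U xi y - U xi (y + h)) * l - (V (x + l) eta - V x eta) * h); last by ring.
  by rewrite -Exi -Eeta /rect_int; ring.
apply: le_trans (ler_normB _ _) _; rewrite !normrM (ger0_norm l0) (ger0_norm h0).
have -> : e * (l + h) ^+ 2 = e * (l + h) * l + e * (l + h) * h by ring.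
apply: lerD; apply: ler_wpM2r => //.
  by apply: le_trans (dist_sub u1 u2 _) _; [ring|rewrite -mulrDl -splitr].
by apply: le_trans (dist_sub v2 v1 _) _; [ring|rewrite -mulrDl -splitr].
Qed.

Let lh := b0 - a0.
Let hh := d0 - c0.

(** Bisection: were the integral nonzero, one of the four quarters of each
    rectangle would carry at least a quarter of the integral, against
    [rect_int_small] at the common point of the nested rectangles. *)
Theorem goursat_rect : rect_int a0 b0 c0 d0 = 0.
Proof.
apply/eqP/negPn/negP; rewrite -normr_gt0 => K0.
have lh0 : 0 <= lh by rewrite subr_ge0.
have hh0 : 0 <= hh by rewrite subr_ge0.
(* The threshold of [bad] is met by the whole rectangle; it scales with the
   square of the size, that is by 1/4 when the rectangle is halved. *)
pose e := `|rect_int a0 b0 c0 d0| / ((lh + hh) ^+ 2 + 1) / 2.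
have sq0 : 0 < (lh + hh) ^+ 2 + 1 by rewrite ltr_wpDl// exprn_ge0// addr_ge0.
have e0 : 0 < e by rewrite !divr_gt0.
pose bad n (p : R * R) :=
  [/\ a0 <= p.1, p.1 + lh / 2 ^+ n <= b0, c0 <= p.2, p.2 + hh / 2 ^+ n <= d0 &
    e * (lh / 2 ^+ n + hh / 2 ^+ n) ^+ 2 <
    `|rect_int p.1 (p.1 + lh / 2 ^+ n) p.2 (p.2 + hh / 2 ^+ n)|].
pose next n (p q : R * R) := [/\ p.1 <= q.1,
   q.1 + lh / 2 ^+ n.+1 <= p.1 + lh / 2 ^+ n, p.2 <= q.2
   & q.2 + hh / 2 ^+ n.+1 <= p.2 + hh / 2 ^+ n].
have halve n p : bad n p -> exists q, bad n.+1 q /\ next n p q.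
  case: p => x y [/=]; rewrite /bad /next/=.
  set l := lh / _; set h := hh / _ => ax xb cy yd.
  have -> : lh / 2 ^+ n.+1 = l / 2 by rewrite exprS /l invfM; lra.
  have -> : hh / 2 ^+ n.+1 = h / 2 by rewrite exprS /h invfM; lra.
  have l0 : 0 <= l by rewrite divr_ge0// exprn_ge0.
  have h0 : 0 <= h by rewrite divr_ge0// exprn_ge0.
  move=> big; apply: contrapT => /forallNP none.
  have small x' y' : x' = x \/ x' = x + l / 2 -> y' = y \/ y' = y + h / 2 ->
      `|rect_int x' (x' + l / 2) y' (y' + h / 2)| <= e * (l / 2 + h / 2) ^+ 2.
    move=> x'E y'E; rewrite leNgt; apply/negP => big'.
    have [x1 x2] : x <= x' /\ x' + l / 2 <= x + l by case: x'E => ->; split; lra.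
    have [y1 y2] : y <= y' /\ y' + h / 2 <= y + h by case: y'E => ->; split; lra.
    apply: (none (x', y')); split; split => //=.
    - exact: le_trans ax x1.
    - exact: le_trans x2 xb.
    - exact: le_trans cy y1.
    - exact: le_trans y2 yd.
  have := small x y (or_introl erefl) (or_introl erefl).
  have := small (x + l / 2) y (or_intror erefl) (or_introl erefl).
  have := small x (y + h / 2) (or_introl erefl) (or_intror erefl).
  have := small (x + l / 2) (y + h / 2) (or_intror erefl) (or_intror erefl).
  have -> : x + l / 2 + l / 2 = x + l by lra.
  have -> : y + h / 2 + h / 2 = y + h by lra.
  have -> : l / 2 + h / 2 = (l + h) / 2 by lra.
  move: big; have -> : rect_int x (x + l) y (y + h) =
      rect_int (x + l / 2) (x + l) (y + h / 2) (y + h) +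
      rect_int x (x + l / 2) (y + h / 2) (y + h) +
      rect_int (x + l / 2) (x + l) y (y + h / 2) +
      rect_int x (x + l / 2) y (y + h / 2) by rewrite /rect_int; ring.
  set k1 := rect_int _ _ _ _; set k2 := rect_int _ _ _ _.
  set k3 := rect_int _ _ _ _; set k4 := rect_int _ _ _ _.
  rewrite exprMn exprVn => big s1 s2 s3 s4.
  have := ler_normD (k1 + k2 + k3) k4; have := ler_normD (k1 + k2) k3.
  have := ler_normD k1 k2.
  have sqE : e * ((l + h) ^+ 2 / 2 ^+ 2) = e * (l + h) ^+ 2 / 4 by field.
  by move: s1 s2 s3 s4; rewrite !sqE; lra.
pose fix p n : R * R := if n is m.+1 then
  xget (p m) [set q | bad n q /\ next m (p m) q] else (a0, c0).
have badp n : bad n (p n).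
  elim: n => [|n IH]; last first.
    by have /= := @xgetPex _ (p n) _ (halve _ _ IH) => -[].
  rewrite /bad/= expr0 !divr1 /lh /hh; split=> //; [lra|lra|].
  have -> : a0 + (b0 - a0) = b0 by lra.
  have -> : c0 + (d0 - c0) = d0 by lra.
  rewrite /e; set k := `| _ |; rewrite -/lh -/hh mulrAC ltr_pdivrMr// mulrAC.
  rewrite ltr_pdivrMr//; have := sqr_ge0 (lh + hh).
  by rewrite -/k in K0; nra.
have nextp n : next n (p n) (p n.+1).
  by have /= := @xgetPex _ (p n) _ (halve _ _ (badp n)) => -[].
have [s sP] : exists s, forall n, (p n).1 <= s <= (p n).1 + lh / 2 ^+ n.
  by apply: nested_intervals => // n; case: (nextp n).
have [t tP] : exists t, forall n, (p n).2 <= t <= (p n).2 + hh / 2 ^+ n.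
  by apply: nested_intervals => // n; case: (nextp n).
have sab : a0 <= s <= b0.
  have /= := sP 0%N; rewrite expr0 divr1 /lh => /andP[? ?]; apply/andP; split; lra.
have tcd : c0 <= t <= d0.
  have /= := tP 0%N; rewrite expr0 divr1 /hh => /andP[? ?]; apply/andP; split; lra.
have [dl dl0 small] := rect_int_small sab tcd e0.
have [n nP] := halves_small (lh + hh) dl0.
have [ax xb cy yd] := badp n; apply/negP; rewrite -leNgt; apply: small => //.
  by rewrite divr_ge0 ?exprn_ge0//= (le_lt_trans _ nP)// ler_pM2r ?invr_gt0 ?exprn_gt0// lerDl.
by rewrite divr_ge0 ?exprn_ge0//= (le_lt_trans _ nP)// ler_pM2r ?invr_gt0 ?exprn_gt0// lerDr.
Qed.

End Goursat.

(** * Complex numbers as a plane *)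

Lemma derivable_expansion (K : numFieldType) (f : K -> K) (a e : K) :
  derivable f a 1 -> 0 < e ->
  \forall h \near 0, `|f (a + h) - f a - derive1 f a * h| <= e * `|h|.
Proof.
move=> df e0; rewrite derive1E.
have : (fun h => h^-1 *: (f (h *: 1 + a) - f a)) @ 0^' --> 'D_1 f a by exact: df.
move=> /cvgrPdist_le/(_ _ e0).
rewrite near_withinE => H; near=> h; have [->|h0] := eqVneq h 0.
  by rewrite addr0 subrr mulr0 subrr normr0 mulr0.
have /(_ h0) : h != 0 -> `|'D_1 f a - h^-1 *: (f (h *: 1 + a) - f a)| <= e.
  by near: h.
rewrite /GRing.scale/= mulr1 => le_e.
have -> : f (a + h) - f a - 'D_1 f a * h =
   - (('D_1 f a - h^-1 * (f (h + a) - f a)) * h).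
  by rewrite (addrC a h); field.
by rewrite normrN normrM ler_wpM2r.
Unshelve. all: by end_near. Qed.

Lemma derivable_continuous (K : numFieldType) (f : K -> K) (a : K) :
  derivable f a 1 -> {for a, continuous f}.
Proof.
by move=> df; apply: differentiable_continuous; apply/derivable1_diffP.
Qed.

Section ComplexTopology.
Variable R : realType.
Local Notation C := (Cplx R).
Local Notation Re := (@complex.Re R).
Local Notation Im := (@complex.Im R).
Implicit Types (z w p : C) (x y s r e : R).

Lemma normCE z : `|z| = ((normc z)%:C)%C.
Proof. by case: z. Qed.

Lemma nbhs_normcP p (P : set C) : nbhs p P <->
  exists2 r : R, 0 < r & forall z, normc (z - p) < r -> P z.
Proof.
split=> [/nbhs_normP[/= e e0 eP]|[r r0 rP]].
  move: e0 eP; case: e => e ei; rewrite ltcE/= => /andP[/eqP Ei e0] eP.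
  have {Ei} eE : (Complex e ei) = (e%:C)%C by rewrite Ei.
  rewrite {}eE in eP; exists e => // z ze; apply: eP; rewrite /ball_/= distrC.
  by rewrite normCE ltcR.
apply/nbhs_normP; exists (r%:C)%C => /=; first by rewrite ltcR.
by move=> z/=; rewrite distrC normCE ltcR => ?; exact: rP.
Qed.

Lemma nbhs_normrP x (P : set R) : nbhs x P <->
  exists2 r : R, 0 < r & forall y, `|y - x| < r -> P y.
Proof.
split=> [/nbhs_normP[/= e e0 eP]|[r r0 rP]].
  by exists e => // y ye; apply: eP; rewrite /ball_/= distrC.
by apply/nbhs_normP; exists r => //= y/=; rewrite distrC => ?; exact: rP.
Qed.

Lemma normc_Re_le z : `|Re z| <= normc z.
Proof. by have := normc_ge_Re z; rewrite lecE/= eqxx. Qed.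

Lemma normc_Im_le z : `|Im z| <= normc z.
Proof.
by case: z => x y /=; rewrite -[leLHS]sqrtr_sqr ler_wsqrtr// lerDr sqr_ge0.
Qed.

Lemma normc_le z : normc z <= `|Re z| + `|Im z|.
Proof.
case: z => x y /=; rewrite -[leRHS]ger0_norm ?addr_ge0// -sqrtr_sqr ler_wsqrtr//.
rewrite sqrrD !real_normK ?num_real// -addrA lerD2l lerDr.
by rewrite mulrn_wge0// mulr_ge0.
Qed.

Lemma normc_ge0 z : 0 <= normc z. Proof. by case: z => x y /=; exact: sqrtr_ge0. Qed.

Lemma continuous_cpt (T : topologicalType) (f g : T -> R) (a : T) :
  {for a, continuous f} -> {for a, continuous g} ->
  {for a, continuous (fun t => cpt (f t) (g t))}.
Proof.
move=> cf cg; apply/cvgrPdist_lt => e e0.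
have : nbhs (cpt (f a) (g a)) [set z | `|cpt (f a) (g a) - z| < e].
  by apply/nbhs_normP; exists e.
move=> /nbhs_normcP[r r0 rP].
have r20 : 0 < r / 2 by rewrite divr_gt0.
have /cvgrPdist_lt/(_ _ r20) nf := cf; have /cvgrPdist_lt/(_ _ r20) ng := cg.
near=> t; apply: rP; rewrite -(normcN _) opprB.
apply: le_lt_trans (normc_le _) _; rewrite (splitr r) ltrD//=.
  by near: t.
by near: t.
Unshelve. all: by end_near. Qed.

Lemma continuous_Re : continuous (Re : C -> R).
Proof.
move=> z; apply/(@cvgrPdist_lt R R C (nbhs z)) => e e0; apply/nbhs_normcP; exists e => // w wz.
by apply: le_lt_trans wz; rewrite distrC; have := normc_Re_le (w - z); case: w z => ? ? [].
Qed.

Lemma continuous_Im : continuous (Im : C -> R).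
Proof.
move=> z; apply/(@cvgrPdist_lt R R C (nbhs z)) => e e0; apply/nbhs_normcP; exists e => // w wz.
by apply: le_lt_trans wz; rewrite distrC; have := normc_Im_le (w - z); case: w z => ? ? [].
Qed.

Lemma primitive_exists (f : R -> R) (a b : R) : continuous f ->
  exists F : R -> R, forall x, a < x < b -> is_derive x 1 F (f x).
Proof.
move=> cf.
pose mu := @lebesgue_measure R.
exists (fun x => \int[mu]_(t in `[a, x]) f t)%R => x /andP[ax xb].
have intf : mu.-integrable `[a, b] (EFin \o f).
  by apply: continuous_compact_integrable; [exact: segment_compact|exact: continuous_subspaceT].
have [d1 d2] := continuous_FTC1_closed xb intf ax (cf x).
by apply: DeriveDef; [exact: d1|rewrite -derive1E; exact: d2].
Qed.

End ComplexTopology.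

(** * The local maximum principle *)

Section LogCoordinates.
Variable R : realType.
Local Notation C := (Cplx R).
Local Notation Re := (@complex.Re R).
Local Notation Im := (@complex.Im R).
Implicit Types (z w p : C) (x y s t r e : R).

Definition cexp s t : C := cpt (expR s * cos t) (expR s * sin t).

Lemma cexpD s t x y : cexp (s + x) (t + y) = cexp s t * cexp x y.
Proof.
rewrite /cexp /cpt expRD sinD cosD; apply/eqP; rewrite eq_complex /=.
by apply/andP; split; apply/eqP; ring.
Qed.

Lemma normc_cexp s t : normc (cexp s t) = expR s.
Proof.
by rewrite /cexp /= !exprMn -mulrDr cos2Dsin2 mulr1 sqrtr_sqr ger0_norm.
Qed.

Lemma cexp_neq0 s t : cexp s t != 0.
Proof.
apply/eqP => /(congr1 (@normc R)); rewrite normc_cexp normc0 => /eqP.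
by rewrite gt_eqF// expR_gt0.
Qed.

Lemma derivable_expansionR (f : R -> R) x d e : is_derive x 1 f d -> 0 < e ->
  exists2 r : R, 0 < r & forall h, `|h| < r -> `|f (x + h) - f x - d * h| <= e * `|h|.
Proof.
move=> fd e0; have [df <-] := fd.
have /nbhs_normrP[r r0 rP] := derivable_expansion df e0.
exists r => // h hr; rewrite -derive1E; apply: rP.
by rewrite subr0.
Qed.

Lemma cexp_expansion e : 0 < e -> exists2 r : R, 0 < r & forall x y,
  `|x| < r -> `|y| < r ->
  normc (cexp x y - 1 - cpt x y) <= e * (`|x| + `|y|).
Proof.
move=> e0; have e80 : 0 < e / 8 by rewrite divr_gt0.
have m_gt0 : 0 < Num.min 1 (e / 8) by rewrite lt_min ltr01.
have [r1 r10 P1] := derivable_expansionR (is_derive_expR 0) m_gt0.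
have [r2 r20 P2] := derivable_expansionR (is_derive_cos 0) m_gt0.
have [r3 r30 P3] := derivable_expansionR (is_derive_sin 0) m_gt0.
pose r := Num.min (Num.min r1 r2) (Num.min r3 (Num.min 1 (e / 8))).
have r0 : 0 < r by rewrite !lt_min r10 r20 r30 ltr01.
exists r => // x y; rewrite !lt_min => /and3P[/andP[xr1 xr2] xr3 /andP[x1 xe]].
move=> /and3P[/andP[yr1 yr2] yr3 /andP[y1 ye]].
have := P1 _ xr1; have := P2 _ yr2; have := P3 _ yr3.
rewrite !add0r sin0 cos0 expR0 oppr0 !mul0r !mul1r !subr0 addr0.
set m := Num.min 1 (e / 8).
have m1 : m <= 1 by rewrite ge_min lexx.
have me : m <= e / 8 by rewrite ge_min lexx orbT.
have m0 : 0 <= m by rewrite le_min ler01 ltW.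
move=> hs hc he.
apply: le_trans (normc_le _) _.
have -> : Re (cexp x y - 1 - cpt x y) =
  (expR x - 1 - x) * cos y + (1 + x) * (cos y - 1).
  by rewrite /cexp /cpt /=; ring.
have -> : Im (cexp x y - 1 - cpt x y) =
  (expR x - 1) * sin y + (sin y - y).
  by rewrite /cexp /cpt /=; ring.
have ax : 0 <= `|x| by []. have ay : 0 <= `|y| by [].
have hcos : `|cos y| <= 1 by rewrite ler_norml cos_geN1 cos_le1.
have b1 : `|(expR x - 1 - x) * cos y| <= e / 8 * `|x|.
  rewrite normrM -[leRHS]mulr1 ler_pM//.
  by apply: le_trans he _; rewrite ler_wpM2r.
have b2 : `|(1 + x) * (cos y - 1)| <= e / 4 * `|y|.
  have -> : e / 4 * `|y| = 2 * (e / 8 * `|y|) by field.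
  rewrite normrM ler_pM//.
    by apply: le_trans (ler_normD _ _) _; rewrite normr1 -[leRHS]/(1 + 1) lerD2l ltW.
  by apply: le_trans hc _; rewrite ler_wpM2r.
have b3 : `|(expR x - 1) * sin y| <= e / 2 * `|y|.
  have ex : `|expR x - 1| <= 2 * `|x|.
    have -> : expR x - 1 = (expR x - 1 - x) + x by ring.
    apply: le_trans (ler_normD _ _) _.
    have := ler_wpM2r ax m1; rewrite mul1r; lra.
  have sy : `|sin y| <= 2 * `|y|.
    have -> : sin y = (sin y - y) + y by ring.
    apply: le_trans (ler_normD _ _) _.
    have := ler_wpM2r ay m1; rewrite mul1r; lra.
  have ex' : `|expR x - 1| <= e / 4 by apply: le_trans ex _; lra.
  have -> : e / 2 * `|y| = e / 4 * (2 * `|y|) by field.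
  by rewrite normrM ler_pM.
have b4 : `|sin y - y| <= e / 8 * `|y|.
  by apply: le_trans hs _; rewrite ler_wpM2r.
have := ler_normD ((expR x - 1 - x) * cos y) ((1 + x) * (cos y - 1)).
have := ler_normD ((expR x - 1) * sin y) (sin y - y).
have := mulr_ge0 (ltW e0) ax; have := mulr_ge0 (ltW e0) ay.
by move: b1 b2 b3 b4; lra.
Qed.

Lemma continuous_cexp_s t : continuous (fun s => cexp s t).
Proof.
move=> s; apply: (@continuous_cpt R R (fun s => expR s * cos t) (fun s => expR s * sin t) s);
  apply: continuousM; rewrite /=;
  (exact: continuous_expR || exact: cst_continuous).
Qed.

Lemma continuous_cexp_t s : continuous (fun t => cexp s t).
Proof.
move=> t; apply: (@continuous_cpt R R (fun t => expR s * cos t) (fun t => expR s * sin t) t);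
  apply: continuousM; rewrite /=;
  (exact: cst_continuous || exact: continuous_cos || exact: continuous_sin).
Qed.

Lemma derivable_expansionC (F : C -> C) w e : derivable F w 1 -> 0 < e ->
  exists2 r : R, 0 < r & forall h, normc h < r ->
    normc (F (w + h) - F w - derive1 F w * h) <= e * normc h.
Proof.
move=> dF e0; have e0' : 0 < (e%:C)%C :> C by rewrite ltcR.
have /nbhs_normcP[r r0 rP] := derivable_expansion dF e0'.
exists r => // h hr; have := rP h; rewrite subr0 => /(_ hr).
by rewrite !normCE -rmorphM/= lecR.
Qed.

(** The chain rule for [F (p + e^(s+it))], as the pair of real expansions from
    which the theorem of Goursat starts. *)
Lemma log_cauchy_riemann (F : C -> C) p s t : derivable F (p + cexp s t) 1 ->
  exists al be, forall e, 0 < e -> exists2 dl : R, 0 < dl &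
    forall x y, `|x| < dl -> `|y| < dl ->
      normc (F (p + cexp (s + x) (t + y)) - F (p + cexp s t) -
        cpt (al * x - be * y) (be * x + al * y)) <= e * (`|x| + `|y|).
Proof.
set w := p + cexp s t => dF; pose D := derive1 F w; pose DE := D * cexp s t.
exists (Re DE), (Im DE) => e e0.
have es := expR_gt0 s.
pose e1 := e / (expR s * 4); have e10 : 0 < e1 by rewrite divr_gt0// mulr_gt0.
have DE0 := normc_ge0 DE.
pose e2 := Num.min 1 (e / (2 * (normc DE + 1))).
have e20 : 0 < e2 by rewrite lt_min ltr01/= divr_gt0// mulr_gt0// ltr_wpDl.
have [r1 r10 P1] := derivable_expansionC dF e10.
have [r2 r20 P2] := cexp_expansion e20.
have r30 : 0 < r1 / (expR s * 4) by rewrite divr_gt0// mulr_gt0.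
exists (Num.min r2 (r1 / (expR s * 4))); first by rewrite lt_min r20.
move=> x y; rewrite !lt_min => /andP[x2 x1] /andP[y2 y1].
have {P2} := P2 _ _ x2 y2; set n := `|x| + `|y|; set q := _ - cpt x y => qn.
have n0 : 0 <= n by rewrite addr_ge0.
have hE : cexp (s + x) (t + y) - cexp s t = cexp s t * (q + cpt x y).
  by rewrite cexpD /q; ring.
have hle : normc (cexp (s + x) (t + y) - cexp s t) <= expR s * (2 * n).
  rewrite hE normcM normc_cexp ler_pM2l//; apply: le_trans (le_normcD _ _) _.
  have := normc_le (cpt x y); rewrite /= -/n => c1.
  have e21 : e2 <= 1 by rewrite ge_min lexx.
  by have := ler_wpM2r n0 e21; rewrite mul1r; move: qn c1; rewrite /=; lra.
have hlt : normc (cexp (s + x) (t + y) - cexp s t) < r1.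
  apply: le_lt_trans hle _; have -> : r1 = expR s * (r1 / (expR s * 4) * 4).
    by field; rewrite gt_eqF.
  by rewrite ltr_pM2l// /n; move: x1 y1; lra.
have := P1 _ hlt; rewrite -/D.
have -> : w + (cexp (s + x) (t + y) - cexp s t) = p + cexp (s + x) (t + y).
  by rewrite /w; ring.
set f := F _ - F w; rewrite hE => fP.
have -> : f - cpt (Re DE * x - Im DE * y) (Im DE * x + Re DE * y) =
   (f - D * (cexp s t * (q + cpt x y))) + DE * q.
  have -> : cpt (Re DE * x - Im DE * y) (Im DE * x + Re DE * y) = DE * cpt x y.
    by case: (DE) => a b; rewrite /cpt; apply/eqP; rewrite eq_complex /= [in X in _ && X]addrC !eqxx.
  by rewrite /DE; ring.
apply: le_trans (le_normcD _ _) _; rewrite [normc (DE * q)]normcM.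
have b1 : e1 * normc (cexp s t * (q + cpt x y)) <= e / 2 * n.
  have -> : e / 2 * n = e1 * (expR s * (2 * n)) by rewrite /e1; field; rewrite gt_eqF.
  by rewrite ler_pM2l// -hE.
have b2 : normc DE * normc q <= e / 2 * n.
  apply: le_trans (_ : (normc DE + 1) * (e / (2 * (normc DE + 1)) * n) <= _).
    apply: ler_pM => //; [exact: normc_ge0|by rewrite lerDl|].
    by apply: le_trans qn _; rewrite ler_wpM2r// ge_min lexx orbT.
  rewrite le_eqVlt; apply/orP; left; apply/eqP; field.
  by rewrite gt_eqF// ltr_wpDl.
by move: fP b1 b2; lra.
Qed.

(** The local maximum principle.  In the coordinates [p + e^(s+it)], Goursat's
    theorem makes the mean of [Im (F - F p)] over a circle about [p]
    independent of the radius; it would be negative, yet tend to [0]. *)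
Lemma no_strict_max (F : C -> C) p :
  (\forall z \near p, z != p -> derivable F z 1) -> {for p, continuous F} ->
  ~ (\forall z \near p, z != p -> Im (F z) < Im (F p)).
Proof.
move=> /nbhs_normcP[r1 r10 dF] cF /nbhs_normcP[r2 r20 ltF].
pose r := Num.min r1 r2; have r0 : 0 < r by rewrite lt_min r10.
have r2_0 : 0 < r / 2 by rewrite divr_gt0.
pose s1 := ln (r / 2); have es1 : expR s1 = r / 2 by rewrite lnK// posrE.
(* The radius is truncated, so that [F] is defined and continuous along
   the whole of each line in the [s] direction. *)
pose zt s t := p + cexp (Num.min s s1) t.
have zt_p s t : zt s t != p.
  by rewrite -subr_eq0 /zt addrC addKr cexp_neq0.
have zt_r s t : normc (zt s t - p) < r.
  rewrite /zt addrC addKr normc_cexp.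
  apply: (@le_lt_trans _ _ (expR s1)); first by rewrite ler_expR ge_min lexx orbT.
  by rewrite es1; lra.
have dFzt s t : derivable F (zt s t) 1.
  by apply: dF => //; apply: lt_le_trans (zt_r s t) _; rewrite ge_min lexx.
have Fzt s t : Im (F (zt s t)) < Im (F p).
  by apply: ltF => //; apply: lt_le_trans (zt_r s t) _; rewrite ge_min lexx orbT.
have cFzt s t : {for zt s t, continuous F}.
  exact: (@derivable_continuous C F (zt s t) (dFzt s t)).
have czs t : continuous (fun s => zt s t).
  move=> s; apply: (@continuousD C C R (cst p) (fun s => cexp (Num.min s s1) t) s).
    exact: cst_continuous.
  apply: (@continuous_comp _ _ _ (fun s => Num.min s s1) (fun s => cexp s t)).
    by apply: continuous_min; [exact: cvg_id|exact: cst_continuous].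
  exact: continuous_cexp_s.
have czt s : continuous (zt s).
  move=> t; apply: (@continuousD C C R (cst p) (cexp (Num.min s s1)) t).
    exact: cst_continuous.
  exact: continuous_cexp_t.
pose U s t := Re (F (zt s t)).
pose V s t := Im (F (zt s t)) - Im (F p).
have cU t : continuous (fun s => U s t).
  move=> s; apply: (@continuous_comp _ _ _ (fun s => zt s t) (fun z => Re (F z))).
    exact: czs.
  by apply: (@continuous_comp _ _ _ F Re); [exact: cFzt|exact: continuous_Re].
have cV s : continuous (V s).
  move=> t; apply: (@continuousB _ _ _ (fun t => Im (F (zt s t))) (cst (Im (F p)))); last exact: cst_continuous.
  apply: (@continuous_comp _ _ _ (zt s) (fun z => Im (F z))).
    exact: czt.
  by apply: (@continuous_comp _ _ _ F Im); [exact: cFzt|exact: continuous_Im].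
pose b := s1 - 1; have bs1 : b < s1 by rewrite /b; lra.
have pi0 : 0 < pi *+ 2 :> R by rewrite mulrn_wgt0// pi_gt0.
have /choice[PV dPV] : forall s, exists P : R -> R, forall t,
    0 <= t <= pi *+ 2 -> is_derive t 1 P (V s t).
  move=> s; have [P dP] := primitive_exists (-1) (pi *+ 2 + 1) (cV s).
  by exists P => t /andP[? ?]; apply: dP; apply/andP; split; lra.
have meanV s : exists t, PV s (pi *+ 2) - PV s 0 = V s t * (pi *+ 2).
  have [t _ ->] := mvt_is_derive (ltW pi0) (dPV s).
  by exists t; rewrite subr0.
have J_const (a : R) : a <= b ->
    PV a (pi *+ 2) - PV a 0 = PV b (pi *+ 2) - PV b 0.
  move=> ab.
  have /choice[PU dPU] : forall t, exists P : R -> R, forall s,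
      a <= s <= b -> is_derive s 1 P (U s t).
    move=> t; have [P dP] := primitive_exists (a - 1) (b + 1) (cU t).
    by exists P => s /andP[? ?]; apply: dP; apply/andP; split; lra.
  have PU_per : PU 0 b - PU 0 a = PU (pi *+ 2) b - PU (pi *+ 2) a.
    have [|s _] := @mvt_is_derive _ (PU 0 - PU (pi *+ 2)) (cst 0) a b ab.
      move=> s sab; have := dPU 0 s sab; have := dPU (pi *+ 2) s sab => d1 d2.
      apply: is_derive_eq; rewrite /U /zt /cexp.
      by rewrite cos0 sin0 cos2pi sin2pi subrr.
    rewrite mul0r !fctE; lra.
  suff K0 : rect_int PU PV a b 0 (pi *+ 2) = 0.
    by move: K0; rewrite /rect_int PU_per; lra.
  apply: (@goursat_rect R U V PU PV a b 0 (pi *+ 2) ab (ltW pi0)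
    (fun s t => dPU t s) (fun s t => dPV s t)).
  move=> s t /andP[sa sb] _.
  have smin : Num.min s s1 = s by rewrite min_l// ltW// (le_lt_trans sb).
  have := dFzt s t; rewrite /zt smin => /log_cauchy_riemann[al [be CR]].
  exists al, be => e e0; have [dl dl0 {}CR] := CR e e0.
  exists (Num.min dl (s1 - b)); first by rewrite lt_min dl0 subr_gt0.
  move=> s' t'; rewrite !lt_min => /andP[s'1 s'2] /andP[t'1 _].
  have s'min : Num.min s' s1 = s'.
    rewrite min_l//; have := ler_norm (s' - s); move: s'2 sb; lra.
  have := CR _ _ s'1 t'1.
  have -> : s + (s' - s) = s' by ring.
  have -> : t + (t' - t) = t' by ring.
  rewrite /U /V /zt s'min smin; set A := F _; set B := F _ => le_e.
  split; [apply: le_trans le_e; apply: le_trans (normc_Re_le _)|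
          apply: le_trans le_e; apply: le_trans (normc_Im_le _)];
    rewrite le_eqVlt; apply/orP; left; apply/eqP; congr (`| _ |).
    by case: A B => ? ? [].
  by case: A B => a1 a2 [b1 b2] /=; ring.
have [tb Jb] := meanV b.
have Vb : V b tb < 0 by rewrite subr_lt0.
have [d d0 dP] : exists2 d : R, 0 < d & forall z, normc (z - p) < d ->
    normc (F z - F p) < - V b tb.
  have e0 : 0 < (((- V b tb)%:C)%C : C) by rewrite ltcR oppr_gt0.
  have /cvgrPdist_lt/(_ _ e0)/nbhs_normcP[d d0 dP] := cF.
  by exists d => // z /dP; rewrite distrC normCE ltcR.
pose a := Num.min b (ln (d / 2)).
have ab : a <= b by rewrite ge_min lexx.
have ea : expR a < d.
  apply: (@le_lt_trans _ _ (d / 2)); last by lra.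
  rewrite -[leRHS]lnK ?posrE ?divr_gt0//.
  by rewrite ler_expR ge_min lexx orbT.
have [ta Ja] := meanV a.
have VE : V a ta = V b tb.
  by apply: (mulIf (lt0r_neq0 pi0)); rewrite -Ja -Jb J_const.
have /dP : normc (zt a ta - p) < d.
  by rewrite /zt addrC addKr normc_cexp min_l// (le_trans ab)// ltW.
apply/negP; rewrite -leNgt -VE.
apply: le_trans (normc_Im_le _).
have := ler_norm (- V a ta); rewrite normrN /V.
by case: (F _) (F p) => ? ? [].
Qed.

End LogCoordinates.

(** * Slopes of functions of one variable *)

Section Slope.
Variable K : numFieldType.
Implicit Types (f : K -> K) (a z : K).

(** The value on the diagonal makes the slope continuous wherever [f] is
    differentiable. *)
Definition slope f a z := if z == a then derive1 f a else (f z - f a) / (z - a).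

Lemma slope_diag f a : slope f a a = derive1 f a.
Proof. by rewrite /slope eqxx. Qed.

Lemma slopeE f a z : z != a -> slope f a z = (f z - f a) / (z - a).
Proof. by rewrite /slope => /negPf->. Qed.

Lemma slopeM f a z : f z - f a = slope f a z * (z - a).
Proof.
have [->|za] := eqVneq z a; first by rewrite !subrr mulr0.
by rewrite slopeE// divfK// subr_eq0.
Qed.

Lemma slope_continuous_diag f a : derivable f a 1 -> {for a, continuous (slope f a)}.
Proof.
move=> df; apply/(@cvgrPdist_le K K K (nbhs a)) => e e0; rewrite slope_diag.
have /nbhs_normP[r r0 rP] := derivable_expansion df e0.
apply/nbhs_normP; exists r => // z zr.
have [->|za] := eqVneq z a; first by rewrite slope_diag subrr normr0 ltW.
have za0 : z - a != 0 by rewrite subr_eq0.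
have := rP (z - a); rewrite /ball_/= sub0r normrN distrC => /(_ zr).
rewrite (addrC a) subrK slopeE// => le_e.
have -> : derive1 f a - (f z - f a) / (z - a) =
  - ((f z - f a - derive1 f a * (z - a)) / (z - a)) by field.
by rewrite normrN normf_div ler_pdivrMr ?normr_gt0// [`|z - a|]distrC.
Qed.

Lemma near_neq a z : z != a -> \forall x \near z, x != a.
Proof.
move=> za; apply/nbhs_normP; exists `|z - a|; first by rewrite /= normr_gt0 subr_eq0.
by move=> x; apply: contraTneq => ->; rewrite /ball_/= ltxx.
Qed.

Lemma slope_near f a z : z != a ->
  \forall x \near z, slope f a x = (f x - f a) / (x - a).
Proof. by move=> /near_neq; apply: filterS => x; exact: slopeE. Qed.

Lemma derivable_const (c : K) z : derivable (fun _ : K => c) z 1.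
Proof. exact: (@derivable_cst K K K). Qed.

Lemma derivable_var z : derivable (fun x : K => x) z 1.
Proof. exact: (@derivable_id K K). Qed.

Lemma derivable_add f g z : derivable f z 1 -> derivable g z 1 ->
  derivable (fun x => f x + g x) z 1.
Proof. exact: (@derivableD K K K). Qed.

Lemma derivable_mul f g z : derivable f z 1 -> derivable g z 1 ->
  derivable (fun x => f x * g x) z 1.
Proof. exact: (@derivableM K K). Qed.

Lemma derivable_subr f z c : derivable f z 1 -> derivable (fun x => f x - c) z 1.
Proof. by move=> df; apply: (@derivableB K K K f (cst c)) => //; exact: derivable_cst. Qed.

Lemma derivable_shift a z : derivable (fun x : K => x - a) z 1.
Proof. apply: (@derivable_subr (fun x => x) z a). apply: derivable_id. Qed.

Lemma slope_continuous f a z : z != a -> {for z, continuous f} ->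
  {for z, continuous (slope f a)}.
Proof.
move=> za cf; have za0 : z - a != 0 by rewrite subr_eq0.
have cV : {for z, continuous (fun x => (x - a)^-1)}.
  apply: (@derivable_continuous K (fun x => (x - a)^-1) z).
  by apply: (@derivableV K K (fun x => x - a)); last exact: derivable_shift.
have cB : {for z, continuous (fun x => f x - f a)}.
  by apply: (@continuousB K K K f (cst (f a)) z); [exact: cf|exact: cst_continuous].
have cq := @continuousM K K _ _ z cB cV.
have eq_near := slope_near f za.
have le_f : slope f a x @[x --> z] `=>` (f x - f a) / (x - a) @[x --> z].
  apply: (@near_eq_cvg K K (nbhs z) _ (fun x => (f x - f a) / (x - a)) (slope f a)).
  by near=> x; rewrite [RHS](near eq_near x).
by move=> P; rewrite slopeE// => /cq; exact: le_f.
Unshelve. all: by end_near. Qed.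

Lemma slope_derivable f a z : z != a -> derivable f z 1 -> derivable (slope f a) z 1.
Proof.
move=> za df; have eq_near := slope_near f za.
apply: (@near_eq_derivable K K K (fun x => (f x - f a) / (x - a)) (slope f a) z 1).
- by near=> x; rewrite [RHS](near eq_near x).
apply: derivableM; first exact: derivable_subr.
apply: derivableV; first by rewrite subr_eq0.
exact: derivable_shift.
Unshelve. all: by end_near. Qed.

Lemma derive1_mul f g z : derivable f z 1 -> derivable g z 1 ->
  derive1 (fun x => f x * g x) z = derive1 f z * g z + f z * derive1 g z.
Proof.
move=> df dg; rewrite !derive1E; have -> := @deriveM K K f g z 1 df dg.
by rewrite /GRing.scale/= addrC [g z * _]mulrC.
Qed.

Lemma derive1_subr f z c : derivable f z 1 ->
  derive1 (fun x => f x - c) z = derive1 f z.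
Proof.
move=> df; rewrite !derive1E.
have dc : derivable (cst c : K -> K) z 1 by exact: derivable_cst.
have -> := @deriveB K K K f (cst c) z 1 df dc.
by rewrite derive_cst subr0.
Qed.

Lemma derive1_slope f a z : z != a -> derivable f z 1 ->
  derive1 (slope f a) z = (derive1 f z - slope f a z) / (z - a).
Proof.
move=> za df; have za0 : z - a != 0 by rewrite subr_eq0.
have d1 := slope_derivable za df; have d2 := @derivable_shift a z.
have := derive1_mul d1 d2.
rewrite (_ : (fun x => _) = (fun x => f x - f a)); last first.
  by apply/funext => x; rewrite slopeM.
rewrite derive1_subr// (_ : derive1 (fun x => x - a) z = 1); last first.
  have di : derivable (fun x : K => x) z 1 by exact: derivable_id.
  have -> := @derive1_subr (fun x => x) z a di.
  by rewrite derive1E derive_id.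
by move=> ->; rewrite mulr1 addrK mulfK.
Qed.

Lemma derivable_of_slope f a (l : K) :
  (f z - f a) / (z - a) @[z --> a^'] --> l -> derivable f a 1.
Proof.
move=> fl; apply/cvg_ex; exists l => /=.
apply/(@cvgrPdist_le K K K (0^')) => e e0; have /cvgrPdist_le/(_ _ e0) := fl.
rewrite !near_withinE => /nbhs_normP[r r0 rP]; apply/nbhs_normP; exists r => //.
move=> h hr h0; have := rP (h + a); rewrite /ball_/= => /(_ _ _).
rewrite opprD addrCA subrr addr0 (_ : h *: 1 = h); last by rewrite /GRing.scale/= mulr1.
rewrite addrK mulrC; apply; first by move: hr; rewrite /ball_/= sub0r.
by rewrite -subr_eq0 addrK.
Qed.

End Slope.

(** * The maximum modulus principle and the lemma of Schwarz *)

Section MaximumPrinciple.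
Variable R : realType.
Local Notation C := (Cplx R).
Local Notation Re := (@complex.Re R).
Local Notation Im := (@complex.Im R).
Implicit Types (z w p : C) (x y s t r e : R).

Lemma normc_sub_comm z w : normc (z - w) = normc (w - z).
Proof. by rewrite -normcN opprB. Qed.

Lemma normc_triangle z w p : normc (z - p) <= normc (z - w) + normc (w - p).
Proof. by have := le_normcD (z - w) (w - p); rewrite addrA subrK. Qed.

Lemma normc_eq0 z : (normc z == 0) = (z == 0).
Proof.
by apply/eqP/eqP => [/eq0_normc//|->]; rewrite normc0.
Qed.

Lemma normc_gt0 z : (0 < normc z) = (z != 0).
Proof. by rewrite lt_def normc_ge0 normc_eq0 andbT. Qed.

Lemma continuous_normc : continuous (fun z : C => normc z).
Proof.
move=> z; apply/(@cvgrPdist_lt R R C (nbhs z)) => e e0; apply/nbhs_normcP.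
exists e => // w wz; apply: le_lt_trans wz; rewrite ler_norml.
have := normc_triangle z w 0; have := normc_triangle w z 0.
by rewrite !subr0 (normc_sub_comm w z); move=> ? ?; apply/andP; split; lra.
Qed.

Lemma closed_bounded_compact (K : set C) M : closed K ->
  (forall z, K z -> normc z <= M) -> compact K.
Proof.
move=> cK KM.
pose box := (fun x : R * R => cpt x.1 x.2) @` (`[- M, M] `*` `[- M, M]).
have cbox : compact box.
  apply: continuous_compact; last by apply: compact_setX; exact: segment_compact.
  apply: continuous_subspaceT => x.
  apply: (@continuous_cpt R (R * R)%type (@fst R R) (@snd R R) x); [exact: cvg_fst|exact: cvg_snd].
apply: (subclosed_compact cK cbox) => z Kz.
have zM := KM _ Kz; exists (Re z, Im z); last by case: (z).
have := le_trans (normc_Re_le z) zM; have := le_trans (normc_Im_le z) zM.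
by rewrite !ler_norml /= !in_itv/= => /andP[-> ->] /andP[-> ->].
Qed.

Lemma rotation_to_Im z : exists2 u : C, normc u <= 1 & Im (u * z) = normc z.
Proof.
have [->|z0] := eqVneq z 0; first by exists 0; rewrite ?mulr0 ?normc0 ?ler01.
have := z0; rewrite -normc_gt0; set n := normc z => n0.
have nE : n ^+ 2 = Re z ^+ 2 + Im z ^+ 2.
  by rewrite /n; case: (z) => a b /=; rewrite sqr_sqrtr// addr_ge0// sqr_ge0.
exists (cpt (Im z / n) (Re z / n)).
  rewrite /= !expr_div_n -mulrDl addrC -nE divff ?sqrtr1//.
  by rewrite expf_neq0// gt_eqF.
have -> : Im (cpt (Im z / n) (Re z / n) * z) = (Re z ^+ 2 + Im z ^+ 2) / n.
  by case: (z) => a b /=; ring.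
by rewrite -nE expr2 mulfK// gt_eqF.
Qed.

(** The maximum modulus principle, for functions holomorphic outside isolated
    points at which they are merely continuous.  Were [|F|] larger somewhere
    than it is at the points of the first kind, a rotation of [F] plus a small
    multiple of [|z|^2] would have an interior maximum [p]; up to an affine
    holomorphic function, [|z|^2] is [|z - p|^2], hence the maximum would be
    strict for the imaginary part of a holomorphic function. *)
Lemma max_modulus (K : set C) (F : C -> C) (M B : R) : closed K ->
  (forall z, K z -> normc z <= M) -> (forall z, K z -> {for z, continuous F}) ->
  (forall p, K p -> normc (F p) <= B \/
     \forall z \near p, K z /\ (z != p -> derivable F z 1)) ->
  forall z, K z -> normc (F z) <= B.
Proof.
move=> cK KM cF Kcases z0 Kz0; rewrite leNgt; apply/negP => Bz0.
have compK := closed_bounded_compact cK KM.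
have [u u1 uz0] := rotation_to_Im (F z0).
(* [e |z|^2] is at most half the excess of [|F z0|] over [B]. *)
pose e := (normc (F z0) - B) / (2 * (M ^+ 2 + 1)).
have M2 : 0 < M ^+ 2 + 1 by rewrite ltr_wpDl// sqr_ge0.
have e0 : 0 < e by rewrite divr_gt0 ?subr_gt0// mulr_gt0.
have sq_ge0 z : 0 <= Re z ^+ 2 + Im z ^+ 2 by rewrite addr_ge0// sqr_ge0.
have sq_normc z : Re z ^+ 2 + Im z ^+ 2 = normc z ^+ 2.
  by case: z => a b /=; rewrite sqr_sqrtr// addr_ge0// sqr_ge0.
pose Phi z := Im (u * F z) + e * (Re z ^+ 2 + Im z ^+ 2).
have cPhi : {within K, continuous Phi}.
  apply: continuous_in_subspaceT => z /set_mem Kz.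
  have cuF : {for z, continuous (fun z => u * F z)}.
    by apply: (@continuousM C C (cst u) F z); [exact: cst_continuous|exact: cF].
  have cR : {for z, continuous (fun z => Re z ^+ 2)}.
    by apply: (@continuous_comp _ _ _ (fun z : C => Re z) (fun x : R => x ^+ 2));
      [exact: continuous_Re|exact: exprn_continuous].
  have cI : {for z, continuous (fun z => Im z ^+ 2)}.
    by apply: (@continuous_comp _ _ _ (fun z : C => Im z) (fun x : R => x ^+ 2));
      [exact: continuous_Im|exact: exprn_continuous].
  apply: (@continuousD R R C (fun z => Im (u * F z)) (fun z => e * (Re z ^+ 2 + Im z ^+ 2)) z).
    by apply: (@continuous_comp _ _ _ (fun z => u * F z) (fun z : C => Im z));
      [exact: cuF|exact: continuous_Im].
  apply: (@continuousM R C (cst e) (fun z : C => Re z ^+ 2 + Im z ^+ 2) z).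
    exact: cst_continuous.
  exact: (@continuousD R R C _ _ z cR cI).
have K0 : K !=set0 by exists z0.
have [p /set_mem Kp pmax] := compact_EVT_max K0 compK cPhi.
have pz0 : normc (F z0) <= Phi p.
  apply: le_trans (pmax z0 (mem_set Kz0)).
  by rewrite /Phi uz0 lerDl mulr_ge0// ltW.
have [FpB|nearp] := Kcases p Kp.
  have : Phi p <= B + e * M ^+ 2.
    apply: lerD; last first.
      by rewrite ler_pM2l// sq_normc ler_sqr ?nnegrE ?normc_ge0 ?KM// (le_trans _ (KM _ Kp))// normc_ge0.
    apply: le_trans (ler_norm _) _; apply: le_trans (normc_Im_le _) _.
    by rewrite normcM; apply: le_trans FpB; rewrite ler_piMl// normc_ge0.
  apply/negP; rewrite -ltNge; apply: lt_le_trans pz0.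
  have : e * (M ^+ 2 + 1) * 2 = normc (F z0) - B.
    by rewrite /e; field; rewrite gt_eqF.
  by move: M2 e0 Bz0; rewrite mulrDr mulr1; nra.
(* [e |z|^2 = e |z - p|^2 + Im (L z) + e |p|^2]. *)
pose L z := (2 * e)%:C%C * (cpt (Im p) (Re p) * (z - p)) : C.
have LIm z : Im (L z) = 2 * e * (Re p * (Re z - Re p) + Im p * (Im z - Im p)).
  by rewrite /L /cpt; case: z => a b; case: (p) => c d /=; ring.
have dL z : derivable L z 1.
  apply: (@derivable_mul C (fun=> _)); first exact: derivable_const.
  apply: (@derivable_mul C (fun=> _)); first exact: derivable_const.
  exact: derivable_shift.
have cF2 z : {for z, continuous F} -> {for z, continuous (fun z => u * F z + L z)}.
  move=> cFz; apply: (@continuousD C C C (fun z => u * F z) L z).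
    by apply: (@continuousM C C (cst u) F z); [exact: cst_continuous|exact: cFz].
  exact: (@derivable_continuous C L z (@dL z)).
have dF2 z : derivable F z 1 -> derivable (fun z => u * F z + L z) z 1.
  move=> dFz; apply: (@derivable_add C); last exact: dL.
  by apply: (@derivable_mul C (fun=> u)); [exact: derivable_const|exact: dFz].
apply: (@no_strict_max R (fun z => u * F z + L z) p).
- by near=> z => zp; apply: dF2; apply: (near nearp z _).2.
- by apply: cF2; exact: cF.
- near=> z => zp.
  have Kz : K z by apply: (near nearp z _).1.
  have := pmax z (mem_set Kz); rewrite /Phi => le_max.
  have sqD : 0 < (Re z - Re p) ^+ 2 + (Im z - Im p) ^+ 2.
    have -> : (Re z - Re p) ^+ 2 + (Im z - Im p) ^+ 2 = normc (z - p) ^+ 2.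
      by rewrite -sq_normc; case: (z) (p) => ? ? [].
    by rewrite exprn_gt0// normc_gt0 subr_eq0.
  have ImD (v w : C) : Im (v + w) = Im v + Im w by case: v w => ? ? [].
  rewrite !ImD !LIm !subrr !mulr0 addr0 mulr0 addr0.
  have := mulr_gt0 e0 sqD; move: le_max; nra.
Unshelve. all: by end_near.
Qed.

(** Hence the discs [|z - w| <= r |z - w^*|] with [r < 1] exhaust the half-plane
    of [w]. *)
Lemma same_side z w : (normc (z - w) < normc (z - w^*%C)) = (0 < Im z * Im w).
Proof.
rewrite -(@ltr_pXn2r _ 2) ?nnegrE ?normc_ge0//.
case: z w => a b [c d] /=; rewrite !sqr_sqrtr ?addr_ge0 ?sqr_ge0//.
by apply/idP/idP; nra.
Qed.

(** The quotient [q] of [phi] by [(z - w) / (z - w^* )], extended continuously to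
    [w], is at most [B / r] on the circle [|z - w| = r |z - w^*|], hence inside
    it; then let [r] tend to [1]. *)
Lemma schwarz_half_plane (phi : C -> C) w B : Im w != 0 -> phi w = 0 ->
  (forall z, 0 < Im z * Im w -> derivable phi z 1) ->
  (forall z, 0 < Im z * Im w -> normc (phi z) <= B) ->
  forall z, 0 < Im z * Im w -> normc (phi z) * normc (z - w^*%C) <= B * normc (z - w).
Proof.
move=> w0 phiw dphi phiB z0 z0w.
have [z0E|z0_w] := eqVneq z0 w.
  by rewrite z0E phiw normc0 subrr normc0 mul0r mulr0.
have B0 : 0 <= B by apply: le_trans (phiB _ z0w); exact: normc_ge0.
pose q z := slope phi w z * (z - w^*%C).
have ww : 0 < Im w * Im w by rewrite -expr2 exprn_even_gt0.
have qE z : normc (q z) * normc (z - w) = normc (phi z) * normc (z - w^*%C).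
  by rewrite -!normcM /q mulrAC -slopeM phiw subr0.
suff qB : normc (q z0) <= B.
  by rewrite -qE ler_wpM2r// normc_ge0.
have n0 : 0 < normc (z0 - w^*%C) by apply: le_lt_trans (normc_ge0 (z0 - w)) _; rewrite same_side.
suff qBr r : r < 1 -> normc (z0 - w) <= r * normc (z0 - w^*%C) -> normc (q z0) <= B / r.
  rewrite leNgt; apply/negP => Bq.
  have q0 : 0 < normc (q z0) by apply: le_lt_trans Bq.
  (* An [r < 1] whose disc contains [z0] and for which [B / r < |q z0|]. *)
  pose r := Num.max (normc (z0 - w) / normc (z0 - w^*%C)) ((B / normc (q z0) + 1) / 2).
  have Bq1 : B / normc (q z0) < 1 by rewrite ltr_pdivrMr// mul1r.
  have Bq0 : 0 <= B / normc (q z0) by rewrite divr_ge0// ltW.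
  have rB : (B / normc (q z0) + 1) / 2 <= r by rewrite le_max lexx orbT.
  have r0 : 0 < r by lra.
  have := qBr r; rewrite ler_pdivlMr// => /(_ _ _)/wrap[].
  - by rewrite gt_max ltr_pdivrMr// mul1r same_side z0w; lra.
  - by rewrite -ler_pdivrMr// le_max lexx.
  move=> qr; have := ler_wpM2l (ltW q0) rB.
  have : B = normc (q z0) * (B / normc (q z0)) by field; rewrite gt_eqF.
  by move: qr Bq; nra.
move=> r1 z0r.
have r0 : 0 < r.
  by rewrite -(pmulr_lgt0 _ n0); apply: lt_le_trans z0r; rewrite normc_gt0 subr_eq0.
pose g z := r * normc (z - w^*%C) - normc (z - w).
have cg : continuous g.
  have cn v : continuous (fun z : C => normc (z - v)).
    move=> z; apply: (@continuous_comp _ _ _ (fun z : C => z - v) (fun z : C => normc z)).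
      exact: (@derivable_continuous C _ _ (@derivable_shift C v z)).
    exact: continuous_normc.
  move=> z; apply: (@continuousB R R C (fun z => r * normc (z - w^*%C)) (fun z => normc (z - w)) z); last exact: cn.
  by apply: (@continuousM R C (cst r) (fun z => normc (z - w^*%C)) z); [exact: cst_continuous|exact: cn].
pose K : set C := [set z | 0 <= g z].
have KH z : K z -> 0 < Im z * Im w.
  rewrite /K/= subr_ge0 -same_side => zr.
  have [zw0|zw0] := eqVneq (normc (z - w^*%C)) 0; last first.
    apply: le_lt_trans zr _; rewrite -[ltRHS]mul1r ltr_pM2r//.
    by rewrite lt_def zw0 normc_ge0.
  move: zr; rewrite zw0 mulr0 => zw_le.
  have zwE : z = w.
    by apply/eqP; rewrite -subr_eq0 -normc_eq0 eq_le zw_le normc_ge0.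
  move/eqP: zw0; rewrite zwE normc_eq0 subr_eq0 => /eqP/(congr1 (fun z : C => Im z)).
  by move: w0; case: (w) => a b /= b0 bb; move: b0; rewrite (_ : b = 0) ?eqxx//; lra.
have dphi_q z : 0 < Im z * Im w -> z != w -> derivable q z 1.
  move=> zH zw; apply: (@derivable_mul C).
    by apply: slope_derivable => //; exact: dphi.
  exact: derivable_shift.
have cq z : 0 < Im z * Im w -> {for z, continuous q}.
  move=> zH; have [->|zw] := eqVneq z w; last exact: (@derivable_continuous C q z (dphi_q z zH zw)).
  apply: (@continuousM C C (slope phi w) (fun z => z - w^*%C) w).
    by apply: slope_continuous_diag; exact: dphi.
  exact: (@derivable_continuous C _ _ (@derivable_shift C _ w)).
apply: (@max_modulus K q (normc w + normc (w - w^*%C) / (1 - r)) (B / r)).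
- by apply: (@preimage_closed C R g [set x | 0 <= x]); [move=> z _; exact: cg|exact: closed_ge].
- move=> z; rewrite /K/= subr_ge0 => zr.
  have := normc_triangle z w (w^*%C); have := normc_triangle z w 0; rewrite !subr0.
  have : 0 < 1 - r by rewrite subr_gt0.
  move=> r1' t1 t2; have y0 := normc_ge0 (w - w^*%C).
  have : normc (z - w) <= normc (w - w^*%C) / (1 - r); last by lra.
  rewrite ler_pdivlMr//; have := ler_wpM2l (ltW r0) t2.
  by have := ler_wpM2r y0 (ltW r1); move: zr; rewrite mul1r; lra.
- by move=> z /KH; exact: cq.
- move=> z Kz; have zH := KH z Kz; have := Kz; rewrite /K/= le_eqVlt => /predU1P[gz0|gz0].
    left; have [zE|zw] := eqVneq z w.
      exfalso; move/eqP: gz0; rewrite zE /g subrr normc0 subr0 eq_sym mulf_eq0 (gt_eqF r0)/=.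
      by apply/negP; rewrite gt_eqF//; move: ww; rewrite -same_side subrr normc0.
    have zw0 : 0 < normc (z - w) by rewrite normc_gt0 subr_eq0.
    rewrite -(ler_pM2r zw0) qE; have /eqP := esym gz0; rewrite subr_eq0 => /eqP <-.
    by rewrite mulrA divfK ?gt_eqF// ler_wpM2r ?normc_ge0// phiB.
  have near_g : \forall x \near z, 0 < g x.
    have /cvgrPdist_lt/(_ _ gz0) := cg z; apply: filterS => x.
    by have := ler_norm (g z - g x); lra.
  have near_w : \forall x \near z, x != z -> x != w.
    have [->|zw] := eqVneq z w; first by near=> x.
    by have := near_neq zw; apply: filterS => x xw _.
  right; near=> x; split.
    by apply: ltW; near: x.
  have xH : 0 < Im x * Im w by apply: KH; apply: ltW; near: x.
  by move=> xz; apply: (dphi_q x xH); move: xz; near: x.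
- by rewrite /K/= subr_ge0.
Unshelve. all: by end_near. Qed.

End MaximumPrinciple.

(** * Derivatives of holomorphic functions *)

Section DerivativeHolomorphic.
Variable R : realType.
Local Notation C := (Cplx R).
Local Notation Re := (@complex.Re R).
Local Notation Im := (@complex.Im R).
Implicit Types (z w p : C) (x y s t r e M : R).

(** On the circle of radius [2 r] the distance to [a] is at least [r], and the
    maximum principle carries the bound inside.  At the points of [S], where
    earlier slopes have been taken, continuity is all that is known. *)
Lemma slope_bound (F : C -> C) w r M (S : seq C) a : 0 < r ->
  (forall z, normc (z - w) <= 2 * r -> {for z, continuous F}) ->
  (forall z, normc (z - w) < 3 * r -> z \notin S -> derivable F z 1) ->
  (forall z, normc (z - w) <= 2 * r -> normc (F z) <= M) ->
  normc (a - w) < r -> a \notin S ->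
  [/\ forall z, normc (z - w) <= 2 * r -> {for z, continuous (slope F a)},
      forall z, normc (z - w) < 3 * r -> z \notin a :: S ->
        derivable (slope F a) z 1
    & forall z, normc (z - w) <= 2 * r -> normc (slope F a z) <= 2 * M / r].
Proof.
move=> r0 cF dF FM ar aS.
have dFa : derivable F a 1 by apply: (dF a) => //; lra.
have cs z : normc (z - w) <= 2 * r -> {for z, continuous (slope F a)}.
  move=> zr; have [->|za] := eqVneq z a; first exact: (@slope_continuous_diag C F a dFa).
  exact: (@slope_continuous C F a z za (cF z zr)).
have ds z : normc (z - w) < 3 * r -> z \notin a :: S -> derivable (slope F a) z 1.
  rewrite inE negb_or => zr /andP[za zS].
  exact: (@slope_derivable C F a z za (dF z zr zS)).
split=> //.
have cn : continuous (fun z : C => normc (z - w)).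
  move=> z; apply: (@continuous_comp _ _ _ (fun z : C => z - w) (fun z : C => normc z)).
    exact: (@derivable_continuous C _ _ (@derivable_shift C w z)).
  exact: continuous_normc.
apply: (@max_modulus R [set z | normc (z - w) <= 2 * r] (slope F a) (2 * r + normc w)).
- by apply: (@preimage_closed C R (fun z : C => normc (z - w)) [set x | x <= 2 * r]); [move=> z _; exact: cn|exact: closed_le].
- by move=> z/= zr; have := normc_triangle z w 0; rewrite !subr0; lra.
- exact: cs.
move=> z/=; rewrite le_eqVlt => /predU1P[zr|zr].
  left; have za : z != a by apply: contraTneq ar => <-; rewrite zr -leNgt; lra.
  have zar : r <= normc (z - a).
    by have := normc_triangle z a w; lra.
  have za0 : 0 < normc (z - a) by lra.
  rewrite slopeE// normcM normcV ler_pdivrMr// mulrAC ler_pdivlMr//.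
  have Fz := FM z (eq_ind_r (fun x => x <= 2 * r) (lexx _) zr).
  have Fa : normc (F a) <= M by apply: FM; lra.
  have F0 := normc_ge0 (F z).
  have := le_normcD (F z) (- F a); rewrite normcN => Fle.
  apply: ler_pM => //; [exact: normc_ge0|exact: ltW|by lra].
right.
have near_r : \forall x \near z, normc (x - w) < 2 * r.
  have e0 : 0 < 2 * r - normc (z - w) by rewrite subr_gt0.
  have /cvgrPdist_lt/(_ _ e0) := cn z; apply: filterS => x.
  by rewrite distrC; have := ler_norm (normc (x - w) - normc (z - w)); lra.
have near_S : \forall x \near z, x != z -> x \notin a :: S.
  elim: (a :: S) => [|b l IH]; first by near=> x.
  have [<-|zb] := eqVneq z b.
    by apply: filterS IH => x IH xz; rewrite inE negb_or xz IH.
  by have := near_neq zb; apply: filterS2 IH => x IH xb xz; rewrite inE negb_or xb IH.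
near=> x; split.
  by apply: ltW; near: x.
move=> xz; apply: (ds x); last by move: xz; near: x.
by apply: (@lt_trans _ _ (2 * r)); [near: x|lra].
Unshelve. all: by end_near. Qed.

(** The limit is the supremum of the lower bounds [A z - c |z - w|]. *)
Lemma lipschitz_punctured_limit (A : C -> R) w r c : 0 < r -> 0 <= c ->
  (forall z z', 0 < normc (z - w) < r -> 0 < normc (z' - w) < r -> z != z' ->
     `|A z - A z'| <= c * normc (z - z')) ->
  exists l, forall z, 0 < normc (z - w) < r -> `|A z - l| <= c * normc (z - w).
Proof.
move=> r0 c0 lipA.
have cmp z z' : 0 < normc (z - w) < r -> 0 < normc (z' - w) < r ->
    A z - c * normc (z - w) <= A z' + c * normc (z' - w).
  move=> zr z'r; have [->|zz'] := eqVneq z z'.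
    have := mulr_ge0 c0 (normc_ge0 (z' - w)); lra.
  have := lipA _ _ zr z'r zz'; have := normc_triangle z w z'.
  rewrite (normc_sub_comm w) => /(ler_wpM2l c0); rewrite mulrDr.
  by have := ler_norm (A z - A z'); lra.
pose E := [set A z - c * normc (z - w) | z in [set z | 0 < normc (z - w) < r]].
pose z1 := w + cpt (r / 2) 0.
have z1r : 0 < normc (z1 - w) < r.
  rewrite /z1 addrC addKr /= expr0n addr0 sqrtr_sqr gtr0_norm ?divr_gt0//=.
  lra.
have hE : has_sup E.
  split; first by exists (A z1 - c * normc (z1 - w)); exists z1.
  by exists (A z1 + c * normc (z1 - w)) => _ [z zr <-]; exact: cmp.
exists (sup E) => z zr; rewrite ler_norml; apply/andP; split.
  have : sup E <= A z + c * normc (z - w); last by lra.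
  by apply: ge_sup => [|_ [z' z'r <-]]; [case: hE|exact: cmp].
have : A z - c * normc (z - w) <= sup E; last by lra.
by apply: ub_le_sup; [case: hE|exists z].
Qed.

(** The derivative of a holomorphic function is holomorphic.  The maximum
    principle bounds the divided differences [u[w, w, z, z']] of order three
    uniformly in [z] and [z'], whence [u[w, w, z]] and [u[w, z, z]] have a
    common limit as [z] tends to [w], and the slope of [u'] is their sum. *)
Lemma derivable_derive1 (u : C -> C) w :
  (\forall z \near w, derivable u z 1) -> derivable (derive1 u) w 1.
Proof.
move=> /nbhs_normcP[r1 r10 du1].
pose r := r1 / 3; have r0 : 0 < r by rewrite divr_gt0.
have du z : normc (z - w) < 3 * r -> derivable u z 1.
  by move=> zr; apply: du1; move: zr; rewrite /r; lra.
have cu z : normc (z - w) <= 2 * r -> {for z, continuous u}.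
  by move=> zr; apply: (@derivable_continuous C u z); apply: du; lra.
have [M uM] : exists M, forall z, normc (z - w) <= 2 * r -> normc (u z) <= M.
  pose K := [set z : C | normc (z - w) <= 2 * r].
  have cn : continuous (fun z : C => normc (z - w)).
    move=> z; apply: (@continuous_comp _ _ _ (fun z : C => z - w) (fun z : C => normc z)).
      exact: (@derivable_continuous C _ _ (@derivable_shift C w z)).
    exact: continuous_normc.
  have cK : closed K.
    by apply: (@preimage_closed C R (fun z : C => normc (z - w)) [set x | x <= 2 * r]); [move=> z _; exact: cn|exact: closed_le].
  have compK : compact K.
    apply: (@closed_bounded_compact R K (2 * r + normc w) cK) => z.
    by rewrite /K/= => zr; have := normc_triangle z w 0; rewrite !subr0; lra.
  have K0 : K !=set0 by exists w; rewrite /K/= subrr normc0; lra.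
  have cuK : {within K, continuous (fun z => normc (u z))}.
    apply: continuous_in_subspaceT => z /set_mem Kz.
    by apply: (@continuous_comp _ _ _ u (fun z : C => normc z)); [exact: cu|exact: continuous_normc].
  have [p _ pmax] := compact_EVT_max K0 compK cuK.
  by exists (normc (u p)) => z zr; apply: pmax; apply/mem_set.
have ww : normc (w - w) < r by rewrite subrr normc0.
have ww2 : normc (w - w) <= 2 * r by rewrite subrr normc0; lra.
have [c1 d1 b1] := slope_bound r0 cu (fun z zr _ => du z zr) uM ww (isT : w \notin [::]).
set k1 := slope u w in c1 d1 b1.
(* Each of three applications of [slope_bound] multiplies the bound by [2/r]. *)
pose c := 2 * (2 * (2 * M / r) / r) / r.
pose A z := (k1 z - k1 w) / (z - w).
have third z z' : 0 < normc (z - w) < r -> 0 < normc (z' - w) < r -> z != z' ->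
    normc (A z - A z') <= c * normc (z - z') /\
    normc (A z - slope k1 z z') <= c * normc (z' - w).
  rewrite !normc_gt0 !subr_eq0 => /andP[zw zr] /andP[z'w z'r] zz'.
  have z1 : z \notin [:: w] by rewrite inE.
  have [c2 d2 b2] := slope_bound r0 c1 d1 b1 zr z1.
  have z'2 : z' \notin [:: z; w] by rewrite !inE negb_or eq_sym zz'.
  have [_ _ b3] := slope_bound r0 c2 d2 b2 z'r z'2.
  have wz : w != z by rewrite eq_sym. have wz' : w != z' by rewrite eq_sym.
  have z'z : z' != z by rewrite eq_sym.
  have z1' : z - w != 0 by rewrite subr_eq0. have z2' : w - z != 0 by rewrite subr_eq0.
  have z3' : z' - w != 0 by rewrite subr_eq0. have z4' : w - z' != 0 by rewrite subr_eq0.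
  have z5' : z' - z != 0 by rewrite subr_eq0.
  have -> : A z - A z' = slope (slope k1 z) z' w * (z - z').
    rewrite (slopeE _ wz') (slopeE _ wz) (slopeE _ z'z) /A; field.
    by rewrite z1' z2' z3' z4' z5'.
  have -> : A z - slope k1 z z' = slope (slope k1 z) z' w * (w - z').
    rewrite (slopeE _ wz') (slopeE _ wz) (slopeE _ z'z) /A; field.
    by rewrite z1' z2' z4' z5'.
  rewrite !normcM (normc_sub_comm w).
  by split; apply: ler_wpM2r; rewrite ?normc_ge0// b3.
have z1r : 0 < normc (w + cpt (r / 2) 0 - w) < r.
  rewrite addrC addKr /= expr0n addr0 sqrtr_sqr gtr0_norm ?divr_gt0//=; lra.
have c0 : 0 <= c.
  have M0 : 0 <= M by apply: le_trans (uM w ww2); exact: normc_ge0.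
  by rewrite /c !(divr_ge0, mulr_ge0)// ltW.
have [l1 l1P] : exists l, forall z, 0 < normc (z - w) < r -> `|Re (A z) - l| <= c * normc (z - w).
  apply: lipschitz_punctured_limit => // z z' zr z'r zz'.
  apply: le_trans (third z z' zr z'r zz').1; apply: le_trans (normc_Re_le _).
  by case: (A z) (A z') => ? ? [].
have [l2 l2P] : exists l, forall z, 0 < normc (z - w) < r -> `|Im (A z) - l| <= c * normc (z - w).
  apply: lipschitz_punctured_limit => // z z' zr z'r zz'.
  apply: le_trans (third z z' zr z'r zz').1; apply: le_trans (normc_Im_le _).
  by case: (A z) (A z') => ? ? [].
have AL z : 0 < normc (z - w) < r -> normc (A z - cpt l1 l2) <= 2 * c * normc (z - w).
  move=> zr; apply: le_trans (normc_le _) _; have -> : 2 * c * normc (z - w) = c * normc (z - w) + c * normc (z - w) by ring.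
  by have := l2P z zr; have := l1P z zr; case: (A z) => a b /= h1 h2; apply: lerD.
have dk1 z : 0 < normc (z - w) < r -> derivable k1 z 1.
  rewrite normc_gt0 subr_eq0 => /andP[zw zr].
  by apply: d1; [lra|rewrite inE].
have derA z : 0 < normc (z - w) < r -> normc (derive1 k1 z - A z) <= c * normc (z - w).
  move=> zr; apply/ler_addgt0Pr => e e0.
  have e20 : 0 < (((e / 2)%:C)%C : C) by rewrite ltcR divr_gt0.
  have /cvgrPdist_lt/(_ _ e20)/nbhs_normcP[d d0 dP] := @slope_continuous_diag C k1 z (dk1 z zr).
  have /andP[zw zr'] := zr.
  pose t := Num.min (d / 2) (Num.min (normc (z - w) / 2) (Num.min ((r - normc (z - w)) / 2) (e / (2 * (c + 1))))).
  have t0 : 0 < t.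
    rewrite !lt_min !divr_gt0 ?subr_gt0//= mulr_gt0//; lra.
  have t1 : t < d by rewrite gt_min; apply/orP; left; lra.
  have t2 : t < normc (z - w) by rewrite !gt_min; apply/orP; right; apply/orP; left; lra.
  have t3 : t < r - normc (z - w).
    by rewrite !gt_min; apply/orP; right; apply/orP; right; apply/orP; left; lra.
  have t4 : c * t <= e / 2.
    apply: (@le_trans _ _ ((c + 1) * t)); first by apply: ler_wpM2r; [exact: ltW|rewrite lerDl].
    have c10 : 0 < c + 1 by lra.
    rewrite mulrC -ler_pdivlMr// (_ : e / 2 / (c + 1) = e / (2 * (c + 1))); last by field; rewrite gt_eqF.
    by rewrite !ge_min lexx !orbT.
  pose z' := z + cpt t 0.
  have nz'z : normc (z' - z) = t.
    by rewrite /z' addrC addKr /= expr0n addr0 sqrtr_sqr gtr0_norm.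
  have z'z : z != z' by rewrite eq_sym -subr_eq0 -normc_gt0 nz'z.
  have z'r : 0 < normc (z' - w) < r.
    have := normc_triangle z' z w; have := normc_triangle z z' w.
    rewrite (normc_sub_comm z z') nz'z => h1 h2; apply/andP; split; lra.
  have [_] := third z z' zr z'r z'z; have := normc_triangle z' z w; rewrite nz'z.
  have : normc (z' - z) < d by rewrite nz'z.
  move=> /dP; rewrite slope_diag normCE ltcR => s1 s2 s3.
  have := normc_triangle (derive1 k1 z) (slope k1 z z') (A z).
  rewrite (normc_sub_comm (slope k1 z z')) => s4.
  have := ler_wpM2l c0 s2; rewrite mulrDr; lra.
apply: (@derivable_of_slope C (derive1 u) w (2 * cpt l1 l2)).
apply/(@cvgrPdist_le C C C (w^')) => e; case: e => e ei; rewrite ltcE/= => /andP[/eqP -> e0].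
rewrite near_withinE; apply/nbhs_normcP.
have c50 : 0 < 5 * c + 1 by lra.
exists (Num.min r (e / (5 * c + 1))); first by rewrite lt_min r0 divr_gt0.
move=> z; rewrite lt_min => /andP[zr ze] zw.
have zw0 : 0 < normc (z - w) by rewrite normc_gt0 subr_eq0.
have zr0 : 0 < normc (z - w) < r by rewrite zw0.
rewrite distrC normCE -[Complex e 0]/((e%:C)%C) lecR.
have -> : (derive1 u z - derive1 u w) / (z - w) = derive1 k1 z + A z.
  rewrite /k1 derive1_slope//; last by apply: du; lra.
  rewrite /A /k1 slope_diag -mulrDl; congr (_ / _).
  by rewrite addrA subrK.
have -> : derive1 k1 z + A z - 2 * cpt l1 l2 =
  (derive1 k1 z - A z) + ((A z - cpt l1 l2) + (A z - cpt l1 l2)) by ring.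
have := le_normcD (derive1 k1 z - A z) ((A z - cpt l1 l2) + (A z - cpt l1 l2)).
have := le_normcD (A z - cpt l1 l2) (A z - cpt l1 l2).
have := AL z zr0; have := derA z zr0.
have : (5 * c + 1) * normc (z - w) < e by rewrite mulrC -ltr_pdivlMr.
lra.
Qed.

End DerivativeHolomorphic.

(** * Positive semidefinite matrices *)

Local Open Scope sesquilinear_scope.

Section HermitianForms.
Variables (C : numClosedFieldType) (n : nat).
Implicit Types (A B : 'M[C]_n) (u v x y : 'cV[C]_n) (a b : C).

Definition dot x y : C := (x ^t* *m y) 0 0.

Lemma dotE x y : dot x y = \sum_i (x i 0)^* * y i 0.
Proof. by rewrite /dot mxE; apply: eq_bigr => i _; rewrite !mxE. Qed.

Lemma dotDr x y v : dot x (y + v) = dot x y + dot x v.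
Proof. by rewrite /dot mulmxDr mxE. Qed.

Lemma dotZr a x y : dot x (a *: y) = a * dot x y.
Proof. by rewrite /dot -scalemxAr mxE. Qed.

Lemma dotNr x y : dot x (- y) = - dot x y.
Proof. by rewrite -scaleN1r dotZr mulN1r. Qed.

Lemma dotBr x y v : dot x (y - v) = dot x y - dot x v.
Proof. by rewrite dotDr dotNr. Qed.

Lemma dotC x y : dot y x = (dot x y)^*.
Proof.
rewrite !dotE rmorph_sum; apply: eq_bigr => i _.
by rewrite rmorphM /= conjCK mulrC.
Qed.

Lemma dotDl x y v : dot (x + y) v = dot x v + dot y v.
Proof. by rewrite dotC dotDr rmorphD /= -!dotC. Qed.

Lemma dotZl a x y : dot (a *: x) y = a^* * dot x y.
Proof. by rewrite dotC dotZr rmorphM /= -dotC. Qed.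

Lemma dotBl x y v : dot (x - y) v = dot x v - dot y v.
Proof. by rewrite dotDl -scaleN1r dotZl rmorphN /= conjC1 mulN1r. Qed.

Lemma adjmxM A B : (A *m B) ^t* = B ^t* *m A ^t*.
Proof. by rewrite trmx_mul map_mxM. Qed.

Lemma dot_adj A x y : dot x (A *m y) = dot (A ^t* *m x) y.
Proof. by rewrite /dot mulmxA trmx_mul map_mxM trmxCK. Qed.

Lemma dot_ge0 x : 0 <= dot x x.
Proof. by rewrite dotE sumr_ge0// => i _; rewrite mulrC mul_conjC_ge0. Qed.

Lemma dot_eq0 x : dot x x = 0 -> x = 0.
Proof.
rewrite dotE => /eqP; rewrite psumr_eq0; last first.
  by move=> i _; rewrite mulrC mul_conjC_ge0.
move=> /allP x0; apply/matrixP => i j; rewrite (ord1 j) mxE; apply/eqP.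
by have := x0 i (mem_index_enum i); rewrite /= mulrC mul_conjC_eq0.
Qed.

Lemma dot_eq0_all x : (forall y, dot y x = 0) -> x = 0.
Proof. by move=> H; apply: dot_eq0. Qed.

Lemma unitmx_of_kernel A : (forall v, A *m v = 0 -> v = 0) -> A \in unitmx.
Proof.
move=> kerA; rewrite -unitmx_tr -row_free_unit; apply/row_freeP.
have : kermx A^T = 0.
  apply/row_matrixP => i; rewrite row0; apply: trmx_inj; rewrite trmx0; apply: kerA.
  by apply: trmx_inj; rewrite trmx_mul trmxK -row_mul mulmx_ker row0 trmx0.
by move/eqP; rewrite kermx_eq0 => /row_freeP.
Qed.

(** The form of [psdmx] in which the inner product can be manipulated, over any
    field with a conjugation. *)
Definition psd A := A ^t* = A /\ forall v, 0 <= dot v (A *m v).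

Section Psd.
Variable A : 'M[C]_n.
Hypothesis psdA : psd A.

Lemma psd_sym x y : dot x (A *m y) = dot (A *m x) y.
Proof. by rewrite dot_adj psdA.1. Qed.

Lemma psd_cauchy_schwarz x v :
  `|dot x (A *m v)| ^+ 2 <= dot x (A *m x) * dot v (A *m v).
Proof.
set s := dot x (A *m v); set p := dot x (A *m x); set q := dot v (A *m v).
have p0 : 0 <= p := psdA.2 x. have q0 : 0 <= q := psdA.2 v.
have quad t : t \is Num.real -> 0 <= p - 2 * t * `|s| ^+ 2 + t ^+ 2 * `|s| ^+ 2 * q.
  move=> /CrealP t_real; have := psdA.2 (x + (- t * s^*) *: v).
  have vx : dot v (A *m x) = s^* by rewrite psd_sym dotC.
  rewrite mulmxDr -scalemxAr !(dotDr, dotDl, dotZr, dotZl) -/s -/p -/q vx.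
  rewrite !(rmorphN, rmorphM) /= conjCK t_real.
  congr (0 <= _); rewrite normCK; ring.
have [s0|s0] := eqVneq s 0; first by rewrite s0 normr0 expr0n mulr_ge0.
have ns : 0 < `|s| ^+ 2 by rewrite exprn_gt0// normr_gt0.
have sre : `|s| ^+ 2 \is Num.real by exact: gtr0_real.
(* [quad] is affine for [q = 0], and takes the value [-1] for this [t];
   otherwise [t = q^-1] minimizes it. *)
have [qE|qN0] := eqVneq q 0.
  have := quad ((p + 1) / (2 * `|s| ^+ 2)).
  rewrite qE !mulr0 addr0 => /(_ _)/wrap[].
    by apply: ger0_real; rewrite divr_ge0 ?addr_ge0 ?mulr_ge0 ?ler01 ?ler0n ?(ltW ns).
  have -> : p - 2 * ((p + 1) / (2 * `|s| ^+ 2)) * `|s| ^+ 2 = - 1.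
    by field; rewrite normr_eq0 s0.
  by rewrite oppr_ge0 ler10.
have q_gt0 : 0 < q by rewrite lt_def qN0.
have := quad q^-1; rewrite rpredV (ger0_real q0) => /(_ isT).
have -> : p - 2 * q^-1 * `|s| ^+ 2 + q^-1 ^+ 2 * `|s| ^+ 2 * q = p - `|s| ^+ 2 / q.
  by field.
by rewrite subr_ge0 ler_pdivrMr.
Qed.

Lemma psd_isotropic v : dot v (A *m v) = 0 -> A *m v = 0.
Proof.
move=> v0; apply: dot_eq0_all => y; have := psd_cauchy_schwarz y v.
rewrite v0 mulr0 => le0; apply/eqP; rewrite -normr_eq0 -sqrf_eq0 eq_le le0.
by rewrite exprn_ge0.
Qed.

End Psd.

Lemma adjmx_inv A : A \in unitmx -> (invmx A) ^t* = invmx (A ^t*).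
Proof. by move=> uA; rewrite trmx_inv map_invmx. Qed.

Lemma psd_inv A : psd A -> A \in unitmx -> psd (invmx A).
Proof.
move=> [sA pA] uA; split; first by rewrite adjmx_inv// sA.
move=> v; have := pA (invmx A *m v); rewrite mulKVmx//.
by rewrite dotC conjC_ge0.
Qed.

(** In this section [F] and [G] stand for the values of a Nevanlinna function
    at points with imaginary parts [y] and [t], and [N], [Y] are the positive
    matrices [Im F / y] and [Im G / t]. *)
Section TwoPoints.
Variables (F G N Y : 'M[C]_n) (y t : C).
Hypotheses (psdN : psd N) (psdY : psd Y).
Hypotheses (yR : y \is Num.real) (tR : t \is Num.real) (y0 : y != 0).
Hypothesis imF : F - F ^t* = (2 * 'i * y) *: N.
Hypothesis imG : G - G ^t* = (2 * 'i * t) *: Y.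

Let S := F - G ^t*.

Lemma adjS : S ^t* = F ^t* - G.
Proof. by rewrite /S linearB map_mxB /= trmxCK. Qed.

Lemma dot_skew v : dot v (S *m v) - dot (S *m v) v =
  2 * 'i * (y * dot v (N *m v) + t * dot v (Y *m v)).
Proof.
rewrite -[X in dot (X *m v)]trmxCK -dot_adj -dotBr -mulmxBl adjS.
have -> : S - (F ^t* - G) = (F - F ^t*) + (G - G ^t*).
  by apply/matrixP => i j; rewrite /S !mxE; ring.
rewrite imF imG mulmxDl -!scalemxAl dotDr !dotZr; ring.
Qed.

(** On the kernel of [S] the form of [y N + t Y] vanishes, and its two terms
    have the same sign. *)
Lemma two_point_unit : 0 <= y * t -> (forall v, N *m v = 0 -> v = 0) ->
  S \in unitmx.
Proof.
move=> yt injN; apply: unitmx_of_kernel => v Sv; apply/injN/psd_isotropic => //.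
have d0 : dot v 0 = 0 by rewrite -(scale0r v) dotZr mul0r.
have := dot_skew v; rewrite Sv d0 (dotC v) d0 conjC0 subrr => /esym/eqP.
rewrite !mulf_eq0 pnatr_eq0 (negPf (neq0Ci C))/= => /eqP sum0.
have : y ^+ 2 * dot v (N *m v) + y * t * dot v (Y *m v) = 0.
  by rewrite expr2 -!mulrA -mulrDr sum0 mulr0.
move/eqP; rewrite paddr_eq0; first last.
- by rewrite mulr_ge0//; case: psdY.
- by rewrite mulr_ge0 ?real_exprn_even_ge0//; case: psdN.
by move=> /andP[+ _]; rewrite mulf_eq0 sqrf_eq0 (negPf y0) => /eqP.
Qed.

Hypothesis uY : Y \in unitmx.

(** Expand [F - G = S - 2 i t Y] in the inner product of [Y^-1].  For points on
    the same side this makes [(F - G) S^-1] a contraction. *)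
Lemma two_point_identity v :
  dot ((F - G) *m v) (invmx Y *m ((F - G) *m v)) =
  dot (S *m v) (invmx Y *m (S *m v)) - 4 * t * y * dot v (N *m v).
Proof.
pose al := 2 * 'i * t.
have alC : al^* = - al.
  by rewrite /al !rmorphM /= conjCi !conj_Creal ?realn//; ring.
have -> : (F - G) *m v = S *m v - al *: (Y *m v).
  have -> : F - G = S - (G - G ^t*) by rewrite /S opprB addrA subrK.
  by rewrite imG mulmxBl -scalemxAl.
have sv := dot_skew v; set s1 := dot v (S *m v) in sv.
rewrite mulmxBr -scalemxAr mulKmx// !(dotBr, dotZr).
rewrite !(dotBl, dotZl) alC.
have -> : dot (Y *m v) (invmx Y *m (S *m v)) = s1.
  by rewrite -psd_sym// mulKVmx.
have -> : dot (Y *m v) v = dot v (Y *m v) by rewrite -psd_sym.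
have -> : dot (S *m v) v = s1 - 2 * 'i * (y * dot v (N *m v) + t * dot v (Y *m v)).
  by rewrite -sv opprB addrCA subrr addr0.
have i2 : 'i ^+ 2 = -1 :> C := sqrCi C.
rewrite /al; move: i2; set j := 'i => i2.
set P := dot v (N *m v); set Q := dot v (Y *m v); set W := dot (S *m v) _.
transitivity (W + j ^+ 2 * (4 * t * y * P)); first by ring.
by rewrite i2; ring.
Qed.

End TwoPoints.

(** From the lemma of Schwarz to the Pick inequality.  With [m = |z - w^*|^2],
    [mu = |z - w|^2] and squared norms [ka], [si] of [(F - G) v], [S v], the
    hypotheses are the two-point identity and the gain [mu / m]; eliminate
    [ka]. *)
Lemma pick_scalar (ka si N yt m mu : C) : 0 <= ka -> 0 <= N -> 0 <= m -> 0 <= mu ->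
  0 < yt -> ka = si - 4 * yt * N -> m - mu = 4 * yt ->
  ka ^+ 2 * m <= ka * si * mu -> si <= N * m.
Proof.
move=> ka0 N0 m0 mu0 yt0 kaE mE le2.
have yt4 : 0 < 4 * yt by rewrite mulr_gt0.
have mle : 4 * yt <= m by rewrite -mE gerBl.
have [ka_0|kaN0] := eqVneq ka 0.
  have -> : si = N * (4 * yt) by move/eqP: kaE; rewrite ka_0 eq_sym subr_eq0 mulrC => /eqP.
  by rewrite ler_wpM2l.
have ka_gt0 : 0 < ka by rewrite lt_def kaN0.
have : ka * m <= si * mu.
  by rewrite -(ler_pM2l ka_gt0) !mulrA -expr2.
rewrite kaE -subr_ge0 => le1; rewrite -(ler_pM2l yt4) -subr_ge0.
have -> : 4 * yt * (N * m) - 4 * yt * si = si * mu - (si - 4 * yt * N) * m.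
  by rewrite -{2}mE; ring.
exact: le1.
Qed.

End HermitianForms.

(** * Classes of functions closed under the matrix operations *)

(** The same closure argument serves differentiability and continuity at a
    point, and the existence of expansions. *)
Section EntrywiseClosure.
Variables (K : fieldType) (X : Type) (P : (X -> K) -> Prop).
Hypothesis P_const : forall c, P (fun=> c).
Hypothesis P_add : forall f g, P f -> P g -> P (fun x => f x + g x).
Hypothesis P_mul : forall f g, P f -> P g -> P (fun x => f x * g x).

Definition entrywise m n (A : X -> 'M[K]_(m, n)) := forall i j, P (fun x => A x i j).

Lemma closed_sum I (r : seq I) (Q : pred I) (f : I -> X -> K) :
  (forall i, P (f i)) -> P (fun x => \sum_(i <- r | Q i) f i x).
Proof.
move=> Pf; elim: r => [|i r IH].
  by rewrite (_ : (fun _ => _) = fun=> 0) //; apply/funext => x; rewrite big_nil.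
case Qi : (Q i).
  rewrite (_ : (fun _ => _) = fun x => f i x + \sum_(i <- r | Q i) f i x).
    exact: P_add.
  by apply/funext => x; rewrite big_cons Qi.
rewrite (_ : (fun _ => _) = fun x => \sum_(i <- r | Q i) f i x)//.
by apply/funext => x; rewrite big_cons Qi.
Qed.

Lemma closed_prod I (r : seq I) (Q : pred I) (f : I -> X -> K) :
  (forall i, P (f i)) -> P (fun x => \prod_(i <- r | Q i) f i x).
Proof.
move=> Pf; elim: r => [|i r IH].
  by rewrite (_ : (fun _ => _) = fun=> 1) //; apply/funext => x; rewrite big_nil.
case Qi : (Q i).
  rewrite (_ : (fun _ => _) = fun x => f i x * \prod_(i <- r | Q i) f i x).
    exact: P_mul.
  by apply/funext => x; rewrite big_cons Qi.
rewrite (_ : (fun _ => _) = fun x => \prod_(i <- r | Q i) f i x)//.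
by apply/funext => x; rewrite big_cons Qi.
Qed.

Lemma entrywise_const m n (A : 'M[K]_(m, n)) : entrywise (fun=> A).
Proof. by move=> i j; exact: P_const. Qed.

Lemma entrywise_mul m n p (A : X -> 'M[K]_(m, n)) (B : X -> 'M[K]_(n, p)) :
  entrywise A -> entrywise B -> entrywise (fun x => A x *m B x).
Proof.
move=> PA PB i j.
rewrite (_ : (fun _ => _) = fun x => \sum_k A x i k * B x k j).
  by apply: closed_sum => k; apply: P_mul.
by apply/funext => x; rewrite mxE.
Qed.

Lemma entrywise_add m n (A B : X -> 'M[K]_(m, n)) :
  entrywise A -> entrywise B -> entrywise (fun x => A x + B x).
Proof.
move=> PA PB i j; rewrite (_ : (fun _ => _) = fun x => A x i j + B x i j).
  exact: P_add.
by apply/funext => x; rewrite mxE.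
Qed.

Lemma entrywise_scale m n (c : X -> K) (A : X -> 'M[K]_(m, n)) :
  P c -> entrywise A -> entrywise (fun x => c x *: A x).
Proof.
move=> Pc PA i j; rewrite (_ : (fun _ => _) = fun x => c x * A x i j).
  exact: P_mul.
by apply/funext => x; rewrite mxE.
Qed.

Lemma entrywise_sub m n (A B : X -> 'M[K]_(m, n)) :
  entrywise A -> entrywise B -> entrywise (fun x => A x - B x).
Proof.
move=> PA PB; rewrite (_ : (fun _ => _) = fun x => A x + (-1) *: B x).
  by apply: entrywise_add => //; apply: (entrywise_scale (P_const _)).
by apply/funext => x; rewrite scaleN1r.
Qed.

Lemma closed_det n (A : X -> 'M[K]_n) : entrywise A -> P (fun x => \det (A x)).
Proof.
move=> PA; apply: closed_sum => s; apply: P_mul; first exact: P_const.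
by apply: closed_prod => i; exact: PA.
Qed.

Lemma entrywise_adj n (A : X -> 'M[K]_n) : entrywise A -> entrywise (fun x => \adj (A x)).
Proof.
move=> PA i j; rewrite (_ : (fun _ => _) = fun x => cofactor (A x) j i); last first.
  by apply/funext => x; rewrite mxE.
apply: P_mul; first exact: P_const.
apply: closed_det => k l.
rewrite (_ : (fun _ => _) = fun x => A x (lift j k) (lift i l)).
  exact: PA.
by apply/funext => x; rewrite !mxE.
Qed.

(** [invmx] is given by Cramer's rule only at invertible matrices. *)
Definition cramer n (A : 'M[K]_n) := (\det A)^-1 *: \adj A.

Lemma cramerE n (A : 'M[K]_n) : A \in unitmx -> cramer A = invmx A.
Proof. by rewrite /invmx => ->. Qed.

Lemma entrywise_cramer n (A : X -> 'M[K]_n) :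
  P (fun x => (\det (A x))^-1) -> entrywise A -> entrywise (fun x => cramer (A x)).
Proof. by move=> Pdet PA; apply: entrywise_scale => //; exact: entrywise_adj. Qed.

End EntrywiseClosure.

(** * The Pick inequality *)

Section Pick.
Variables (R : realType) (d : nat).
Local Notation C := (Cplx R).
Local Notation Re := (@complex.Re R).
Local Notation Im := (@complex.Im R).
Implicit Types (f : C -> 'M[C]_d) (z w : C) (x v u : 'cV[C]_d) (A : 'M[C]_d).

Lemma nonreal_Im z : (z \isn't Num.real) = (Im z != 0).
Proof. by case: z => a b; rewrite complex_real. Qed.

Lemma same_side_nonreal z w : 0 < Im z * Im w -> z \isn't Num.real.
Proof. by rewrite nonreal_Im; apply: contraTneq => ->; rewrite mul0r ltxx. Qed.

Lemma ImCE z : 'Im z = ((Im z)%:C)%C :> C.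
Proof.
have := complexE z; rewrite {1}[z]Crect => E.
have hz : z = ((Re z)%:C)%C + 'i * ((Im z)%:C)%C :> C := complexE z.
rewrite {1}hz Im_rect//; apply/CrealP; apply/eqP; rewrite eq_complex /= oppr0 !eqxx//.
Qed.

Lemma Im_neq0 z : z \isn't Num.real -> 'Im z != 0.
Proof. by rewrite nonreal_Im => zR; rewrite ImCE; apply: contra zR => /eqP[/eqP]. Qed.

Lemma psdmxP A : psdmx A <-> psd A.
Proof.
have hE : (A \is hermsymmx) = (A == A ^t*).
  by rewrite qualifE /= expr0 scale1r.
split=> [[]|[sA pA]]; rewrite ?hE.
  by move=> /eqP sA pA; split=> // v; rewrite /dot mulmxA; exact: pA.
split; first by rewrite hE sA.
by move=> v; have := pA v; rewrite /dot mulmxA.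
Qed.

Definition nev_im f z := ('Im z)^-1 *: Im_mx (f z).

Lemma nev_imE f z : z \isn't Num.real ->
  f z - (f z) ^t* = (2 * 'i * 'Im z) *: nev_im f z.
Proof.
move=> /Im_neq0 Im0; rewrite /nev_im /Im_mx !scalerA.
rewrite -[LHS]scale1r; congr (_ *: _); field.
by rewrite Im0 neq0Ci.
Qed.

Lemma nev_im_psd f z : nevanlinna f -> z \isn't Num.real -> psd (nev_im f z).
Proof. by move=> [_ _ nf] zR; apply/psdmxP; exact: nf. Qed.

Lemma nev_im_inj f z v : nondegen f -> z \isn't Num.real -> nev_im f z *m v = 0 -> v = 0.
Proof.
move=> nf zR; rewrite /nev_im -scalemxAl => /eqP; rewrite scaler_eq0 => /orP[|/eqP]; last exact: nf.
by rewrite invr_eq0 (negPf (Im_neq0 zR)).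
Qed.

Lemma nevanlinna_entrywise f z : nevanlinna f -> z \isn't Num.real ->
  entrywise (fun h : C -> C => derivable h z 1) f.
Proof. by move=> [df _ _] zR i j; exact: ((derivable_entries f z).1 (df z zR) i j). Qed.

Lemma derivable_cramer n (A : C -> 'M[C]_n) z :
  entrywise (fun h : C -> C => derivable h z 1) A -> A z \in unitmx ->
  entrywise (fun h : C -> C => derivable h z 1) (fun z => cramer (A z)).
Proof.
move=> dA uA; have Pc := @derivable_const C ^~ z.
have PD := fun h1 h2 : C -> C => @derivable_add C h1 h2 z.
have PM := fun h1 h2 : C -> C => @derivable_mul C h1 h2 z.
apply: (entrywise_cramer Pc PD PM _ dA).
apply: (@derivableV C C (fun z => \det (A z)) z 1).
  by rewrite -unitfE.
exact: (closed_det Pc PD PM dA).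
Qed.

Lemma normc_le_sqrt (p b : C) : `|p| ^+ 2 <= b -> normc p <= Num.sqrt (Re b).
Proof.
move=> pb; have p0 := normc_ge0 p.
have : normc p ^+ 2 <= Re b.
  by move: pb; rewrite normCE -rmorphXn/= lecE/= => /andP[_].
by move=> /(ler_wsqrtr); rewrite sqrtr_sqr ger0_norm.
Qed.

Lemma schwarz_half_plane_sqr (phi : C -> C) w b : Im w != 0 -> phi w = 0 ->
  (forall z, 0 < Im z * Im w -> derivable phi z 1) ->
  (forall z, 0 < Im z * Im w -> `|phi z| ^+ 2 <= b) ->
  forall z, 0 < Im z * Im w -> `|phi z| ^+ 2 * `|z - w^*| ^+ 2 <= b * `|z - w| ^+ 2.
Proof.
move=> w0 phiw dphi phib z zw.
have b0 : 0 <= b by apply: le_trans (phib z zw); rewrite exprn_ge0.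
have bE : b = ((Re b)%:C)%C by rewrite RRe_real// ger0_real.
have Rb0 : 0 <= Re b by rewrite -ler0c -bE.
have := schwarz_half_plane w0 phiw dphi (fun z zw => normc_le_sqrt (phib z zw)) zw.
set q := normc (phi z); set m := normc (z - w^*%C); set mu := normc (z - w) => le1.
have : (q * m) ^+ 2 <= (Num.sqrt (Re b) * mu) ^+ 2.
  have q0 : 0 <= q := normc_ge0 _. have m0 : 0 <= m := normc_ge0 _.
  have mu0 : 0 <= mu := normc_ge0 _.
  by rewrite ler_sqr ?nnegrE ?mulr_ge0 ?sqrtr_ge0.
rewrite !exprMn sqr_sqrtr// => le2.
by rewrite bE !normCE -!rmorphXn -!rmorphM /= lecR.
Qed.

Lemma normc_diff_sqr z w : `|z - w^*| ^+ 2 - `|z - w| ^+ 2 = 4 * ('Im z * 'Im w).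
Proof.
rewrite !normCE !ImCE -!rmorphXn -rmorphB -rmorphM /=.
have -> : 4 = ((4 : R)%:C)%C :> C by rewrite rmorph_nat.
rewrite -rmorphM /=; congr (_%:C)%C.
by case: z w => a b [c e] /=; rewrite !sqr_sqrtr ?addr_ge0 ?sqr_ge0//; ring.
Qed.

(** The two-point Pick inequality.  With [S = f z - (f w)^*] and
    [Y = Im f(w) / Im w], the matrix [T = (f z - f w) S^-1] is a contraction
    for the norm of [Y^-1] and vanishes at [w], so that the lemma of Schwarz,
    applied to its coefficients, gains the factor [|z - w| / |z - w^*|]. *)
Lemma pick_inequality f z w x v : nevanlinna f -> nondegen f ->
  0 < Im z * Im w ->
  `|dot x ((f z - (f w) ^t*) *m v)| ^+ 2 <=
  dot x (nev_im f w *m x) * (dot v (nev_im f z *m v) * `|z - w^*| ^+ 2).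
Proof.
move=> nf ndf zw; set Y := nev_im f w.
have wz : 0 < Im w * Im z by rewrite mulrC.
have zR := same_side_nonreal zw; have wR := same_side_nonreal wz.
have w0 : Im w != 0 by rewrite -nonreal_Im.
have psdY : psd Y by exact: nev_im_psd.
have injY u : Y *m u = 0 -> u = 0 by exact: nev_im_inj.
have uY : Y \in unitmx by exact: unitmx_of_kernel.
have psdV := psd_inv psdY uY.
pose S z' := f z' - (f w) ^t*.
have Im_gt0 z' : 0 < Im z' * Im w -> 0 < 'Im z' * 'Im w.
  by rewrite !ImCE -rmorphM /= ltcR.
have uS z' : 0 < Im z' * Im w -> S z' \in unitmx.
  move=> z'w; have z'R := same_side_nonreal z'w.
  apply: (@two_point_unit _ _ (f z') (f w) (nev_im f z') Y ('Im z') ('Im w)).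
  - exact: nev_im_psd.
  - by [].
  - exact: Creal_Im.
  - exact: Im_neq0.
  - exact: nev_imE.
  - exact: nev_imE.
  - by apply: ltW; exact: Im_gt0.
  - by move=> u; exact: nev_im_inj.
have key z' u : 0 < Im z' * Im w ->
    dot ((f z' - f w) *m u) (invmx Y *m ((f z' - f w) *m u)) =
    dot (S z' *m u) (invmx Y *m (S z' *m u)) -
      4 * ('Im z' * 'Im w) * dot u (nev_im f z' *m u).
  move=> z'w; have z'R := same_side_nonreal z'w.
  rewrite (@two_point_identity _ _ (f z') (f w) (nev_im f z') Y ('Im z') ('Im w))//.
  - by congr (_ - _); ring.
  - exact: nev_imE.
  - exact: nev_imE.
pose phi x u z' := dot x ((f z' - f w) *m cramer (S z') *m u).
have dphi x' u z' : 0 < Im z' * Im w -> derivable (phi x' u) z' 1.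
  move=> z'w; have z'R := same_side_nonreal z'w.
  have Pc := @derivable_const C ^~ z'.
  have PD := fun h1 h2 : C -> C => @derivable_add C h1 h2 z'.
  have PM := fun h1 h2 : C -> C => @derivable_mul C h1 h2 z'.
  have df : entrywise (fun h : C -> C => derivable h z' 1) f.
    exact: nevanlinna_entrywise.
  have dS := entrywise_sub Pc PD PM df (entrywise_const Pc ((f w) ^t*)).
  have dk := entrywise_sub Pc PD PM df (entrywise_const Pc (f w)).
  have dT := entrywise_mul Pc PD PM dk (derivable_cramer dS (uS z' z'w)).
  have dTu := entrywise_mul Pc PD PM dT (entrywise_const Pc u).
  exact: (entrywise_mul Pc PD PM (entrywise_const Pc (x' ^t*)) dTu).
have phi_w x' u : phi x' u w = 0.
  by rewrite /phi subrr !mul0mx /dot mulmx0 mxE.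
have phi_le x' u z' : 0 < Im z' * Im w ->
    `|phi x' u z'| ^+ 2 <= dot x' (Y *m x') * dot u (invmx Y *m u).
  move=> z'w; have uSz := uS z' z'w; have z'R := same_side_nonreal z'w.
  rewrite /phi (cramerE uSz); pose v' := invmx (S z') *m u.
  have uE : u = S z' *m v' by rewrite mulKVmx.
  rewrite -mulmxA -/v'.
  rewrite -[X in dot x' X](mulKVmx uY).
  apply: le_trans (psd_cauchy_schwarz psdY _ _) _.
  apply: ler_wpM2l; first exact: psdY.2.
  rewrite (mulKVmx uY) -(psd_sym psdV) key// -uE gerBl.
  apply: mulr_ge0; last by case: (nev_im_psd nf z'R).
  by apply: mulr_ge0 => //; apply: ltW; exact: Im_gt0.
set k := f z - f w; set u0 := S z *m v.
pose x0 := invmx Y *m (k *m v).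
pose ka := dot (k *m v) x0; pose si := dot u0 (invmx Y *m u0).
have schw := schwarz_half_plane_sqr w0 (phi_w x0 u0) (fun z' => @dphi x0 u0 z')
  (fun z' => @phi_le x0 u0 z') zw.
have x0k : dot x0 (k *m v) = ka by rewrite /ka /x0 (psd_sym psdV).
have ka0 : 0 <= ka by exact: psdV.2.
have phiE : phi x0 u0 z = ka.
  by rewrite /phi (cramerE (uS z zw)) -mulmxA /u0 (mulKmx (uS z zw)) -/k x0k.
have yt0 := Im_gt0 z zw.
have si_le : si <= dot v (nev_im f z *m v) * `|z - w^*| ^+ 2.
  apply: (@pick_scalar _ ka si _ ('Im z * 'Im w) _ (`|z - w| ^+ 2)).
  - exact: ka0.
  - exact: (nev_im_psd nf zR).2.
  - by rewrite exprn_ge0.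
  - by rewrite exprn_ge0.
  - exact: yt0.
  - exact: (key z v zw).
  - exact: normc_diff_sqr.
  - by move: schw; rewrite phiE (ger0_norm ka0) {2}/x0 (mulKVmx uY) x0k.
rewrite -/u0 -[u0](mulKVmx uY).
apply: le_trans (psd_cauchy_schwarz psdY _ _) _.
apply: ler_wpM2l; first exact: psdY.2.
by rewrite (mulKVmx uY) -(psd_sym psdV).
Qed.

End Pick.

(** * The Pick inequality at a boundary point *)

(** For [F = f (i t)], [G = f (- i t) = F^*], this is [Im f(it) / t] as the mean
    of two slopes, which identifies its limit at [0] with the normal
    derivative. *)
Lemma symmetric_slopes (K : numClosedFieldType) n (F G B : 'M[K]_n) (t : K) : t != 0 ->
  2^-1 *: (('i * t)^-1 *: (F - B) + (- ('i * t))^-1 *: (G - B)) =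
  t^-1 *: ((2 * 'i)^-1 *: (F - G)).
Proof.
by move=> t0; apply/matrixP => i j; rewrite !mxE; field; rewrite t0 neq0Ci.
Qed.

Lemma continuous_dot (K : numClosedFieldType) n (x v : 'cV[K]_n) :
  continuous (fun M : 'M[K]_n => dot x (M *m v)).
Proof.
move=> M0.
pose P (h : 'M[K]_n -> K) := {for M0, continuous h}.
have Pc (c : K) : P (fun=> c) by exact: cst_continuous.
have PD (f g : 'M[K]_n -> K) : P f -> P g -> P (fun M => f M + g M) by exact: continuousD.
have PM (f g : 'M[K]_n -> K) : P f -> P g -> P (fun M => f M * g M) by exact: continuousM.
have Pid : entrywise P (fun M : 'M[K]_n => M) by move=> i j; exact: coord_continuous.
have PMv := entrywise_mul Pc PD PM Pid (entrywise_const Pc v).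
exact: (entrywise_mul Pc PD PM (entrywise_const Pc (x ^t*)) PMv).
Qed.

Lemma continuous_conj (K : numClosedFieldType) : continuous (@Num.conj K).
Proof.
move=> z; apply/(@cvgrPdist_lt K K K (nbhs z)) => e e0.
apply/nbhs_normP; exists e => // w /=; rewrite -rmorphB /= norm_conjC.
exact.
Qed.

Lemma cvg_adjmx (K : numClosedFieldType) n T (F : set_system T) {FF : Filter F}
    (A : T -> 'M[K]_n) (A0 : 'M[K]_n) :
  A x @[x --> F] --> A0 -> (A x) ^t* @[x --> F] --> A0 ^t*.
Proof.
move=> /cvg_entries cA; apply/cvg_entries => i j; rewrite !mxE.
rewrite (_ : (fun _ => _) = fun x => Num.conj (A x j i)); last by apply/funext => x; rewrite !mxE.
by apply: (@cvg_comp _ _ _ (fun x => A x j i) (@Num.conj K) F _ _ (cA j i)); exact: continuous_conj.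
Qed.

Section NormalLimits.
Variables (R : realType).
Local Notation C := (Cplx R).
Local Notation Re := (@complex.Re R).
Local Notation Im := (@complex.Im R).
Implicit Types y : R.

Lemma dnbhs0_opp : (- y : R) @[y --> 0^'] --> 0^'.
Proof.
move=> P P0; have : \forall y \near (0 : R), y != 0 -> P y := P0.
move=> /nbhs_normrP[r r0 rP].
change (\forall y \near (0 : R), y != 0 -> P (- y)).
apply/nbhs_normrP; exists r => // y yr y0; apply: rP; last by rewrite oppr_eq0.
by move: yr; rewrite !subr0 normrN.
Qed.

Lemma cvg_dnbhs0_opp (T : topologicalType) (h : R -> T) (l : T) :
  h y @[y --> 0^'] --> l -> h (- y) @[y --> 0^'] --> l.
Proof. by move=> hl; apply: (@cvg_comp _ _ _ (fun y : R => - y) h _ _ _ dnbhs0_opp hl). Qed.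

(** The sign of [s] selects a side of [0]. *)
Lemma side_limit_ge0 (E : R -> R) (e0 s r1 : R) : E y @[y --> 0^'] --> e0 -> s != 0 ->
  0 < r1 -> (forall y, 0 < y * s -> `|y| < r1 -> 0 <= E y) -> 0 <= e0.
Proof.
move=> cE s0 r10 Epos; rewrite leNgt; apply/negP => e0_lt.
have e0' : 0 < - e0 by rewrite oppr_gt0.
have /cvgrPdist_lt/(_ _ e0') := cE.
rewrite near_withinE => /nbhs_normrP[r2 r20 rP].
pose r := Num.min r1 r2; have r0 : 0 < r by rewrite lt_min r10.
pose y := r / 2 * Num.sg s.
have r_2 : 0 < r / 2 by rewrite divr_gt0.
have y0 : y != 0 by rewrite mulf_neq0 ?sgr_eq0// gt_eqF.
have : `|y| < r by rewrite normrM normr_sg s0 mulr1 gtr0_norm//; lra.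
rewrite lt_min => /andP[yr1 yr2].
have := rP y; rewrite subr0 => /(_ yr2 y0); have := ler_norm (E y - e0); rewrite distrC.
have ys : 0 < y * s by rewrite /y -mulrA -normrEsg mulr_gt0// normr_gt0.
by have := Epos y ys yr1; lra.
Qed.

Lemma cpt0_nonreal y : (cpt 0 y \isn't Num.real) = (y != 0).
Proof. by rewrite nonreal_Im. Qed.

Lemma conj_cpt0 y : (cpt 0 y)^* = cpt 0 (- y).
Proof. by []. Qed.

Lemma cpt0N y : cpt 0 (- y) = - cpt 0 y :> C.
Proof. by apply/eqP; rewrite eq_complex /= oppr0 !eqxx. Qed.

Lemma cpt0E y : cpt 0 y = 'i * ((y%:C)%C : C).
Proof. by apply/eqP; rewrite eq_complex /=; apply/andP; split; apply/eqP; ring. Qed.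

Lemma cvg_cpt0 : cpt 0 y @[y --> (0 : R)^'] --> (0 : C).
Proof.
apply: cvg_within_filter.
have := @continuous_cpt R R (cst 0) id 0; rewrite /prop_for /continuous_at /=.
by apply; [exact: cst_continuous|exact: cvg_id].
Qed.

Variable d : nat.
Implicit Types (f : C -> 'M[C]_d) (z w : C) (x v u : 'cV[C]_d) (A : 'M[C]_d).

Section Class1.
Variable f : C -> 'M[C]_d.
Hypothesis f1 : Nclass 1 0 f.
Local Notation b := (nderiv f 0 0).
Local Notation c := (nderiv f 0 1).

Let nf : nevanlinna f. Proof. by case: f1. Qed.

Lemma normal_value : f (cpt 0 y) @[y --> (0 : R)^'] --> b.
Proof. exact: (f1.2 0%N). Qed.

Lemma normal_slope : (cpt 0 y)^-1 *: (f (cpt 0 y) - b) @[y --> (0 : R)^'] --> c.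
Proof. exact: (f1.2 1%N). Qed.

Lemma nevanlinna_conj0 y : y != 0 -> (f (cpt 0 y)) ^t* = f (cpt 0 (- y)).
Proof. by move=> y0; have [_ sym_f _] := nf; rewrite sym_f ?cpt0_nonreal. Qed.

Lemma normal_value_herm : b ^t* = b.
Proof.
apply: (@cvg_unique _ _ ((fun y => f (cpt 0 (- y))) @ (0 : R)^')); first exact: norm_hausdorff.
- apply: cvg_trans (cvg_adjmx normal_value); apply: near_eq_cvg.
  rewrite near_withinE; near=> y => y0; exact: nevanlinna_conj0.
- exact: cvg_dnbhs0_opp normal_value.
Unshelve. all: by end_near. Qed.

Lemma nev_im_normal : nev_im f (cpt 0 y) @[y --> (0 : R)^'] --> c.
Proof.
have s1 := normal_slope; have s2 := cvg_dnbhs0_opp s1.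
have two0 : 2 != 0 :> C by rewrite pnatr_eq0.
have s3 : (2^-1 : C) *: ((cpt 0 y)^-1 *: (f (cpt 0 y) - b) +
    (cpt 0 (- y))^-1 *: (f (cpt 0 (- y)) - b)) @[y --> (0 : R)^'] --> (2^-1 : C) *: (c + c).
  by apply: cvgZ; [exact: cvg_cst|exact: cvgD].
have cE : 2^-1 *: (c + c) = c.
  have -> : c + c = (2 : C) *: c by rewrite scaler_nat mulr2n.
  by rewrite scalerA mulVf// scale1r.
rewrite cE in s3; refine (@cvg_dnbhs_eq R _ _ _ 0 _ _ s3) => y y0.
have y0' : (y%:C)%C != 0 :> C by rewrite eq_complex /= eqxx andbT.
rewrite cpt0N (cpt0E y) (symmetric_slopes _ _ _ y0') -cpt0E -cpt0N.
by rewrite /nev_im /Im_mx ImCE (nevanlinna_conj0 y0).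
Qed.

Lemma normal_slope_psd : psd c.
Proof.
split.
  apply: (@cvg_unique _ _ ((fun y => (nev_im f (cpt 0 y)) ^t* ) @ (0 : R)^')); first exact: norm_hausdorff.
    exact: cvg_adjmx nev_im_normal.
  refine (@cvg_dnbhs_eq R _ _ _ 0 _ _ nev_im_normal) => y y0.
  by have [-> _] := nev_im_psd nf (etrans (cpt0_nonreal y) y0).
move=> v; have cdot : dot v (nev_im f (cpt 0 y) *m v) @[y --> (0 : R)^'] --> dot v (c *m v).
  by apply: (@cvg_comp _ _ _ (fun y => nev_im f (cpt 0 y)) (fun M => dot v (M *m v)) _ _ _ nev_im_normal); exact: continuous_dot.
have cRe : Re (dot v (nev_im f (cpt 0 y) *m v)) @[y --> (0 : R)^'] --> Re (dot v (c *m v)).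
  by apply: (@cvg_comp _ _ _ _ (fun z : C => Re z) _ _ _ cdot); exact: continuous_Re.
have cIm : Im (dot v (nev_im f (cpt 0 y) *m v)) @[y --> (0 : R)^'] --> Im (dot v (c *m v)).
  by apply: (@cvg_comp _ _ _ _ (fun z : C => Im z) _ _ _ cdot); exact: continuous_Im.
have pos y : y != 0 -> 0 <= dot v (nev_im f (cpt 0 y) *m v).
  by move=> y0; apply: (nev_im_psd nf _).2; rewrite cpt0_nonreal.
have Re_ge0 : 0 <= Re (dot v (c *m v)).
  apply: (side_limit_ge0 cRe (oner_neq0 R) ltr01) => y; rewrite mulr1 => y0 _.
  by have := pos y (lt0r_neq0 y0); rewrite lecE => /andP[].
have Im_eq0 : Im (dot v (c *m v)) = 0.
  apply: (@cvg_unique _ _ (Im (dot v (nev_im f (cpt 0 y) *m v)) @[y --> (0 : R)^'])).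
  - exact: norm_hausdorff.
  - exact: cIm.
  - refine (@cvg_dnbhs_eq R _ (cst 0) _ 0 _ _ (@cvg_cst _ _ _ _ _)).
    by move=> y y0; have := pos y y0; rewrite lecE => /andP[/eqP].
by rewrite lecE /= Im_eq0 eqxx.
Qed.

Hypothesis ndf : nondegen f.

(** The Pick inequality at the boundary point [0] is the limit of the interior
    one as [w = iy] tends to [0] in the half-plane of [z]. *)
Lemma boundary_pick z x v : z \isn't Num.real ->
  `|dot x ((f z - b) *m v)| ^+ 2 <= dot x (c *m x) * (dot v (nev_im f z *m v) * `|z| ^+ 2).
Proof.
move=> zR; have Imz : Im z != 0 by rewrite -nonreal_Im.
have psdN := nev_im_psd nf zR.
have cnv := cvg_dnbhs0_opp normal_value.
have c1 : dot x ((f z - f (cpt 0 (- y))) *m v) @[y --> (0 : R)^'] --> dot x ((f z - b) *m v).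
  have cB : f z - f (cpt 0 (- y)) @[y --> (0 : R)^'] --> f z - b.
    by apply: cvgB; [exact: cvg_cst|exact: cnv].
  by apply: (@cvg_comp _ _ _ (fun y => f z - f (cpt 0 (- y))) (fun M => dot x (M *m v)) _ _ _ cB); exact: continuous_dot.
have c2 : dot x (nev_im f (cpt 0 y) *m x) @[y --> (0 : R)^'] --> dot x (c *m x).
  by apply: (@cvg_comp _ _ _ (fun y => nev_im f (cpt 0 y)) (fun M => dot x (M *m x)) _ _ _ nev_im_normal); exact: continuous_dot.
have c3 : `|z - cpt 0 (- y)| ^+ 2 @[y --> (0 : R)^'] --> `|z| ^+ 2.
  have c0 := cvg_dnbhs0_opp cvg_cpt0.
  have := cvg_sqr_norm (cvg_sub (@cvg_const C R (0 : R)^' _ z) c0).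
  by rewrite subr0; apply.
have cE : dot x (nev_im f (cpt 0 y) *m x) * (dot v (nev_im f z *m v) * `|z - cpt 0 (- y)| ^+ 2)
    - `|dot x ((f z - f (cpt 0 (- y))) *m v)| ^+ 2 @[y --> (0 : R)^'] -->
  dot x (c *m x) * (dot v (nev_im f z *m v) * `|z| ^+ 2) - `|dot x ((f z - b) *m v)| ^+ 2.
  apply: (@cvg_sub C); last by apply: (@cvg_sqr_norm C); exact: c1.
  apply: (@cvg_mul C); first exact: c2.
  by apply: (@cvg_mul C); [exact: cvg_const|exact: c3].
have cRe : Re (dot x (nev_im f (cpt 0 y) *m x) * (dot v (nev_im f z *m v) * `|z - cpt 0 (- y)| ^+ 2)
    - `|dot x ((f z - f (cpt 0 (- y))) *m v)| ^+ 2) @[y --> (0 : R)^'] -->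
  Re (dot x (c *m x) * (dot v (nev_im f z *m v) * `|z| ^+ 2) - `|dot x ((f z - b) *m v)| ^+ 2).
  by apply: (@cvg_comp _ _ _ _ (fun z : C => Re z) _ _ _ cE); exact: continuous_Re.
have Re_ge0 : 0 <= Re (dot x (c *m x) * (dot v (nev_im f z *m v) * `|z| ^+ 2) - `|dot x ((f z - b) *m v)| ^+ 2).
  apply: (side_limit_ge0 cRe Imz ltr01) => y yz _.
  have y0 : y != 0 by apply: contraTneq yz => ->; rewrite mul0r ltxx.
  have zw : 0 < Im z * Im (cpt 0 y) by rewrite mulrC.
  have := pick_inequality x v nf ndf zw.
  by rewrite nevanlinna_conj0// conj_cpt0 -subr_ge0 lecE => /andP[].
have rhs0 : 0 <= dot x (c *m x) * (dot v (nev_im f z *m v) * `|z| ^+ 2).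
  apply: mulr_ge0; first exact: normal_slope_psd.2.
  by apply: mulr_ge0; [exact: psdN.2|rewrite exprn_ge0].
have lhs0 : 0 <= `|dot x ((f z - b) *m v)| ^+ 2 by rewrite exprn_ge0.
rewrite -subr_ge0 lecE Re_ge0 andbT.
have im0 (p q : C) : 0 <= p -> 0 <= q -> Im (p - q) == Im (0 : C).
  move=> /ger0_Im p0 /ger0_Im q0; move: p0 q0; case: p q => ? ? [? ?] /= -> ->.
  by rewrite subrr.
exact: im0.
Qed.

End Class1.
End NormalLimits.

(** * The Schur transform *)

Section PsdSqrt.
Variables (K : numClosedFieldType) (n : nat).
Implicit Types (A : 'M[K]_n).

Lemma dot_diag (D : 'rV[K]_n) (v : 'cV[K]_n) :
  dot v (diag_mx D *m v) = \sum_i D 0 i * `|v i 0| ^+ 2.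
Proof.
rewrite dotE; apply: eq_bigr => i _; rewrite mul_diag_mx mxE.
by rewrite mulrCA normCK [v i 0 * _]mulrC.
Qed.

Lemma psd_sqrt_exists A : psd A -> exists2 S, psd S & S *m S = A.
Proof.
move=> [sA pA].
have nA : A \is normalmx by apply/normalmxP; rewrite sA.
have /orthomx_spectralP := nA.
set P := spectralmx A; set D := spectral_diag A => AE.
have uP : P \is unitarymx := spectral_unitarymx A.
have PP : P *m P ^t* = 1%:M by apply/unitarymxP.
have PP' : P ^t* *m P = 1%:M by apply: mulmx1C.
rewrite invmx_unitary// in AE.
have DE : P *m (A *m P ^t*) = diag_mx D.
  by rewrite AE -!mulmxA PP mulmx1 mulmxA PP mul1mx.
have D_ge0 i : 0 <= D 0 i.
  have := pA (P ^t* *m delta_mx i 0).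
  rewrite -dot_adj !mulmxA -[P *m A *m _]mulmxA DE dot_diag (bigD1 i)//= big1 ?addr0.
    by rewrite mxE !eqxx normr1 expr1n mulr1.
  by move=> k /negPf ki; rewrite mxE ki normr0 expr0n mulr0.
pose E := \row_i sqrtC (D 0 i).
have E_ge0 i : 0 <= E 0 i by rewrite mxE sqrtC_ge0.
exists (P ^t* *m diag_mx E *m P).
  split.
    rewrite !adjmxM trmxCK mulmxA; congr (_ *m _ *m _).
    apply/matrixP => i j; rewrite !mxE eq_sym rmorphMn /=.
    by case: eqVneq => [->|_]; rewrite ?mulr0n// conj_Creal// ger0_real// sqrtC_ge0.
  move=> v; rewrite -!mulmxA dot_adj trmxCK dot_diag sumr_ge0// => i _.
  by rewrite mulr_ge0 ?exprn_ge0.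
rewrite !mulmxA -[_ *m P *m P ^t*]mulmxA PP mulmx1 -[_ *m diag_mx E *m diag_mx E]mulmxA.
rewrite mulmx_diag AE; congr (_ *m diag_mx _ *m _).
by apply/rowP => i; rewrite !mxE -expr2 sqrtCK.
Qed.

End PsdSqrt.

Section SchurExpressions.
Variables (K : fieldType) (n : nat) (a h : 'M[K]_n) (z : K).
Hypotheses (z0 : z != 0) (ua : a \in unitmx) (uh : h \in unitmx).

Lemma schur_expr1_simpl :
  z^-1 *: (invmx a *m (h - z *: (a *m a)) *m invmx h *m a) =
  z^-1 *: 1%:M - a *m invmx h *m a.
Proof.
have -> : invmx a *m (h - z *: (a *m a)) *m invmx h *m a =
    1%:M - z *: (a *m invmx h *m a).
  rewrite mulmxBr !mulmxBl -scalemxAr -!scalemxAl.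
  by rewrite (mulKmx ua) (mulmxK uh) (mulVmx ua).
by rewrite scalerBr scalerA mulVf// scale1r.
Qed.

Lemma schur_expr2_simpl :
  z^-1 *: (a *m invmx h *m (h - z *: (a *m a)) *m invmx a) =
  z^-1 *: 1%:M - a *m invmx h *m a.
Proof.
have -> : a *m invmx h *m (h - z *: (a *m a)) *m invmx a =
    1%:M - z *: (a *m invmx h *m a).
  rewrite mulmxBr mulmxBl -scalemxAr -scalemxAl (mulmxKV uh) (mulmxV ua).
  by rewrite !mulmxA (mulmxK ua).
by rewrite scalerBr scalerA mulVf// scale1r.
Qed.

End SchurExpressions.

Section SchurTransform.
Variables (R : realType) (d : nat).
Local Notation C := (Cplx R).
Implicit Types (f : C -> 'M[C]_d) (z : C) (A : 'M[C]_d).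

Lemma psd_sqrtP A : psd A -> psd (psd_sqrt A) /\ psd_sqrt A *m psd_sqrt A = A.
Proof.
move=> pA; rewrite /psd_sqrt.
have [] := @xgetPex _ 0 [set S : 'M[C]_d | psdmx S /\ S *m S = A].
  by have [S pS SS] := psd_sqrt_exists pA; exists S; split=> //; apply/psdmxP.
by move=> /psdmxP.
Qed.

Lemma schur_expr1E b a f z : z != 0 -> a \in unitmx -> f z - b \in unitmx ->
  schur_expr1 b (a *m a) a f z = z^-1 *: 1%:M - a *m invmx (f z - b) *m a.
Proof. by move=> z0 ua uh; exact: (schur_expr1_simpl z0 ua uh). Qed.

Lemma schur_expr2E b a f z : z != 0 -> a \in unitmx -> f z - b \in unitmx ->
  schur_expr2 b (a *m a) a f z = z^-1 *: 1%:M - a *m invmx (f z - b) *m a.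
Proof. by move=> z0 ua uh; exact: (schur_expr2_simpl z0 ua uh). Qed.

Lemma nonreal_neq0 z : z \isn't Num.real -> z != 0.
Proof. by apply: contraNneq => ->; rewrite real0. Qed.

Section Nondegenerate.
Variable f : C -> 'M[C]_d.
Hypotheses (f1 : Nclass 1 0 f) (ndf : nondegen f).
Local Notation b := (nderiv f 0 0).
Local Notation c := (nderiv f 0 1).
Local Notation a := (psd_sqrt c).

Let nf : nevanlinna f. Proof. by case: f1. Qed.

(** The normal value is Hermitian, so it behaves like the value at a second
    point with imaginary part [Y = 0]. *)
Lemma sub_value_unit z : z \isn't Num.real -> f z - b \in unitmx.
Proof.
move=> zR; have := normal_value_herm f1 => bE.
rewrite -{1}bE.
apply: (@two_point_unit _ _ (f z) b (nev_im f z) 0 ('Im z) 0).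
- exact: nev_im_psd.
- split; first by rewrite trmx0 map_mx0.
  by move=> v; rewrite mul0mx -(scale0r v) dotZr mul0r.
- exact: Creal_Im.
- exact: Im_neq0.
- exact: nev_imE.
- by rewrite bE subrr scaler0.
- by rewrite mulr0.
- by move=> v; exact: nev_im_inj.
Qed.

(** By [boundary_pick] a kernel vector of [c] is orthogonal to the range of
    [f i - b], which is everything. *)
Lemma normal_slope_unit : c \in unitmx.
Proof.
pose i0 : C := cpt (0 : R) (1 : R).
have i_nonreal : i0 \isn't Num.real by exact: etrans (cpt0_nonreal (1 : R)) (oner_neq0 R).
have uh := sub_value_unit i_nonreal.
apply: unitmx_of_kernel => x cx.
have zero v : dot x ((f i0 - b) *m v) = 0.
  have := boundary_pick f1 ndf x v i_nonreal.
  rewrite cx (_ : dot x 0 = 0); last by rewrite -(scale0r x) dotZr mul0r.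
  rewrite mul0r => le0; apply/eqP; rewrite -normr_eq0 -sqrf_eq0 eq_le le0.
  by rewrite exprn_ge0.
apply: dot_eq0; have := zero (invmx (f i0 - b) *m x).
by rewrite (mulKVmx uh).
Qed.

Lemma sqrt_slope_unit : a \in unitmx.
Proof.
have [_ aa] := psd_sqrtP (normal_slope_psd f1).
by have := normal_slope_unit; rewrite -{1}aa unitmx_mul => /andP[].
Qed.

Lemma schur_transformE z : z \isn't Num.real ->
  schur_transform f z = z^-1 *: 1%:M - a *m invmx (f z - b) *m a.
Proof.
move=> zR; have [_ aa] := psd_sqrtP (normal_slope_psd f1).
rewrite /schur_transform -{1}aa schur_expr1E//; last exact: sub_value_unit.
  exact: nonreal_neq0.
exact: sqrt_slope_unit.
Qed.

Lemma schur_transform_valid : schur_expr_valid b c a f.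
Proof.
have [_ aa] := psd_sqrtP (normal_slope_psd f1).
split; first exact: sqrt_slope_unit.
  exact: sub_value_unit.
move=> z zR; have ua := sqrt_slope_unit; have uh := sub_value_unit zR.
by rewrite -{1 3}aa schur_expr1E ?schur_expr2E ?nonreal_neq0.
Qed.

End Nondegenerate.
End SchurTransform.

(** * Positivity of the Schur transform *)

Section SchurImaginaryPart.
Variables (K : numClosedFieldType) (n : nat).
Variables (a h M N : 'M[K]_n) (z y : K).
Hypotheses (psda : psd a) (uh : h \in unitmx).
Hypotheses (z0 : z != 0) (y0 : y != 0) (zE : z - z^* = 2 * 'i * y).
Local Notation G := (z^-1 *: 1%:M - a *m invmx h *m a).
Hypotheses (imh : h - h ^t* = (2 * 'i * y) *: N).
Hypotheses (imG : G - G ^t* = (2 * 'i * y) *: M).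

Lemma adjmx_schur : G ^t* = (z^*)^-1 *: 1%:M - a *m invmx (h ^t*) *m a.
Proof.
rewrite linearB linearZ /= map_mxB map_mxZ !adjmxM trmx1 map_mx1 (adjmx_inv uh) psda.1.
by rewrite fmorphV mulmxA.
Qed.

(** With [h u = a v], the form of [a h^-1 a] at [v] is that of [h] at [u],
    conjugated; the term [|v|^2 / |z|^2] comes from [1/z]. *)
Lemma schur_dot v (u := invmx h *m (a *m v)) :
  dot v (M *m v) = dot u (N *m u) - dot v v / `|z| ^+ 2.
Proof.
have i0 : 2 * 'i != 0 :> K by rewrite mulf_neq0 ?pnatr_eq0 ?neq0Ci.
have iy0 : 2 * 'i * y != 0 by rewrite mulf_neq0.
have im_dot (A B : 'M[K]_n) (x : 'cV[K]_n) : A - A ^t* = (2 * 'i * y) *: B ->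
    dot x (A *m x) - (dot x (A *m x))^* = 2 * 'i * y * dot x (B *m x).
  move=> AB; rewrite -dotC -dotZr scalemxAl -AB mulmxBl dotBr; congr (_ - _).
  by rewrite dot_adj trmxCK.
apply: (mulfI iy0); rewrite -(im_dot _ _ _ imG) mulrBr -(im_dot _ _ _ imh).
have hu : h *m u = a *m v by rewrite /u mulKVmx.
have -> : dot v (G *m v) = z^-1 * dot v v - dot (h *m u) u.
  by rewrite mulmxBl -scalemxAl mul1mx dotBr dotZr -!mulmxA (psd_sym psda) -/u hu.
have vv : (dot v v)^* = dot v v by rewrite -dotC.
rewrite (dotC u (h *m u)) rmorphB rmorphM /= vv conjCK.
set s := dot u (h *m u); set q := dot v v.
rewrite -zE normCK fmorphV; field.
by rewrite z0 conjC_eq0 z0.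
Qed.

End SchurImaginaryPart.

Lemma psd_Im_herm (K : numClosedFieldType) n (A : 'M[K]_n) (t : K) : t \is Num.real ->
  (t *: ((2 * 'i)^-1 *: (A - A ^t*))) ^t* = t *: ((2 * 'i)^-1 *: (A - A ^t*)).
Proof.
move=> /CrealP tR; apply/matrixP => i j; rewrite !mxE !rmorphM rmorphB fmorphV rmorphM /= tR.
rewrite conjCi conj_Creal ?realn// conjCK.
by field; rewrite neq0Ci.
Qed.

Section SchurNevanlinna.
Variables (R : realType) (d : nat).
Local Notation C := (Cplx R).
Local Notation Im := (@complex.Im R).
Implicit Types (z : C) (A : 'M[C]_d).

Lemma near_nonreal z : z \isn't Num.real -> \forall x \near z, x \isn't Num.real.
Proof.
rewrite nonreal_Im => z0; apply/nbhs_normcP; exists `|Im z|; first by rewrite normr_gt0.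
move=> x xz; rewrite nonreal_Im; apply: contraTneq xz => x0.
rewrite -leNgt; have := normc_Im_le (z - x); rewrite normc_sub_comm.
by move: x0; case: z x {z0} => ? ? [? ?] /= ->; rewrite subr0.
Qed.

Variable f : C -> 'M[C]_d.
Hypotheses (f1 : Nclass 1 0 f) (ndf : nondegen f).
Local Notation b := (nderiv f 0 0).
Local Notation c := (nderiv f 0 1).
Local Notation a := (psd_sqrt c).

Let nf : nevanlinna f. Proof. by case: f1. Qed.

Lemma schur_transform_entrywise z : z \isn't Num.real ->
  entrywise (fun h : C -> C => derivable h z 1) (schur_transform f).
Proof.
move=> zR.
have Pc := @derivable_const C ^~ z.
have PD := fun h1 h2 : C -> C => @derivable_add C h1 h2 z.
have PM := fun h1 h2 : C -> C => @derivable_mul C h1 h2 z.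
have df := nevanlinna_entrywise nf zR.
have dh := entrywise_sub Pc PD PM df (entrywise_const Pc b).
have dV := derivable_cramer dh (sub_value_unit f1 ndf zR).
have dz : derivable (fun x : C => x^-1) z 1.
  exact: (@derivableV C C (fun x => x) z 1 (nonreal_neq0 zR) (@derivable_var C z)).
have d1 := entrywise_scale PM dz (entrywise_const Pc (1%:M : 'M[C]_d)).
have da : entrywise (fun h : C -> C => derivable h z 1) (fun _ : C => a).
  exact: (entrywise_const Pc).
have d2 := entrywise_mul Pc PD PM (entrywise_mul Pc PD PM da dV) da.
have dg := entrywise_sub Pc PD PM d1 d2.
move=> i j; apply: (@near_eq_derivable C C C _ _ z 1 _ (dg i j)).
have nearR := near_nonreal zR.
near=> x; have xR : x \isn't Num.real by near: x.
by rewrite (schur_transformE f1 ndf xR) (cramerE (sub_value_unit f1 ndf xR)).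
Unshelve. all: by end_near. Qed.

(** By [schur_dot], positivity of [Im g(z) / Im z] at [v] is the inequality
    [boundary_pick] for [x = a^-1 v] and [u = (f z - b)^-1 a v], in which
    [x^* (f z - b) u] and [x^* c x] both are [|v|^2]. *)
Lemma schur_transform_nevanlinna : nevanlinna (schur_transform f).
Proof.
have [pa aa] := psd_sqrtP (normal_slope_psd f1).
have ua := sqrt_slope_unit f1 ndf.
have bE := normal_value_herm f1.
have sym_g z : z \isn't Num.real -> (schur_transform f z) ^t* = schur_transform f z^*.
  move=> zR; have zR' : z^* \isn't Num.real.
    by move: zR; rewrite !nonreal_Im; case: (z) => ? ? /=; rewrite oppr_eq0.
  rewrite (schur_transformE f1 ndf zR) (schur_transformE f1 ndf zR').
  have [_ sym_f _] := nf.
  have -> : f z^* - b = (f z - b) ^t*.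
    by rewrite linearB map_mxB /= bE sym_f.
  exact: (adjmx_schur z pa (sub_value_unit f1 ndf zR)).
split.
- by move=> z zR; apply/derivable_entries; exact: schur_transform_entrywise.
- exact: sym_g.
move=> z zR; apply/psdmxP; split; first by apply: psd_Im_herm; rewrite rpredV; exact: Creal_Im.
move=> v; rewrite -/(nev_im (schur_transform f) z).
have uh := sub_value_unit f1 ndf zR.
pose u := invmx (f z - b) *m (a *m v).
have psdN := nev_im_psd nf zR.
have nz0 : 0 < `|z| ^+ 2 by rewrite exprn_gt0// normr_gt0 nonreal_neq0.
rewrite (@schur_dot _ _ a (f z - b) _ (nev_im f z) z ('Im z) pa uh (nonreal_neq0 zR) (Im_neq0 zR)); first last.
- by rewrite -(schur_transformE f1 ndf zR); exact: nev_imE.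
- have -> : (f z - b) ^t* = (f z) ^t* - b by rewrite linearB map_mxB /= bE.
  by rewrite opprB addrA subrK; exact: nev_imE.
- by have := subcJ z; rewrite ImCE mulrAC.
rewrite -/u subr_ge0 ler_pdivrMr//.
have hu : (f z - b) *m u = a *m v by rewrite /u mulKVmx.
have := boundary_pick f1 ndf (invmx a *m v) u zR.
have xv : dot (invmx a *m v) (a *m v) = dot v v.
  by rewrite -(psd_sym (psd_inv pa ua)) (mulKmx ua).
have cx : c *m (invmx a *m v) = a *m v.
  transitivity ((a *m a) *m (invmx a *m v)); first by rewrite aa.
  by rewrite -mulmxA (mulKVmx ua).
rewrite hu cx xv ger0_norm ?dot_ge0// expr2.
have [->|v0] := eqVneq (dot v v) 0.
  by move=> _; apply: mulr_ge0; [exact: psdN.2|exact: ltW].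
by rewrite ler_pM2l// lt_def v0 dot_ge0.
Qed.

End SchurNevanlinna.

(** * Expansions along the imaginary axis *)

Lemma derive1_add (K : numFieldType) (f g : K -> K) (z : K) :
  derivable f z 1 -> derivable g z 1 ->
  derive1 (fun x => f x + g x) z = derive1 f z + derive1 g z.
Proof. by move=> df dg; rewrite !derive1E; exact: (@deriveD K K K f g z 1 df dg). Qed.

Section AxisExpansions.
Variable R : realType.
Local Notation C := (Cplx R).
Implicit Types (u v w s x f g : C -> C) (z a l : C) (J m k : nat).

Definition hol u := forall z, z \isn't Num.real -> derivable u z 1.

(** The limit of [u] at [0] along the imaginary axis.  A one-constructor type
    rather than a definition, so that unification does not unfold it to an
    inclusion of filters. *)
Variant axis_lim u l : Prop :=
  AxisLim of u (cpt 0 y) @[y --> (0 : R)^'] --> l.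

(** The Euler operator, which preserves the order of vanishing at [0]. *)
Definition theta u z := z * derive1 u z.

Definition eq_off_axis u v := forall z, z \isn't Num.real -> u z = v z.

Lemma near_eq_off u v z : eq_off_axis u v -> z \isn't Num.real ->
  \forall x \near z, u x = v x.
Proof. by move=> uv zR; have := near_nonreal zR; apply: filterS => x; exact: uv. Qed.

Lemma hol_ext u v : eq_off_axis u v -> hol u -> hol v.
Proof.
move=> uv hu z zR; exact: (@near_eq_derivable C C C u v z 1 (near_eq_off uv zR) (hu z zR)).
Qed.

Lemma derive1_ext u v : eq_off_axis u v -> eq_off_axis (derive1 u) (derive1 v).
Proof.
move=> uv z zR; rewrite !derive1E; exact: (@near_eq_derive C C C u v z 1 (near_eq_off uv zR)).
Qed.

Lemma theta_ext u v : eq_off_axis u v -> eq_off_axis (theta u) (theta v).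
Proof. by move=> uv z zR; rewrite /theta (derive1_ext uv zR). Qed.

Lemma axis_lim_ext u v l : eq_off_axis u v -> axis_lim u l -> axis_lim v l.
Proof.
move=> uv [ul]; split; refine (@cvg_dnbhs_eq R C (fun y => u (cpt 0 y)) (fun y => v (cpt 0 y)) 0 l _ ul) => y y0.
by apply: uv; rewrite cpt0_nonreal.
Qed.

Lemma axis_lim_unique u l l' : axis_lim u l -> axis_lim u l' -> l = l'.
Proof.
move=> [ul] [ul']; exact: (@cvg_unique _ (@norm_hausdorff C C) (u (cpt 0 y) @[y --> (0 : R)^']) _ l l' ul ul').
Qed.

Lemma hol_const a : hol (fun=> a). Proof. by move=> z _; exact: derivable_const. Qed.
Lemma hol_id : hol (fun z => z). Proof. by move=> z _; exact: derivable_var. Qed.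
Lemma hol_add u v : hol u -> hol v -> hol (fun z => u z + v z).
Proof. by move=> hu hv z zR; exact: (@derivable_add C u v z (hu z zR) (hv z zR)). Qed.
Lemma hol_mul u v : hol u -> hol v -> hol (fun z => u z * v z).
Proof. by move=> hu hv z zR; exact: (@derivable_mul C u v z (hu z zR) (hv z zR)). Qed.
Lemma hol_inv u : (forall z, z \isn't Num.real -> u z != 0) -> hol u -> hol (fun z => (u z)^-1).
Proof. by move=> u0 hu z zR; exact: (@derivableV C C u z 1 (u0 z zR) (hu z zR)). Qed.
Lemma hol_derive1 u : hol u -> hol (derive1 u).
Proof.
move=> hu z zR; apply: derivable_derive1.
by have := near_nonreal zR; apply: filterS => x; exact: hu.
Qed.
Lemma hol_theta u : hol u -> hol (theta u).
Proof. by move=> hu; apply: hol_mul; [exact: hol_id|exact: hol_derive1]. Qed.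

Lemma theta_const a : theta (fun=> a) =1 fun=> 0.
Proof. by move=> z; rewrite /theta (@derive1_cst C C a z) mulr0. Qed.

Lemma theta_id : theta (fun z => z) =1 fun z => z.
Proof. by move=> z; rewrite /theta derive1E (@derive_id C C z 1) mulr1. Qed.

Lemma theta_add u v : hol u -> hol v ->
  eq_off_axis (theta (fun z => u z + v z)) (fun z => theta u z + theta v z).
Proof.
move=> hu hv z zR; rewrite /theta (@derive1_add C u v z (hu z zR) (hv z zR)).
exact: mulrDr.
Qed.

Lemma theta_mul u v : hol u -> hol v ->
  eq_off_axis (theta (fun z => u z * v z)) (fun z => theta u z * v z + u z * theta v z).
Proof.
move=> hu hv z zR; rewrite /theta (@derive1_mul C u v z (hu z zR) (hv z zR)).
by rewrite mulrDr (mulrCA z (u z)) (mulrA z (derive1 u z)).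
Qed.

Lemma theta_inv u : (forall z, z \isn't Num.real -> u z != 0) -> hol u ->
  eq_off_axis (theta (fun z => (u z)^-1)) (fun z => - ((u z)^-1 * (theta u z * (u z)^-1))).
Proof.
move=> u0 hu z zR; have hw := hol_inv u0 hu.
have uw : eq_off_axis (fun z => u z * (u z)^-1) (fun=> 1).
  by move=> x xR; rewrite mulfV// u0.
have := theta_mul hu hw zR; rewrite (theta_ext uw zR) theta_const => /esym/eqP.
rewrite addr_eq0 => /eqP E; rewrite E mulrN opprK mulrA mulVf ?u0//.
by rewrite mul1r.
Qed.

(** [small J u]: the functions [u], [z u'], [z (z u')'], and so on, [J + 1]
    of them, tend to [0] at [0] along the imaginary axis. *)
Fixpoint small J u : Prop :=
  axis_lim u 0 /\ if J is J'.+1 then small J' (theta u) else True.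

Lemma small_lim J u : small J u -> axis_lim u 0.
Proof. by case: J => [|J] [ul _]; exact: ul. Qed.

Lemma small_ext J u v : eq_off_axis u v -> small J u -> small J v.
Proof.
elim: J u v => [|J IH] u v uv [ul su].
  exact: (conj (axis_lim_ext uv ul) I).
exact: (conj (axis_lim_ext uv ul) (IH _ _ (theta_ext uv) su)).
Qed.

Lemma smallS J u : small J.+1 u -> small J u.
Proof.
elim: J u => [|J IH] u [ul su]; first exact: (conj ul I).
exact: (conj ul (IH _ su)).
Qed.

Lemma axis_lim_const a : axis_lim (fun=> a) a.
Proof. by split; exact: cvg_const. Qed.

Lemma axis_lim_id : axis_lim (fun z => z) 0.
Proof. by split; exact: cvg_cpt0. Qed.

Lemma axis_lim_add u v a l : axis_lim u a -> axis_lim v l -> axis_lim (fun z => u z + v z) (a + l).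
Proof. by move=> [ua] [vl]; split; apply: (@cvg_add C); [exact: ua|exact: vl]. Qed.

Lemma axis_lim_mul u v a l : axis_lim u a -> axis_lim v l -> axis_lim (fun z => u z * v z) (a * l).
Proof. by move=> [ua] [vl]; split; apply: (@cvg_mul C); [exact: ua|exact: vl]. Qed.

Lemma smallSI J u : axis_lim u 0 -> small J (theta u) -> small J.+1 u.
Proof. by move=> ul su; exact: (conj ul su). Qed.

Lemma small0I u : axis_lim u 0 -> small 0 u.
Proof. by move=> ul; exact: (conj ul I). Qed.

Lemma small_theta J u : small J.+1 u -> small J (theta u).
Proof. by case. Qed.

Lemma axis_lim_add0 u v : axis_lim u 0 -> axis_lim v 0 -> axis_lim (fun z => u z + v z) 0.
Proof. by move=> ul vl; have := axis_lim_add ul vl; rewrite addr0. Qed.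

Lemma axis_lim_mul0 u v l : axis_lim u 0 -> axis_lim v l -> axis_lim (fun z => u z * v z) 0.
Proof. by move=> ul vl; have := axis_lim_mul ul vl; rewrite mul0r. Qed.

Lemma small_add J u v : hol u -> hol v -> small J u -> small J v -> small J (fun z => u z + v z).
Proof.
elim: J u v => [|J IH] u v hu hv su sv.
  exact: (small0I (axis_lim_add0 (small_lim su) (small_lim sv))).
apply: smallSI; first exact: (axis_lim_add0 (small_lim su) (small_lim sv)).
apply: (@small_ext J (fun z => theta u z + theta v z)).
  by move=> z zR; rewrite (theta_add hu hv zR).
exact: (IH _ _ (hol_theta hu) (hol_theta hv) (small_theta su) (small_theta sv)).
Qed.

Lemma small_mul J u v : hol u -> hol v -> small J u -> small J v -> small J (fun z => u z * v z).
Proof.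
elim: J u v => [|J IH] u v hu hv su sv.
  exact: (small0I (axis_lim_mul0 (small_lim su) (small_lim sv))).
apply: smallSI; first exact: (axis_lim_mul0 (small_lim su) (small_lim sv)).
apply: (@small_ext J (fun z => theta u z * v z + u z * theta v z)).
  by move=> z zR; rewrite (theta_mul hu hv zR).
have hu' := hol_theta hu; have hv' := hol_theta hv.
apply: (small_add (hol_mul hu' hv) (hol_mul hu hv')).
  exact: (IH _ _ hu' hv (small_theta su) (smallS sv)).
exact: (IH _ _ hu hv' (smallS su) (small_theta sv)).
Qed.

Lemma small0 J : small J (fun=> 0).
Proof.
elim: J => [|J IH]; first exact: (small0I (axis_lim_const 0)).
apply: (smallSI (axis_lim_const 0)); apply: small_ext IH => z _.
by rewrite theta_const.
Qed.

Lemma small_scale J a u : hol u -> small J u -> small J (fun z => a * u z).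
Proof.
have lim v : axis_lim v 0 -> axis_lim (fun z => a * v z) 0.
  by move=> vl; have := axis_lim_mul (axis_lim_const a) vl; rewrite mulr0.
elim: J u => [|J IH] u hu su; first exact: (small0I (lim _ (small_lim su))).
apply: (smallSI (lim _ (small_lim su))).
apply: (@small_ext J (fun z => a * theta u z)).
  by move=> z zR; rewrite (theta_mul (@hol_const a) hu zR) theta_const mul0r add0r.
exact: (IH _ (hol_theta hu) (small_theta su)).
Qed.

Lemma small_id J : small J (fun z => z).
Proof.
elim: J => [|J IH]; first exact: (small0I axis_lim_id).
apply: (smallSI axis_lim_id); apply: small_ext IH => z _.
by rewrite theta_id.
Qed.

(** [taylor J m u]: [u] has an expansion of order [m] at [0] along the imaginary
    axis, which can be differentiated [J] times: with [theta = z d/dz], the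
    remainder is [o(z^m)] together with its first [J] images under [theta]. *)
Fixpoint taylor J m u : Prop :=
  if m is m'.+1 then
    exists (u0 : C) v, [/\ hol v, taylor J m' v & eq_off_axis u (fun z => u0 + z * v z)]
  else exists (u0 : C) v, [/\ hol v, small J v & eq_off_axis u (fun z => u0 + v z)].

Lemma taylor_ext J m u v : eq_off_axis u v -> taylor J m u -> taylor J m v.
Proof.
by case: m => [|m] uv [u0 [w [hw sw uE]]]; exists u0, w; split=> // z zR; rewrite -(uv z zR) (uE z zR).
Qed.

Lemma taylorSJ J m u : taylor J.+1 m u -> taylor J m u.
Proof.
elim: m u => [|m IH] u [u0 [v [hv sv uE]]]; exists u0, v.
  by split; [exact: hv|exact: smallS|exact: uE].
by split; [exact: hv|exact: IH|exact: uE].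
Qed.

Lemma taylor_of_small J u : hol u -> small J u -> taylor J 0 u.
Proof. by move=> hu su; exists 0, u; split=> // z _; rewrite add0r. Qed.

Lemma taylor_mulz J m v : hol v -> taylor J m v -> taylor J m.+1 (fun z => z * v z).
Proof. by move=> hv tv; exists 0, v; split=> // z _; rewrite add0r. Qed.

Lemma taylor_const J m a : taylor J m (fun=> a).
Proof.
elim: m a => [|m IH] a; exists a, (fun=> 0).
  by split; [exact: hol_const|exact: small0|move=> z _; rewrite addr0].
by split; [exact: hol_const|exact: IH|move=> z _; rewrite mulr0 addr0].
Qed.

Lemma taylor_add J m u v : taylor J m u -> taylor J m v -> taylor J m (fun z => u z + v z).
Proof.
elim: m u v => [|m IH] u v [u0 [u' [hu' su' uE]]] [v0 [v' [hv' sv' vE]]];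
  exists (u0 + v0), (fun z => u' z + v' z); split.
- exact: hol_add.
- exact: small_add.
- by move=> z zR; rewrite (uE z zR) (vE z zR) addrACA.
- exact: hol_add.
- exact: IH.
- by move=> z zR; rewrite (uE z zR) (vE z zR) addrACA mulrDr.
Qed.

Lemma taylor_scale J m a u : taylor J m u -> taylor J m (fun z => a * u z).
Proof.
elim: m u => [|m IH] u [u0 [v [hv sv uE]]]; exists (a * u0), (fun z => a * v z); split.
- exact: (hol_mul (@hol_const a)).
- exact: small_scale.
- by move=> z zR; rewrite (uE z zR) mulrDr.
- exact: (hol_mul (@hol_const a)).
- exact: IH.
- by move=> z zR; rewrite (uE z zR) mulrDr mulrCA.
Qed.

Lemma taylorSm J m u : taylor J m.+1 u -> taylor J m u.
Proof.
elim: m u => [|m IH] u [u0 [v [hv tv uE]]].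
  case: tv => v0 [s [hs ss vE]].
  exists u0, (fun z => v0 * z + z * s z); split.
  - apply: hol_add; first exact: (hol_mul (@hol_const v0) hol_id).
    exact: (hol_mul hol_id hs).
  - apply: small_add.
    + exact: (hol_mul (@hol_const v0) hol_id).
    + exact: (hol_mul hol_id hs).
    + exact: (small_scale _ hol_id (small_id J)).
    + exact: (small_mul hol_id hs (small_id J) ss).
  - by move=> z zR; rewrite (uE z zR) (vE z zR) mulrDr (mulrC z).
by exists u0, v; split; [exact: hv|exact: IH|exact: uE].
Qed.

Lemma taylor_mul J m u v : taylor J m u -> taylor J m v -> taylor J m (fun z => u z * v z).
Proof.
elim: m u v => [|m IH] u v tu tv; have [u0 [u' [hu' su' uE]]] := tu;
  have [v0 [v' [hv' sv' vE]]] := tv.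
  exists (u0 * v0), (fun z => u0 * v' z + v0 * u' z + u' z * v' z).
  have h1 := hol_mul (@hol_const u0) hv'; have h2 := hol_mul (@hol_const v0) hu'.
  have h3 := hol_mul hu' hv'; have h12 := hol_add h1 h2.
  split; first exact: (hol_add h12 h3).
    apply: (small_add h12 h3); last exact: small_mul.
    by apply: (small_add h1 h2); exact: small_scale.
  by move=> z zR; rewrite (uE z zR) (vE z zR); ring.
exists (u0 * v0), (fun z => u0 * v' z + v0 * u' z + z * (u' z * v' z)).
have h1 := hol_mul (@hol_const u0) hv'; have h2 := hol_mul (@hol_const v0) hu'.
have h3 := hol_mul hu' hv'; have h12 := hol_add h1 h2.
have h4 := hol_mul hol_id h3.
split; first exact: (hol_add h12 h4).
  apply: taylor_add; last exact: (taylorSm (taylor_mulz h3 (IH _ _ su' sv'))).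
  by apply: taylor_add; exact: taylor_scale.
by move=> z zR; rewrite (uE z zR) (vE z zR); ring.
Qed.

Lemma taylor_lim J m u : taylor J m u -> exists l, axis_lim u l.
Proof.
elim: m u => [|m IH] u [u0 [v [hv tv uE]]].
  exists u0; apply: (@axis_lim_ext (fun z => u0 + v z)); first by move=> z zR; rewrite (uE z zR).
  by have := axis_lim_add (axis_lim_const u0) (small_lim tv); rewrite addr0.
have [l vl] := IH _ tv; exists u0.
apply: (@axis_lim_ext (fun z => u0 + z * v z)); first by move=> z zR; rewrite (uE z zR).
have := axis_lim_add (axis_lim_const u0) (axis_lim_mul axis_lim_id vl).
by rewrite mul0r addr0.
Qed.

Lemma taylorS_lim J m u l : taylor J m.+1 u -> axis_lim u l ->
  exists v, [/\ hol v, taylor J m v & eq_off_axis u (fun z => l + z * v z)].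
Proof.
move=> [u0 [v [hv tv uE]]] ul; exists v; split=> //.
have [lv vl] := taylor_lim tv; suff -> : l = u0 by [].
apply: (axis_lim_unique ul); apply: (@axis_lim_ext (fun z => u0 + z * v z)).
  by move=> z zR; rewrite (uE z zR).
have := axis_lim_add (axis_lim_const u0) (axis_lim_mul axis_lim_id vl).
by rewrite mul0r addr0.
Qed.

Lemma taylor0_lim J u l : taylor J 0 u -> axis_lim u l ->
  exists v, [/\ hol v, small J v & eq_off_axis u (fun z => l + v z)].
Proof.
move=> [u0 [v [hv tv uE]]] ul; exists v; split=> //.
suff -> : l = u0 by [].
apply: (axis_lim_unique ul); apply: (@axis_lim_ext (fun z => u0 + v z)).
  by move=> z zR; rewrite (uE z zR).
by have := axis_lim_add (axis_lim_const u0) (small_lim tv); rewrite addr0.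
Qed.

(** By induction: [theta (s / u) = theta s / u - (s theta u / u) / u] is a
    combination of quotients of the same kind, with one derivative less to
    control. *)
Lemma small_mul_inv J s u t (u0 : C) : hol s -> hol u -> hol t ->
  (forall z, z \isn't Num.real -> u z != 0) -> axis_lim (fun z => (u z)^-1) u0^-1 ->
  eq_off_axis (theta t) (theta u) -> small J t -> small J s ->
  small J (fun z => s z * (u z)^-1).
Proof.
move=> hs hu ht uN0 wl tu; have hw := hol_inv uN0 hu.
elim: J s hs => [|J IH] s hs st ss.
  exact: (small0I (axis_lim_mul0 (small_lim ss) wl)).
apply: (smallSI (axis_lim_mul0 (small_lim ss) wl)).
have hs' := hol_theta hs; have hu' := hol_theta hu.
have hsu := hol_mul hs hu'.
pose r z := s z * theta u z * (u z)^-1.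
have hr : hol r by exact: (hol_mul hsu hw).
apply: (@small_ext J (fun z => theta s z * (u z)^-1 + (-1) * (r z * (u z)^-1))).
  move=> z zR; rewrite (theta_mul hs hw zR) (theta_inv uN0 hu zR) /r.
  by move: (u z)^-1 (theta s z) (theta u z) (s z) => w q1 q2 q3; ring.
have st' := smallS st; have su' : small J (theta u) := small_ext tu (small_theta st).
apply: small_add.
- exact: (hol_mul hs' hw).
- exact: (hol_mul (@hol_const (-1)) (hol_mul hr hw)).
- exact: (IH _ hs' st' (small_theta ss)).
apply: (small_scale _ (hol_mul hr hw)); apply: (IH _ hr st').
apply: (IH _ hsu st'); exact: (small_mul hs hu' (smallS ss) su').
Qed.

Lemma axis_lim_inv u l : axis_lim u l -> l != 0 -> axis_lim (fun z => (u z)^-1) l^-1.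
Proof. by move=> [ul] l0; split; apply: (@cvgV C R _ _ (fun y => u (cpt 0 y)) l l0 ul). Qed.

(** For [u = u0 + z v] one has [1/u = u0^-1 - z v / (u0 u)], where [1/u] already
    has an expansion of one order less. *)
Lemma taylor_inv J m u (u0 : C) : hol u -> taylor J m u -> axis_lim u u0 -> u0 != 0 ->
  (forall z, z \isn't Num.real -> u z != 0) -> taylor J m (fun z => (u z)^-1).
Proof.
move=> hu tu ul u00 uN0; have hw := hol_inv uN0 hu; have wl := axis_lim_inv ul u00.
elim: m tu => [|m IH] tu.
  have [s [hs ss uE]] := taylor0_lim tu ul.
  have tsu : eq_off_axis (theta s) (theta u).
    move=> z zR; rewrite (theta_ext uE zR) (theta_add (@hol_const u0) hs zR).
    by rewrite theta_const add0r.
  exists u0^-1, (fun z => (- u0^-1) * (s z * (u z)^-1)); split.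
  - exact: (hol_mul (@hol_const _) (hol_mul hs hw)).
  - by apply: (small_scale _ (hol_mul hs hw)); exact: (small_mul_inv hs hu hs uN0 wl tsu ss ss).
  - move=> z zR; have := uE z zR => uzE; have uz0 := uN0 z zR.
    have -> : s z = u z - u0 by rewrite uzE addrC addKr.
    by field; rewrite uz0 u00.
have [v [hv tv uE]] := taylorS_lim tu ul.
have tw := IH (taylorSm tu).
exists u0^-1, (fun z => (- u0^-1) * (v z * (u z)^-1)); split.
- exact: (hol_mul (@hol_const _) (hol_mul hv hw)).
- by apply: taylor_scale; exact: taylor_mul.
- move=> z zR; have uz0 := uN0 z zR.
  have : z * v z = u z - u0 by rewrite (uE z zR) addrC addKr.
  move: (u z) (v z) uz0 => p q p0 E.
  have -> : u0^-1 + z * (- u0^-1 * (q * p^-1)) = u0^-1 - u0^-1 * p^-1 * (z * q) by ring.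
  by rewrite E; field; rewrite p0 u00.
Qed.

End AxisExpansions.

(** * Derivatives of expansions *)

Section AxisCalculus.
Variable R : realType.
Local Notation C := (Cplx R).
Implicit Types (u v w s x f g F : C -> C) (z a l : C) (J m k : nat) (y t : R).

(** Differentiating costs one of the [J] derivatives of the remainder; [theta]
    keeps the order, and [d/dz] lowers it by one. *)
Lemma taylor_theta J m u : hol u -> taylor J.+1 m u -> taylor J m (theta u).
Proof.
elim: m u => [|m IH] u hu [u0 [v [hv tv uE]]].
  apply: (@taylor_ext _ J 0 (theta v)).
    by move=> z zR; rewrite (theta_ext uE zR) (theta_add (@hol_const R u0) hv zR) theta_const add0r.
  exact: (taylor_of_small (hol_theta hv) (small_theta tv)).
apply: (@taylor_ext _ J m.+1 (fun z => z * (v z + theta v z))).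
  move=> z zR; have hzv := hol_mul (@hol_id R) hv.
  rewrite (theta_ext uE zR) (theta_add (@hol_const R u0) hzv zR) theta_const add0r.
  by rewrite (theta_mul (@hol_id R) hv zR) theta_id mulrDr.
apply: taylor_mulz; first exact: (hol_add hv (hol_theta hv)).
by apply: taylor_add; [exact: taylorSJ|exact: IH].
Qed.

Lemma taylor_derive1 J m u : hol u -> taylor J.+1 m.+1 u -> taylor J m (derive1 u).
Proof.
move=> hu [u0 [v [hv tv uE]]].
apply: (@taylor_ext _ J m (fun z => v z + theta v z)).
  move=> z zR; have hzv := hol_mul (@hol_id R) hv.
  apply: (mulfI (nonreal_neq0 zR)); rewrite -/(theta u z).
  rewrite (theta_ext uE zR) (theta_add (@hol_const R u0) hzv zR) theta_const add0r.
  by rewrite (theta_mul (@hol_id R) hv zR) theta_id mulrDr.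
by apply: taylor_add; [exact: taylorSJ|exact: taylor_theta].
Qed.

Lemma taylor_theta_lim J m u : hol u -> taylor J.+1 m u -> axis_lim (theta u) 0.
Proof.
move=> hu; case: m => [|m] [u0 [v [hv tv uE]]].
  apply: (@axis_lim_ext _ (theta v)); last exact: (small_lim (small_theta tv)).
  by move=> z zR; rewrite (theta_ext uE zR) (theta_add (@hol_const R u0) hv zR) theta_const add0r.
have tu' : taylor J m (derive1 u).
  by apply: taylor_derive1 => //; exists u0, v; split.
have [l ul] := taylor_lim tu'.
by have := axis_lim_mul (@axis_lim_id R) ul; rewrite mul0r.
Qed.

Lemma is_derive_of_expansion (f : R -> R) t (d : R) :
  (forall e : R, 0 < e -> exists2 r : R, 0 < r & forall h, `|h| < r ->
     `|f (t + h) - f t - d * h| <= e * `|h|) -> is_derive t 1 f d.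
Proof.
move=> fd.
have cd : (fun h => h^-1 *: (f (h *: 1 + t) - f t)) @ 0^' --> d.
  apply/(@cvgrPdist_le R R R (0^')) => e e0; have [r r0 rP] := fd e e0.
  rewrite near_withinE; apply/nbhs_normrP; exists r => // h; rewrite subr0 => hr h0.
  have := rP h hr; rewrite /GRing.scale/= mulr1 (addrC h).
  have -> : f (t + h) - f t - d * h = - ((d - h^-1 * (f (t + h) - f t)) * h) by field.
  by rewrite normrN normrM ler_pM2r// normr_gt0.
apply: DeriveDef; first by apply/cvg_ex; exists d.
exact: (@cvg_lim R (@norm_hausdorff R R) _ _ _ _ d cd).
Qed.

Lemma cpt0D t h : cpt 0 (t + h) = cpt 0 t + cpt 0 h :> C.
Proof. by apply/eqP; rewrite eq_complex /= addr0 !eqxx. Qed.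

Lemma normc_cpt0 t : normc (cpt 0 t) = `|t|.
Proof. by rewrite /= expr0n add0r sqrtr_sqr. Qed.

(** A mean value inequality between [0] and [iy], for the real and for the
    imaginary part of [F]. *)
Section Component.
Variable part : C -> R.
Hypothesis part_le : forall z, `|part z| <= normc z.
Hypothesis partB : forall z l, part (z - l) = part z - part l.
Hypothesis partZ : forall t z, part ((t%:C)%C * z) = t * part z.

Lemma axis_is_derive F t : derivable F (cpt 0 t) 1 ->
  is_derive t 1 (fun y => part (F (cpt 0 y))) (part ('i * derive1 F (cpt 0 t))).
Proof.
move=> dF; apply: is_derive_of_expansion => e e0.
have [r r0 rP] := derivable_expansionC dF e0.
exists r => // h hr; have := rP (cpt 0 h); rewrite normc_cpt0 => /(_ hr) le_e.
rewrite cpt0D; apply: le_trans le_e; apply: le_trans (part_le _).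
rewrite le_eqVlt; apply/orP; left; apply/eqP; congr (`| _ |).
rewrite !partB; congr (_ - _).
have -> : derive1 F (cpt 0 t) * cpt 0 h = (h%:C)%C * ('i * derive1 F (cpt 0 t)).
  by rewrite (cpt0E h) [LHS]mulrC -mulrA [RHS]mulrCA.
by rewrite partZ mulrC.
Qed.

Lemma axis_part_bound F y (M : R) : hol F -> y != 0 -> axis_lim F 0 ->
  continuous part -> part 0 = 0 ->
  (forall t, t != 0 -> `|t| <= `|y| -> normc (derive1 F (cpt 0 t)) <= M) ->
  `|part (F (cpt 0 y))| <= M * `|y|.
Proof.
move=> hF y0 [F0] cpart part0 FM.
pose phi t := part (F (cpt 0 t)).
have dphi t : t != 0 -> is_derive t 1 phi (part ('i * derive1 F (cpt 0 t))).
  by move=> t0; apply: axis_is_derive; apply: hF; rewrite cpt0_nonreal.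
have dle t : t != 0 -> `|t| <= `|y| -> `|part ('i * derive1 F (cpt 0 t))| <= M.
  move=> t0 ty; apply: le_trans (part_le _) _; rewrite normcM.
  have -> : normc ('i : C) = 1 by rewrite /= expr0n add0r expr1n sqrtr1.
  by rewrite mul1r FM.
have M0 : 0 <= M by apply: le_trans (FM y y0 (lexx _)); exact: normc_ge0.
have seg t b : t <= b -> (forall q, t <= q <= b -> q != 0 /\ `|q| <= `|y|) ->
    b - t <= `|y| -> `|phi b - phi t| <= M * `|y|.
  move=> tb qP bt.
  have [q /qP[q0 qy] ->] := mvt_is_derive tb (fun q qtb => dphi q (qP q qtb).1).
  rewrite normrM; apply: ler_pM => //; first exact: dle.
  by rewrite ger0_norm// subr_ge0.
have step t : 0 < t * y -> `|t| < `|y| -> `|phi y - phi t| <= M * `|y|.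
  move=> ty t_lt; have [y_gt0|y_le0] := ltP 0 y.
    have t0 : 0 < t by rewrite -(pmulr_lgt0 _ y_gt0).
    have t_lt' : t < y by move: t_lt; rewrite (gtr0_norm t0) (gtr0_norm y_gt0).
    apply: (seg t y (ltW t_lt')); last by rewrite (gtr0_norm y_gt0) gerBl ltW.
    move=> q /andP[tq qy]; have q0 : 0 < q by apply: lt_le_trans tq.
    by rewrite (gt_eqF q0) (gtr0_norm q0) (gtr0_norm y_gt0).
  have y_lt0 : y < 0 by rewrite lt_neqAle y0.
  have t0 : t < 0 by rewrite -(nmulr_lgt0 _ y_lt0).
  have t_lt' : y < t by move: t_lt; rewrite (ltr0_norm t0) (ltr0_norm y_lt0) ltrN2.
  rewrite distrC; apply: (seg y t (ltW t_lt')); last by rewrite (ltr0_norm y_lt0); lra.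
  move=> q /andP[yq qt]; have q0 : q < 0 by apply: le_lt_trans qt _.
  by rewrite (lt_eqF q0) (ltr0_norm q0) (ltr0_norm y_lt0) lerN2.
have cphi : phi t @[t --> (0 : R)^'] --> (0 : R).
  have : phi t @[t --> (0 : R)^'] --> part 0.
    by apply: (@cvg_comp _ _ _ (fun t => F (cpt 0 t)) part _ _ _ F0); exact: cpart.
  by rewrite part0.
have cE : M * `|y| + `|phi t| - `|phi y| @[t --> (0 : R)^'] --> M * `|y| + `|0 : R| - `|phi y|.
  apply: (@cvg_sub R); last exact: cvg_const.
  by apply: (@cvg_add R); [exact: cvg_const|exact: cvg_norm cphi].
have y_gt0 : 0 < `|y| by rewrite normr_gt0.
have := @side_limit_ge0 R (fun t => M * `|y| + `|phi t| - `|phi y|) _ y `|y| cE y0 y_gt0.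
rewrite normr0 addr0 subr_ge0; apply => t ty t_lt; rewrite subr_ge0.
have := step t ty t_lt; have := ler_normD (phi y - phi t) (phi t); rewrite subrK.
by lra.
Qed.

End Component.

Lemma axis_bound F y (M : R) : hol F -> y != 0 -> axis_lim F 0 ->
  (forall t, t != 0 -> `|t| <= `|y| -> normc (derive1 F (cpt 0 t)) <= M) ->
  normc (F (cpt 0 y)) <= 2 * (M * `|y|).
Proof.
move=> hF y0 F0 FM; apply: le_trans (normc_le _) _.
have -> : 2 * (M * `|y|) = M * `|y| + M * `|y| by ring.
apply: lerD; apply: axis_part_bound => //.
- exact: normc_Re_le.
- by case=> ? ? [].
- by move=> t [? ?] /=; ring.
- exact: continuous_Re.
- exact: normc_Im_le.
- by case=> ? ? [].
- by move=> t [? ?] /=; ring.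
- exact: continuous_Im.
Qed.

End AxisCalculus.

(** * The Euler equation *)

Section EulerEquation.
Variable R : realType.
Local Notation C := (Cplx R).
Implicit Types (u v w s x : C -> C) (z a l : C) (J m k : nat) (y t : R).

Lemma hol_exp k : hol (fun z : C => z ^+ k).
Proof.
elim: k => [|k IH]; first exact: hol_const.
by apply: hol_ext (hol_mul (@hol_id R) IH) => z _; rewrite exprS.
Qed.

Lemma theta_exp k : eq_off_axis (theta (fun z : C => z ^+ k)) (fun z => k%:R * z ^+ k).
Proof.
elim: k => [|k IH] z zR; first by rewrite theta_const mul0r.
have -> : theta (fun z : C => z ^+ k.+1) z = theta (fun z => z * z ^+ k) z.
  by apply: theta_ext zR => x _; rewrite exprS.
rewrite (theta_mul (@hol_id R) (@hol_exp k) zR) (IH z zR) theta_id.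
by rewrite mulrCA -exprS -natr1 mulrDl mul1r addrC.
Qed.

Lemma axis_lim0P u : axis_lim u 0 -> forall e : R, 0 < e ->
  exists2 r : R, 0 < r & forall y, y != 0 -> `|y| < r -> normc (u (cpt 0 y)) <= e.
Proof.
move=> [ul] e e0; have e0' : 0 < ((e%:C)%C : C) by rewrite ltcR.
have /cvgrPdist_le/(_ _ e0') := ul.
rewrite near_withinE => /nbhs_normrP[r r0 rP]; exists r => // y y0 yr.
by have := rP y; rewrite subr0 => /(_ yr y0); rewrite sub0r normrN normCE lecR.
Qed.

Lemma axis_lim0I u : (forall e : R, 0 < e ->
  exists2 r : R, 0 < r & forall y, y != 0 -> `|y| < r -> normc (u (cpt 0 y)) <= e) ->
  axis_lim u 0.
Proof.
move=> uP; split; apply/(@cvgrPdist_le C C R ((0 : R)^')) => e.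
case: e => e ei; rewrite ltcE/= => /andP[/eqP -> e0].
have [r r0 rP] := uP e e0; rewrite near_withinE; apply/nbhs_normrP; exists r => // y.
rewrite subr0 => yr y0; rewrite sub0r normrN normCE -[Complex e 0]/((e%:C)%C) lecR.
exact: rP.
Qed.

(** The Euler equation [z s' + (k+1) s = x], that is [(z^(k+1) s)' = z^k x],
    makes [s] tend to [0] along with [x]. *)
Lemma euler_axis_lim s x k : hol s -> axis_lim x 0 ->
  eq_off_axis (fun z => theta s z + k.+1%:R * s z) x ->
  axis_lim (fun z => z ^+ k.+1 * s z) 0 -> axis_lim s 0.
Proof.
move=> hs xl sE Wl; pose W z := z ^+ k.+1 * s z.
have hW : hol W by exact: (hol_mul (@hol_exp k.+1) hs).
have dW z : z \isn't Num.real -> derive1 W z = z ^+ k * x z.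
  move=> zR; have z0 := nonreal_neq0 zR; apply: (mulfI z0).
  rewrite -/(theta W z) (theta_mul (@hol_exp k.+1) hs zR) (theta_exp _ zR).
  rewrite -(sE z zR) exprS.
  by move: (theta s z) (s z) (z ^+ k) (k.+1%:R) => p q Z K; ring.
apply: axis_lim0I => e e0; have e20 : 0 < e / 2 by rewrite divr_gt0.
have [r r0 rP] := axis_lim0P xl e20; exists r => // y y0 yr.
have W_le : normc (W (cpt 0 y)) <= 2 * (`|y| ^+ k * (e / 2) * `|y|).
  apply: axis_bound => // t t0 ty.
  rewrite dW ?cpt0_nonreal// normcM; apply: ler_pM; rewrite ?normc_ge0//.
    have -> : normc (cpt 0 t ^+ k) = `|t| ^+ k.
      elim: (k) => [|j IH]; first by rewrite !expr0 normc1.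
      by rewrite !exprS normcM IH normc_cpt0.
    by apply: lerXn2r; rewrite ?nnegrE.
  by apply: rP => //; apply: le_lt_trans yr.
move: W_le; rewrite /W normcM.
have -> : normc (cpt 0 y ^+ k.+1) = `|y| ^+ k.+1.
  elim: (k.+1) => [|j IH]; first by rewrite !expr0 normc1.
  by rewrite !exprS normcM IH normc_cpt0.
have -> : 2 * (`|y| ^+ k * (e / 2) * `|y|) = `|y| ^+ k.+1 * e by rewrite exprS; field.
by rewrite ler_pM2l// exprn_gt0// normr_gt0.
Qed.

(** The equation gives [theta s] from [x] and [s]: the solution can be
    differentiated once more than the right-hand side. *)
Lemma euler_small s x k J : hol s -> hol x -> axis_lim s 0 -> small J x ->
  eq_off_axis (fun z => theta s z + k.+1%:R * s z) x -> small J.+1 s.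
Proof.
move=> hs hx sl sx sE.
have tE : eq_off_axis (fun z => x z + (- k.+1%:R) * s z) (theta s).
  by move=> z zR; rewrite -(sE z zR) mulNr addrK.
suff IH J' : (J' <= J.+1)%N -> small J' s by exact: (IH _ (leqnn _)).
elim: J' => [|J' IH] J'J; first exact: (small0I sl).
apply: (smallSI sl); apply: (small_ext tE); apply: small_add.
- exact: hx.
- exact: (hol_mul (@hol_const R _) hs).
- have lower n i : small (n + i) x -> small i x.
    by elim: n => [sx'|n IHn sx']; [exact: sx'|exact: (IHn (smallS sx'))].
  by apply: (lower (J - J')%N); rewrite (@subnK J' J J'J); exact: sx.
- exact: (small_scale _ hs (IH (ltnW J'J))).
Qed.

(** The constant term [e0] of [r] forces that of [s] to be [e0 / (k + 1)], and
    the quotient [(s - c0) / z] solves the equation with [k + 1] in place of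
    [k]. *)
Lemma euler_taylor m J s r k : hol s -> hol r -> taylor J m r ->
  eq_off_axis (fun z => theta s z + k.+1%:R * s z) r ->
  axis_lim (fun z => z ^+ k.+1 * s z) 0 -> taylor J.+1 m s.
Proof.
have k0 i : i.+1%:R != 0 :> C by rewrite pnatr_eq0.
have lim_exp j : axis_lim (fun z : C => z ^+ j.+1) 0.
  elim: j => [|j IHj]; first by apply: axis_lim_ext (@axis_lim_id R) => z _; rewrite expr1.
  apply: (@axis_lim_ext _ (fun z => z * z ^+ j.+1)); first by move=> z _; rewrite [RHS]exprS.
  exact: (axis_lim_mul0 (@axis_lim_id R) IHj).
have lim_sub g j a : axis_lim (fun z => z ^+ j.+1 * g z) 0 ->
    axis_lim (fun z => z ^+ j.+1 * (g z + - a)) 0.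
  move=> gl; apply: (@axis_lim_ext _ (fun z => z ^+ j.+1 * g z + z ^+ j.+1 * - a)).
    by move=> z _; rewrite mulrDr.
  apply: (axis_lim_add0 gl); exact: (axis_lim_mul0 (lim_exp j) (@axis_lim_const R (- a))).
elim: m s r k => [|m IH] s r k hs hr [e0 [v [hv tv rE]]] sE sl; pose c0 := e0 / k.+1%:R.
  pose s1 z := s z + - c0.
  have hs1 : hol s1 by exact: (hol_add hs (@hol_const R _)).
  have s1E : eq_off_axis (fun z => theta s1 z + k.+1%:R * s1 z) v.
    move=> z zR; rewrite /s1 (theta_add hs (@hol_const R _) zR) theta_const addr0.
    have := sE z zR; rewrite (rE z zR) mulrDr mulrN /c0 [_ * (e0 / _)]mulrC divfK// addrA => ->.
    by rewrite addrC addKr.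
  have lim0 : axis_lim (fun z => z ^+ k.+1 * s1 z) 0.
    by apply: lim_sub sl.
  have s1l := euler_axis_lim hs1 (small_lim tv) s1E lim0.
  exists c0, s1; split; [exact: hs1| |by move=> z _; rewrite /s1 addrC subrK].
  exact: (euler_small hs1 hv s1l tv s1E).
pose s1 z := z^-1 * (s z + - c0).
have hV : hol (fun z : C => z^-1) by apply: (hol_inv _ (@hol_id R)) => z; exact: nonreal_neq0.
have hsc : hol (fun z => s z + - c0) by exact: (hol_add hs (@hol_const R _)).
have hs1 : hol s1 by exact: (hol_mul hV hsc).
have s_s1 : eq_off_axis s (fun z => c0 + z * s1 z).
  by move=> z zR; rewrite /s1 mulrA mulfV ?nonreal_neq0// mul1r addrC subrK.
have s1E : eq_off_axis (fun z => theta s1 z + k.+2%:R * s1 z) v.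
  move=> z zR; have z0 := nonreal_neq0 zR; apply: (mulfI z0).
  have := sE z zR; rewrite (rE z zR) (theta_ext s_s1 zR).
  rewrite (theta_add (@hol_const R _) (hol_mul (@hol_id R) hs1) zR) theta_const add0r.
  rewrite (theta_mul (@hol_id R) hs1 zR) theta_id (s_s1 z zR).
  have kc : k.+1%:R * c0 = e0 by rewrite /c0 mulrC divfK.
  rewrite mulrDr kc => /eqP; rewrite addrCA (inj_eq (addrI _)) => /eqP <-.
  rewrite -[k.+2%:R]natr1; move: (theta s1 z) (s1 z) (k.+1%:R) => p q K; ring.
have lim1 : axis_lim (fun z => z ^+ k.+2 * s1 z) 0.
  apply: (@axis_lim_ext _ (fun z => z ^+ k.+1 * (s z + - c0))); last exact: lim_sub sl.
  by move=> z zR; rewrite /s1 [z ^+ k.+2]exprSr -mulrA (mulVKf (nonreal_neq0 zR)).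
exists c0, s1; split; [exact: hs1|exact: (IH _ _ _ hs1 hv tv s1E lim1)|exact: s_s1].
Qed.

End EulerEquation.

(** * Normal derivatives and expansions *)

Section NormalDerivatives.
Variable R : realType.
Local Notation C := (Cplx R).
Implicit Types (u v w s x : C -> C) (z a l : C) (J m k r : nat) (y t : R).

Lemma hol_derive1n k u : hol u -> hol (derive1n k u).
Proof. by move=> hu; elim: k => [//|k IH]; rewrite derive1nS; exact: hol_derive1. Qed.

Lemma taylor_derive1n k J m u : hol u -> taylor (k + J) (k + m) u ->
  taylor J m (derive1n k u).
Proof.
elim: k u => [|k IH] u hu tu; first exact: tu.
rewrite derive1Sn; apply: (IH _ (hol_derive1 hu)); exact: (taylor_derive1 hu tu).
Qed.

(** [c 0], ..., [c r] are the successive normal derivatives of [u] at [0]. *)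
Definition normal_data r u (c : nat -> C) := forall k, (k <= r)%N ->
  if k is j.+1 then axis_lim (fun z => z^-1 * (derive1n j u z - c j)) (c j.+1)
  else axis_lim u (c 0%N).

Lemma normal_data_derive1 r u c : normal_data r.+2 u c ->
  normal_data r.+1 (derive1 u) (fun k => c k.+1).
Proof.
move=> uc [|k] kr; last first.
  by apply: axis_lim_ext (uc k.+2 kr) => z _; rewrite derive1Sn.
have := axis_lim_add (axis_lim_mul (@axis_lim_id R) (uc 2%N isT)) (@axis_lim_const R (c 1%N)).
rewrite mul0r add0r; apply: axis_lim_ext => z zR.
by rewrite (mulVKf (nonreal_neq0 zR)) subrK derive1n1.
Qed.

(** By induction [(u' - c1) / z] has an expansion.  Writing
    [u = c0 + c1 z + z^2 s] turns it into [theta s + 2 s], and the Euler equation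
    transfers the expansion to [s]. *)
Lemma taylor_of_normal_data r u c : hol u -> normal_data r.+1 u c ->
  taylor r r (fun z => z^-1 * (u z - c 0%N)).
Proof.
elim: r u c => [|r IH] u c hu uc; pose q z := z^-1 * (u z - c 0%N).
  have hq : hol q.
    apply: hol_mul; first by apply: (hol_inv _ (@hol_id R)) => z; exact: nonreal_neq0.
    exact: (hol_add hu (@hol_const R _)).
  have ql : axis_lim q (c 1%N) := uc 1%N isT.
  exists (c 1%N), (fun z => q z + - c 1%N); split.
  - exact: (hol_add hq (@hol_const R _)).
  - apply: small0I; have := axis_lim_add ql (@axis_lim_const R (- c 1%N)).
    by rewrite subrr.
  - by move=> z zR; rewrite addrCA subrr addr0.
have hV : hol (fun z : C => z^-1) by apply: (hol_inv _ (@hol_id R)) => z; exact: nonreal_neq0.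
have hq : hol q by exact: (hol_mul hV (hol_add hu (@hol_const R _))).
have ql : axis_lim q (c 1%N) := uc 1%N isT.
pose s z := z^-1 * (q z + - c 1%N).
have hs : hol s by exact: (hol_mul hV (hol_add hq (@hol_const R _))).
have q_s : eq_off_axis q (fun z => c 1%N + z * s z).
  by move=> z zR; rewrite /s (mulVKf (nonreal_neq0 zR)) addrCA subrr addr0.
have u_s : eq_off_axis u (fun z => c 0%N + (c 1%N * z + z ^+ 2 * s z)).
  move=> z zR; have := q_s z zR; rewrite /q => E.
  have : u z - c 0%N = z * (c 1%N + z * s z) by rewrite -E (mulVKf (nonreal_neq0 zR)).
  move=> /eqP; rewrite subr_eq => /eqP ->.
  by move: (s z) (c 1%N) (c 0%N) => p c1 c0; ring.
pose q1 z := z^-1 * (derive1 u z - c 1%N).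
have hq1 : hol q1 by exact: (hol_mul hV (hol_add (hol_derive1 hu) (@hol_const R _))).
have tq1 : taylor r r q1 := IH _ _ (hol_derive1 hu) (normal_data_derive1 uc).
have hz2s := hol_mul (@hol_exp R 2) hs.
have hcz := hol_mul (@hol_const R (c 1%N)) (@hol_id R).
have sE : eq_off_axis (fun z => theta s z + 2%:R * s z) q1.
  move=> z zR; have z0 := nonreal_neq0 zR.
  have : theta u z = c 1%N * z + (2%:R * z ^+ 2 * s z + z ^+ 2 * theta s z).
    rewrite (theta_ext u_s zR) (theta_add (@hol_const R _) (hol_add hcz hz2s) zR) theta_const add0r.
    rewrite (theta_add hcz hz2s zR) (theta_mul (@hol_const R _) (@hol_id R) zR) theta_const theta_id mul0r add0r.
    by rewrite (theta_mul (@hol_exp R 2) hs zR) (theta_exp _ zR).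
  rewrite /q1 {1}/theta; move: (derive1 u z) (theta s z) (s z) (c 1%N) => D p q' c1 DE.
  apply: (mulfI z0); rewrite (mulVKf z0); apply: (mulfI z0).
  by rewrite mulrBr DE; ring.
have lim2 : axis_lim (fun z => z ^+ 2 * s z) 0.
  have q0 : axis_lim (fun z => q z + - c 1%N) 0.
    by have := axis_lim_add ql (@axis_lim_const R (- c 1%N)); rewrite subrr.
  apply: axis_lim_ext (axis_lim_mul0 (@axis_lim_id R) q0) => z zR.
  by rewrite /s expr2 -mulrA (mulVKf (nonreal_neq0 zR)).
exists (c 1%N), s; split; [exact: hs|exact: (euler_taylor hs hq1 tq1 sE lim2)|exact: q_s].
Qed.

Variable d : nat.
Implicit Types (G : C -> 'M[C]_d).

Definition hol_mx G := entrywise (@hol R) G.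

Lemma hol_mx_derive1n G k : hol_mx G -> hol_mx (derive1n k G) /\
  forall z i j, z \isn't Num.real -> (derive1n k G z) i j = derive1n k (fun z => G z i j) z.
Proof.
move=> hG; elim: k => [|k [hGk Gk]]; first by split.
have entry z i j : z \isn't Num.real ->
    (derive1n k.+1 G z) i j = derive1n k.+1 (fun z => G z i j) z.
  move=> zR; rewrite !derive1nS derive1_entries; last first.
    by apply/derivable_entries => i' j'; exact: hGk.
  by apply: derive1_ext zR => x xR; exact: Gk.
split; last exact: entry.
move=> i j; refine (@hol_ext R _ _ _ (@hol_derive1n k.+1 _ (hG i j))) => z zR.
exact: (esym (entry z i j zR)).
Qed.

Lemma nquotS_entry G k y i j : y != 0 -> hol_mx G ->
  (nquot G 0 k.+1 y) i j = (cpt 0 y)^-1 *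
    (derive1n k (fun z => G z i j) (cpt 0 y) - (nderiv G 0 k) i j).
Proof.
move=> y0 hG; rewrite /= !mxE (hol_mx_derive1n k hG).2 ?cpt0_nonreal//.
Qed.

Lemma Nclass_normal_data r G i j : hol_mx G ->
  (forall k, (k <= r)%N -> cvg (nquot G 0 k @ (0 : R)^')) ->
  normal_data r (fun z => G z i j) (fun k => (nderiv G 0 k) i j).
Proof.
move=> hG cG [|k] kr; have cl : nquot G 0 _ y @[y --> (0 : R)^'] --> nderiv G 0 _ := cG _ kr.
  by split; have /cvg_entries/(_ i j) := cl.
split; have /cvg_entries/(_ i j) := cl.
refine (@cvg_dnbhs_eq R C _ _ 0 _ _) => y y0.
exact: nquotS_entry.
Qed.

(** Each normal derivative spends one order of the expansion and one derivative
    of the remainder. *)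
Lemma nquot_of_taylor k J m G : hol_mx G ->
  (forall i j, taylor (k + J) (k + m) (fun z => G z i j)) ->
  exists L : 'M[C]_d, nquot G 0 k y @[y --> (0 : R)^'] --> L /\
    forall i j, axis_lim (derive1n k (fun z => G z i j)) (L i j).
Proof.
elim: k J m G => [|k IH] J m G hG tG.
  have /choice[l lP] : forall p : 'I_d * 'I_d, exists l, axis_lim (fun z => G z p.1 p.2) l.
    by move=> p; exact: taylor_lim (tG p.1 p.2).
  exists (\matrix_(i, j) l (i, j)); split; last by move=> i j; rewrite mxE; exact: (lP (i, j)).
  by apply/cvg_entries => i j; rewrite mxE; have [] := lP (i, j).
have tG' i j : taylor (k + J.+1) (k + m.+1) (fun z => G z i j) by rewrite !addnS; exact: tG.
have [L0 [nL0 dL0]] := IH _ _ _ hG tG'.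
have L0E : nderiv G 0 k = L0 by exact: (@cvg_lim _ (@norm_hausdorff C _) _ _ _ _ L0 nL0).
have /choice[l lP] : forall p : 'I_d * 'I_d, exists l,
    axis_lim (fun z => z^-1 * (derive1n k (fun z => G z p.1 p.2) z - L0 p.1 p.2)) l /\
    axis_lim (derive1n k.+1 (fun z => G z p.1 p.2)) l.
  case=> i j /=; have hu := @hol_derive1n k _ (hG i j).
  have tu := taylor_derive1n (hG i j) (tG' i j).
  have [v [hv tv uE]] := taylorS_lim tu (dL0 i j).
  have [l vl] := taylor_lim tv; exists l; split.
    apply: axis_lim_ext vl => z zR; rewrite (uE z zR) addrC addKr.
    by rewrite (mulKf (nonreal_neq0 zR)).
  have := axis_lim_add vl (taylor_theta_lim hv tv); rewrite addr0.
  apply: axis_lim_ext => z zR; apply: (mulfI (nonreal_neq0 zR)).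
  rewrite -[RHS]/(theta _ z) (theta_ext uE zR).
  rewrite (theta_add (@hol_const R _) (hol_mul (@hol_id R) hv) zR) theta_const add0r.
  by rewrite (theta_mul (@hol_id R) hv zR) theta_id mulrDr.
exists (\matrix_(i, j) l (i, j)); split; last by move=> i j; rewrite mxE; case: (lP (i, j)).
apply/cvg_entries => i j; rewrite mxE; have [[lim_l] _] := lP (i, j).
refine (@cvg_dnbhs_eq R C _ _ 0 _ _ lim_l) => y y0.
by rewrite nquotS_entry// L0E.
Qed.

End NormalDerivatives.

(** * Normal derivatives of the Schur transform *)

Lemma continuous_cramer (K : numFieldType) n (M0 : 'M[K]_n) : M0 \in unitmx ->
  entrywise (fun h : 'M[K]_n -> K => {for M0, continuous h}) (@cramer K n).
Proof.
move=> uM.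
pose P (h : 'M[K]_n -> K) := {for M0, continuous h}.
have Pc (c : K) : P (fun=> c) by exact: cst_continuous.
have PD (f g : 'M[K]_n -> K) : P f -> P g -> P (fun M => f M + g M) by exact: continuousD.
have PM (f g : 'M[K]_n -> K) : P f -> P g -> P (fun M => f M * g M) by exact: continuousM.
have Pid : entrywise P (fun M : 'M[K]_n => M) by move=> i j; exact: coord_continuous.
have Pdet : P (fun M => (\det M)^-1).
  have d0 : \det M0 != 0 by rewrite -unitfE.
  have Pd : P (fun M => \det M) := closed_det Pc PD PM Pid.
  exact: (continuousV d0 Pd).
exact: (entrywise_cramer Pc PD PM Pdet Pid).
Qed.

(** Expansions are available for Cramer's formula, and only after the factor [z]
    has been removed from [f z - b], which tends to [0]. *)
Lemma invmx_unscale (K : fieldType) n (z : K) (h : 'M[K]_n) : z != 0 -> h \in unitmx ->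
  invmx h = z^-1 *: cramer (z^-1 *: h) /\ z^-1 *: h \in unitmx.
Proof.
move=> z0 uh; have zV : z^-1 \is a GRing.unit by rewrite unitfE invr_eq0.
have uq : z^-1 *: h \in unitmx by rewrite unitmxZ.
by split=> //; rewrite (cramerE uq) invmxZ ?invrK ?scalerA ?mulVf ?scale1r.
Qed.

Section NormalDerivativesOfTransform.
Variables (R : realType) (d : nat).
Local Notation C := (Cplx R).
Implicit Types (z : C) (A M : 'M[C]_d).

Lemma Nclass_le r s (f : C -> 'M[C]_d) : (r <= s)%N -> Nclass s 0 f -> Nclass r 0 f.
Proof. by move=> rs [nf cf]; split=> // k kr; apply: cf; exact: leq_trans rs. Qed.

Lemma nevanlinna_hol f : nevanlinna f -> @hol_mx R d f.
Proof. by move=> nf i j z zR; exact: nevanlinna_entrywise. Qed.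

Variables (n : nat) (f : C -> 'M[C]_d).
Hypotheses (fn : Nclass n.+2 0 f) (ndf : nondegen f).
Local Notation b := (nderiv f 0 0).
Local Notation c := (nderiv f 0 1).
Local Notation a := (psd_sqrt c).

Let f1 : Nclass 1 0 f. Proof. exact: Nclass_le fn. Qed.

Let q z := z^-1 *: (f z - b).

Let P (h : C -> C) := hol h /\ taylor n.+1 n.+1 h.

Let P_const x : P (fun=> x).
Proof. by split; [exact: hol_const|exact: taylor_const]. Qed.

Let P_add g h : P g -> P h -> P (fun z => g z + h z).
Proof. by move=> [hg tg] [hh th]; split; [exact: hol_add|exact: taylor_add]. Qed.

Let P_mul g h : P g -> P h -> P (fun z => g z * h z).
Proof. by move=> [hg tg] [hh th]; split; [exact: hol_mul|exact: taylor_mul]. Qed.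

Let hf : hol_mx f. Proof. by apply: nevanlinna_hol; case: fn. Qed.

Let q_entry z i j : q z i j = z^-1 * (f z i j - b i j).
Proof. by rewrite !mxE. Qed.

Lemma expansion_quotient : entrywise P q.
Proof.
move=> i j; rewrite /P.
have -> : (fun z => q z i j) = (fun z => z^-1 * (f z i j - b i j)).
  by apply/funext => z; exact: q_entry.
split.
  have hV : hol (fun z : C => z^-1).
    by apply: (hol_inv _ (@hol_id R)) => z; exact: nonreal_neq0.
  exact: (hol_mul hV (hol_add (@hf i j) (@hol_const R (- b i j)))).
exact: (taylor_of_normal_data (@hf i j) (Nclass_normal_data i j hf fn.2)).
Qed.

Lemma quotient_axis_lim : q (cpt 0 y) @[y --> (0 : R)^'] --> c.
Proof. exact: normal_slope f1. Qed.

Lemma quotient_unit z : z \isn't Num.real -> q z \in unitmx.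
Proof. by move=> zR; exact: (invmx_unscale (nonreal_neq0 zR) (sub_value_unit f1 ndf zR)).2. Qed.

Lemma expansion_cramer : entrywise P (fun z => cramer (q z)).
Proof.
apply: (entrywise_cramer P_const P_add P_mul _ expansion_quotient).
have [hd td] := closed_det P_const P_add P_mul expansion_quotient.
have d0 z : z \isn't Num.real -> \det (q z) != 0.
  by move=> zR; rewrite -unitfE; exact: quotient_unit.
split; first exact: (hol_inv d0 hd).
have dc0 : \det c != 0 by rewrite -unitfE; exact: (normal_slope_unit f1 ndf).
apply: (@taylor_inv R n.+1 n.+1 _ (\det c) hd td _ dc0 d0).
split; apply: (@cvg_comp _ _ _ (fun y => q (cpt 0 y)) (fun M => \det M) _ _ _ quotient_axis_lim).
pose Q (h : 'M[C]_d -> C) := {for c, continuous h}.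
have Qc (x : C) : Q (fun=> x) by exact: cst_continuous.
have QD (g h : 'M[C]_d -> C) : Q g -> Q h -> Q (fun M => g M + h M) by exact: continuousD.
have QM (g h : 'M[C]_d -> C) : Q g -> Q h -> Q (fun M => g M * h M) by exact: continuousM.
have Qid : entrywise Q (fun M => M) by move=> i j; exact: coord_continuous.
exact: (closed_det Qc QD QM Qid).
Qed.

Let Phi z := 1%:M - a *m cramer (q z) *m a.

Lemma schur_transform_Phi z : z \isn't Num.real -> schur_transform f z = z^-1 *: Phi z.
Proof.
move=> zR; have [iE _] := invmx_unscale (nonreal_neq0 zR) (sub_value_unit f1 ndf zR).
rewrite (schur_transformE f1 ndf zR) iE -scalemxAr -scalemxAl.
by rewrite -scalerBr.
Qed.

Lemma expansion_Phi : entrywise P Phi.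
Proof.
apply: (entrywise_sub P_const P_add P_mul (entrywise_const P_const _)).
have Pa := @entrywise_const _ _ _ P_const d d a.
exact: (entrywise_mul P_const P_add P_mul (entrywise_mul P_const P_add P_mul Pa expansion_cramer) Pa).
Qed.

Lemma Phi_axis_lim i j : axis_lim (fun z => Phi z i j) 0.
Proof.
have uc : c \in unitmx := normal_slope_unit f1 ndf.
have [_ aa] := psd_sqrtP (normal_slope_psd f1).
have ua : a \in unitmx := sqrt_slope_unit f1 ndf.
pose Q (h : 'M[C]_d -> C) := {for c, continuous h}.
have Qc (x : C) : Q (fun=> x) by exact: cst_continuous.
have QD (g h : 'M[C]_d -> C) : Q g -> Q h -> Q (fun M => g M + h M) by exact: continuousD.
have QM (g h : 'M[C]_d -> C) : Q g -> Q h -> Q (fun M => g M * h M) by exact: continuousM.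
have Qa := @entrywise_const _ _ _ Qc d d a.
have Q1 := @entrywise_const _ _ _ Qc d d 1%:M.
have QP := entrywise_sub Qc QD QM Q1
  (entrywise_mul Qc QD QM (entrywise_mul Qc QD QM Qa (continuous_cramer uc)) Qa).
have Phi_c : (1%:M - a *m cramer c *m a) i j = 0.
  have -> : a *m cramer c *m a = 1%:M.
    by rewrite (cramerE uc); apply: mulmx1C; rewrite mulmxA aa mulmxV.
  by rewrite subrr mxE.
split; rewrite -[X in _ --> X]Phi_c.
exact: (@cvg_comp _ _ _ (fun y => q (cpt 0 y)) (fun M => (1%:M - a *m cramer M *m a) i j) _ _ _ quotient_axis_lim (QP i j)).
Qed.

(** [Phi] has an expansion without constant term, since [a c^-1 a = 1], and [g] is
    its quotient by [z]. *)
Lemma schur_transform_Nclass : Nclass n 0 (schur_transform f).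
Proof.
have ng := schur_transform_nevanlinna f1 ndf.
split; first exact: ng.
move=> k kn.
have tg i j : taylor n.+1 n (fun z => schur_transform f z i j).
  have [_ tP] := expansion_Phi i j.
  have [v [hv tv PE]] := taylorS_lim tP (Phi_axis_lim i j).
  apply: (@taylor_ext R _ _ v _ _ tv) => z zR.
  by rewrite (schur_transform_Phi zR) mxE (PE z zR) add0r (mulKf (nonreal_neq0 zR)).
have tg' i j : taylor (k + (n.+1 - k)) (k + (n - k)) (fun z => schur_transform f z i j).
  by rewrite (subnKC kn) (subnKC (leqW kn)); exact: tg.
have [L [gL _]] := nquot_of_taylor (nevanlinna_hol ng) tg'.
by apply/cvg_ex; exists L.
Qed.

End NormalDerivativesOfTransform.

(** * The Schur algorithm *)

Section SchurAlgorithm.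
Variables (R : realType) (d : nat).
Local Notation C := (Cplx R).
Implicit Types (f h : C -> 'M[C]_d) (z : C).

Lemma Nclass_oo_Nclass r h : Nclass_oo 0 h -> Nclass r 0 h.
Proof. by move=> [nh ch]; split. Qed.

Lemma schur_a_psd h : Nclass 1 0 h ->
  psdmx (schur_a h) /\ schur_a h *m schur_a h = nderiv h 0 1.
Proof.
move=> h1; have [pa aa] := psd_sqrtP (normal_slope_psd h1).
exact: (conj ((psdmxP _).2 pa) aa).
Qed.

Lemma schur_stepE h : Nclass 1 0 h -> schur_step h = schur_transform h.
Proof. by move=> h1; rewrite /schur_step (schur_a_psd h1).2. Qed.

Lemma schur_step_Nclass_oo h : Nclass_oo 0 h -> nondegen h -> Nclass_oo 0 (schur_step h).
Proof.
move=> hoo ndh; rewrite (schur_stepE (Nclass_oo_Nclass 1 hoo)).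
have gn n := schur_transform_Nclass (Nclass_oo_Nclass n.+2 hoo) ndh.
split; first by case: (gn 0%N).
by move=> k; apply: (gn k).2.
Qed.

Lemma schur_step_valid h : Nclass 1 0 h -> nondegen h ->
  schur_expr_valid (schur_b h) (schur_a h *m schur_a h) (schur_a h) h.
Proof. by move=> h1 ndh; rewrite (schur_a_psd h1).2; exact: schur_transform_valid. Qed.

Lemma schur_iterS f n h : schur_iter f n = Some h -> nondegen h ->
  schur_iter f n.+1 = Some (schur_step h).
Proof. by move=> /= -> /asboolP ->. Qed.

Lemma schur_iterS_Some f n h h' : schur_iter f n = Some h -> schur_iter f n.+1 = Some h' ->
  nondegen h /\ h' = schur_step h.
Proof. by move=> /= ->; case: asboolP => // ndh [->]. Qed.

Lemma schur_iter_Nclass_oo f n h : Nclass_oo 0 f -> schur_iter f n = Some h -> Nclass_oo 0 h.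
Proof.
move=> foo; elim: n h => [|n IH] h; first by case=> <-.
move=> hS; have [h0 fn] : exists h0, schur_iter f n = Some h0.
  by move: hS => /=; case: (schur_iter f n) => [h0 _|//]; exists h0.
have [ndh ->] := schur_iterS_Some fn hS.
exact: (schur_step_Nclass_oo (IH h0 fn) ndh).
Qed.

(** The algorithm never resumes once it has stopped. *)
Lemma schur_iter_prefix f n m : (m <= n)%N -> isSome (schur_iter f n) -> isSome (schur_iter f m).
Proof.
move=> mn; rewrite -(subnKC mn); elim: (n - m)%N => [|k IH]; first by rewrite addn0.
by rewrite addnS /= => H; apply: IH; case: (schur_iter f (m + k)) H.
Qed.

Lemma schur_iter_degen f N h : schur_iter f N = Some h -> degen h ->
  forall n, isSome (schur_iter f n) = (n <= N)%N.
Proof.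
move=> fN dh n; apply/idP/idP => [|nN]; last by apply: (schur_iter_prefix nN); rewrite fN.
rewrite leqNgt; apply: contraTN => Nn; apply/negP => /(schur_iter_prefix Nn) /=.
by rewrite fN asboolF.
Qed.

Lemma schur_iter_infinite f : (forall n h, schur_iter f n = Some h -> nondegen h) ->
  forall n, isSome (schur_iter f n).
Proof.
move=> ndf; elim=> [//|n]; case fn: (schur_iter f n) => [h|//] _.
by rewrite (schur_iterS fn (ndf _ _ fn)).
Qed.

End SchurAlgorithm.

Lemma invmx_1x1 (K : fieldType) (M : 'M[K]_1) i : M \in unitmx -> invmx M i i = (M i i)^-1.
Proof.
move=> uM; have /(congr1 (fun A : 'M[K]_1 => A i i)) := mulmxV uM.
rewrite !mxE big_ord1 !ord1 eqxx => E.
have M0 : M 0 0 != 0 by apply: contraTneq uM => M0; rewrite unitmxE det_mx11 M0 unitr0.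
by apply: (mulfI M0); rewrite E mulfV.
Qed.

Lemma schur_step_scalar (R : realType) (h : Cplx R -> 'M[Cplx R]_1) (z : Cplx R) (i : 'I_1) :
  Nclass 1 0 h -> nondegen h -> z \isn't Num.real ->
  schur_step h z i i = z^-1 * ((h z i i - schur_b h i i - schur_a h i i ^+ 2 * z)
                     / (h z i i - schur_b h i i)).
Proof.
move=> h1 ndh zR; rewrite (schur_stepE h1) (schur_transformE h1 ndh zR).
have uM := sub_value_unit h1 ndh zR.
have M0 : h z 0 0 - nderiv h 0 0 0 0 != 0.
  by apply: contraTneq uM => M0; rewrite unitmxE det_mx11 !mxE M0 unitr0.
have := invmx_1x1 0 uM; rewrite !ord1 !mxE !big_ord1 !mxE !big_ord1 => ->.
rewrite eqxx -/(schur_a h) -/(schur_b h).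
move: M0 (nonreal_neq0 zR); rewrite -/(schur_b h).
move: (h z 0 0) (schur_b h 0 0) (schur_a h 0 0) => p q a M0 z0.
by rewrite mulr1; field; rewrite M0 z0.
Qed.
Theorem theorem5p2 (R : realType) (d : nat) :
  (* the transformation f |-> g is well defined *)
  (forall f : Cplx R -> 'M[Cplx R]_d,
     Nclass 1 0 f -> nondegen f ->
     [/\ psdmx (psd_sqrt (nderiv f 0 1)),
         psd_sqrt (nderiv f 0 1) *m psd_sqrt (nderiv f 0 1) = nderiv f 0 1
       & schur_expr_valid (nderiv f 0 0) (nderiv f 0 1)
           (psd_sqrt (nderiv f 0 1)) f]) /\
  (* (i) *)
  (forall f : Cplx R -> 'M[Cplx R]_d,
     Nclass 1 0 f -> nondegen f -> nevanlinna (schur_transform f)) /\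
  (* (ii) *)
  (forall (r : nat) (f : Cplx R -> 'M[Cplx R]_d), (2 <= r)%N ->
     Nclass r 0 f -> nondegen f -> Nclass (r - 2) 0 (schur_transform f)) /\
  (* the Schur algorithm *)
  (forall f : Cplx R -> 'M[Cplx R]_d, Nclass_oo 0 f ->
     [/\ (* every generated iterate is Nevanlinna, with b_n and a_n available *)
         forall n h, schur_iter f n = Some h ->
           Nclass_oo 0 h /\
           psdmx (schur_a h) /\ schur_a h *m schur_a h = nderiv h 0 1,
         (* the recursion is valid at every non-degenerate iterate *)
         forall n h, schur_iter f n = Some h -> nondegen h ->
           schur_iter f n.+1 = Some (schur_step h) /\
           schur_expr_valid (schur_b h) (schur_a h *m schur_a h) (schur_a h) h,
         (* the scalar case *)
         d = 1%N -> forall n h h',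
           schur_iter f n = Some h -> schur_iter f n.+1 = Some h' ->
           forall (z : Cplx R) (i : 'I_d), z \isn't Num.real ->
             h' z i i =
             z^-1 * ((h z i i - schur_b h i i - schur_a h i i ^+ 2 * z)
                     / (h z i i - schur_b h i i)),
         (* a degenerate iterate f_N arises: exactly f_0, ..., f_N *)
         forall N h, schur_iter f N = Some h -> degen h ->
           forall n, isSome (schur_iter f n) = (n <= N)%N
       & (* no degenerate iterate arises: infinitely many iterates *)
         (forall n h, schur_iter f n = Some h -> nondegen h) ->
         forall n, isSome (schur_iter f n)]).
Proof.
split.
  move=> f f1 ndf; have [pa aa] := schur_a_psd f1.
  by split; [exact: pa|exact: aa|exact: (schur_transform_valid f1 ndf)].
split; first by move=> f f1 ndf; exact: (schur_transform_nevanlinna f1 ndf).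
split.
  move=> r f r2; rewrite -{1}(subnK r2) addn2 => fr ndf.
  exact: (schur_transform_Nclass fr ndf).
move=> f foo; split.
- move=> n h fn; have hoo := schur_iter_Nclass_oo foo fn.
  exact: (conj hoo (schur_a_psd (Nclass_oo_Nclass 1 hoo))).
- move=> n h fn ndh; have hoo := schur_iter_Nclass_oo foo fn.
  exact: (conj (schur_iterS fn ndh) (schur_step_valid (Nclass_oo_Nclass 1 hoo) ndh)).
- move=> d1; subst d => n h h' fn fn1 z i zR.
  have [ndh ->] := schur_iterS_Some fn fn1.
  exact: (schur_step_scalar i (Nclass_oo_Nclass 1 (schur_iter_Nclass_oo foo fn)) ndh zR).
- by move=> N h fN dh; exact: (schur_iter_degen fN dh).
- by move=> ndf n; exact: (schur_iter_infinite ndf n).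
Qed.
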